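(* Let $n\geqslant1$. (i) The products $\{\mathfrak{C}_\varpi(X)\mathfrak{C}_\lambda(X)\}$ for $\varpi\in S_n$ and $\lambda\in\mathcal{D}_n$ form a basis for the polynomial ring $\mathbb{Z}[X]$ as a $\mathbb{Z}[X]^{W_n}$-module. Moreover, we have the orthogonality relation $$\bigl\langle\mathfrak{C}_u(X)\mathfrak{C}_\lambda(X),\ \mathfrak{C}_{v\omega_0}(-\omega_0X)\mathfrak{C}_{\mu'}(X)\bigr\rangle=\delta_{u,v}\,\delta_{\lambda,\mu}$$ for all $u,v\in S_n$ and $\lambda,\mu\in\mathcal{D}_n$. (ii) Let $\mathfrak{C}_{\varpi,\lambda}(X)=\mathfrak{C}_\varpi(X)\mathfrak{C}_\lambda(X)$ and suppose $u,v\in S_n$ and $\lambda,\mu\in\mathcal{D}_n$ are such that $\ell(u)+\ell(v)=n(n-1)/2$. Then $$\bigl\langle\mathfrak{C}_{u,\lambda}(X),\mathfrak{C}_{v,\mu}(X)\bigr\rangle=\begin{cases}1&\text{if } v=\omega_0u\text{ and }\mu=\lambda',\\0&\text{otherwise.}\end{cases}$$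
   Context: $X=(x_1,\ldots,x_n)$, $Y=(y_1,\ldots,y_n)$ are commuting independent variables; $\omega_0=(n,n-1,\ldots,1)$ is the longest element of $S_n$; $f(-\omega_0X)$ denotes $f(-x_n,\ldots,-x_1)$. Weyl group and divided differences. $W_n$ is the hyperoctahedral group of signed permutations (a bar denotes a negative entry), generated by simple transpositions $s_i$ ($1\leqslant i\leqslant n-1$), generating $S_n\subset W_n$, and $s_0$; right multiplication by $s_i$ interchanges the entries in positions $i,i+1$, and $(u_1,\ldots,u_n)s_0=(\overline{u}_1,u_2,\ldots,u_n)$; $\ell$ is the length function, and $w_0=(\overline1,\ldots,\overline n)$ is the longest element. $W_n$ acts on polynomials in $X$ (with coefficients in $\mathbb{Z}$ or $\mathbb{Z}[Y]$): $s_i$ interchanges $x_i,x_{i+1}$, $s_0$ sends $x_1$ to $-x_1$; $\mathbb{Z}[X]^{W_n}$ is the ring of invariants. $\partial_i(f)=(f-s_if)/(x_i-x_{i+1})$ for $1\leqslant i\leqslant n-1$, $\partial_0(f)=(f-s_0f)/(2x_1)$; $\partial'_i=-\partial_i$ for $1\leqslant i\leqslant n-1$, $\partial'_0=\partial_0$. For a reduced word $w=s_{a_1}\cdots s_{a_r}$, $\partial_w=\partial_{a_1}\circ\cdots\circ\partial_{a_r}$ and $\partial'_w=\partial'_{a_1}\circ\cdots\circ\partial'_{a_r}$. Scalar product: the $\mathbb{Z}[X]^{W_n}$-linear pairing $\langle\ ,\ \rangle\colon\mathbb{Z}[X]\times\mathbb{Z}[X]\to\mathbb{Z}[X]^{W_n}$,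 $\langle f,g\rangle=\partial_{w_0}(fg)$. Polynomials. $\widetilde Q_i(X)=e_i(X)$ (elementary symmetric), $\widetilde Q_{i,j}=\widetilde Q_i\widetilde Q_j+2\sum_{k=1}^j(-1)^k\widetilde Q_{i+k}\widetilde Q_{j-k}$, and for $\lambda=(\lambda_1\geqslant\cdots\geqslant\lambda_r\geqslant0)$ with $r$ even (put $\lambda_r=0$ if necessary), $\widetilde Q_\lambda=\mathrm{Pfaffian}[\widetilde Q_{\lambda_i,\lambda_j}]_{1\leqslant i<j\leqslant r}$. $\mathcal{D}_n$ is the set of strict partitions (distinct nonzero parts, possibly none) with all parts at most $n$; $\lambda'$ is the strict partition whose parts are the complement of those of $\lambda$ in $\{1,\ldots,n\}$; $\widetilde Q(X,Y)=\sum_{\lambda\in\mathcal{D}_n}\widetilde Q_\lambda(X)\widetilde Q_{\lambda'}(Y)$; $\Delta(X,Y)=\prod_{i+j\leqslant n}(x_i-y_j)$. For $w\in W_n$, $\mathfrak{C}_w(X,Y)=(-1)^{n(n-1)/2}\,\partial'_{w^{-1}w_0}(\Delta(X,Y)\widetilde Q(X,Y))$ and $\mathfrak{C}_w(X)=\mathfrak{C}_w(X,0)$. For $\lambda\in\mathcal{D}_n$ with $\ell=\ell(\lambda)$ nonzero parts and $k=n-\ell$, $\mathfrak{C}_\lambda(X)=\mathfrak{C}_{w_\lambda}(X)$ with $w_\lambda=(\overline{\lambda}_1,\ldots,\overline{\lambda}_\ell,\lambda'_k,\ldots,\lambda'_1)$; one has $\mathfrak{C}_\lambda(X)=\widetilde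 Q_\lambda(X)$. *)

(* Defs.v *)
From HB Require Import structures.
From mathcomp Require Import all_boot all_order all_algebra all_fingroup.
From mathcomp Require Import mpoly.

Set Implicit Arguments.
Unset Strict Implicit.
Unset Printing Implicit Defensive.

Import GRing.Theory.
Local Open Scope ring_scope.

(* Indices are 0-based: 'X_i (i : 'I_n) is the variable x_{i+1}.              *)

(* The signed permutation (w_1, ..., w_n): |w_{i+1}| = sabs w i + 1, with a   *)
(* bar on w_{i+1} iff sbar w i.                                               *)
Record sperm (n : nat) := SPerm { sabs : 'S_n; sbar : {ffun 'I_n -> bool} }.

Section SignedPerm.
Variable n : nat.
Implicit Types u v w : sperm n.

Definition sperm_pair w := (sabs w, sbar w).
Definition pair_sperm (p : 'S_n * {ffun 'I_n -> bool}) := SPerm p.1 p.2.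
Fact sperm_pairK : cancel sperm_pair pair_sperm. Proof. by case. Qed.
HB.instance Definition _ := Finite.copy (sperm n) (can_type sperm_pairK).

Lemma sperm_eq u v : sabs u =1 sabs v -> sbar u =1 sbar v -> u = v.
Proof.
by case: u v => [p e] [q f] /= /permP-> ef; congr SPerm; apply/ffunP.
Qed.

(* Products are composed as functions, (u * v)(i) = u(v(i)), so that right    *)
(* multiplication acts on positions. The product of 'S_n in perm.v is         *)
(* opposite: (s * t) i = t (s i).                                             *)
Definition smul u v : sperm n :=
  SPerm (sabs v * sabs u)%g [ffun i => sbar v i (+) sbar u (sabs v i)].
Definition sone : sperm n := SPerm 1%g [ffun=> false].
Definition sinv u : sperm n :=
  SPerm (sabs u)^-1%g [ffun i => sbar u ((sabs u)^-1%g i)].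

Fact smulA : associative smul.
Proof.
move=> u v w; apply: sperm_eq => i /=; first by rewrite !permM.
by rewrite !ffunE /= !permM addbA.
Qed.

Fact smul1 : left_id sone smul.
Proof.
by move=> u; apply: sperm_eq => i /=; rewrite ?mulg1 // !ffunE addbF.
Qed.

Fact smulV : left_inverse sone sinv smul.
Proof.
move=> u; apply: sperm_eq => i /=; first by rewrite mulgV.
by rewrite !ffunE permK addbb.
Qed.

HB.instance Definition _ := Finite_isGroup.Build (sperm n) smulA smul1 smulV.

Definition semb (s : 'S_n) : sperm n := SPerm s [ffun=> false].

Definition prev_ord (i : 'I_n) : 'I_n :=
  Ordinal (leq_ltn_trans (leq_pred i) (ltn_ord i)).

(* The n generators s_0, s_1, ..., s_{n-1} are indexed by 'I_n; for i > 0,    *)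
(* s_i exchanges the 0-based positions i - 1 and i.                           *)
Definition simple (i : 'I_n) : sperm n :=
  if i == 0 :> nat then SPerm 1%g [ffun j => j == i]
  else semb (tperm (prev_ord i) i).

Definition w_zero : sperm n := SPerm 1%g [ffun=> true].
Definition omega_zero : sperm n := semb (perm (@rev_ord_inj n)).

Definition wprod (a : seq 'I_n) : sperm n := (\prod_(i <- a) simple i)%g.

Lemma sembM (s t : 'S_n) : semb (s * t)%g = (semb t * semb s)%g.
Proof. by apply: sperm_eq => i //=; rewrite !ffunE. Qed.

Lemma semb1 : semb 1%g = 1%g.
Proof. by []. Qed.

Let gens : {group sperm n} := [group of <<[set simple i | i : 'I_n]>>%g].

Let simple_gen i : simple i \in gens.
Proof. by rewrite mem_gen ?imset_f. Qed.

Let tperm_lt_gen d (i j : 'I_n) : j = (i + d.+1)%N :> nat ->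
  semb (tperm i j) \in gens.
Proof.
elim: d i j => [|d IH] i j ji.
  have -> : i = prev_ord j by apply: val_inj; rewrite /= ji addn1.
  by have := simple_gen j; rewrite /simple ji addn1.
have k_lt : (i.+1 < n)%N.
  by apply: leq_ltn_trans (ltn_ord j); rewrite ji addnS ltnS leq_addr.
pose k := Ordinal k_lt.
have ik : i != k by apply/eqP => /(congr1 val) /= /n_Sn.
have ij : i != j.
  by apply/eqP => /(congr1 val) /= eij; move: ji; rewrite eij -[LHS]addn0 => /addnI.
have -> : tperm i j = (tperm i k * tperm k j * tperm i k)%g.
  have := tpermJ k j (tperm i k); rewrite conjgE tpermV mulgA => ->.
  have kj : k != j.
    apply/eqP => /(congr1 val) /= kj; move: ji; rewrite -kj -addn1.
    by move/addnI.
  by rewrite tpermR tpermD.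
have tik : semb (tperm i k) \in gens.
  have := simple_gen k; rewrite /simple /=.
  by have -> : prev_ord k = i by apply: val_inj.
rewrite !sembM !groupM // IH //= ji !addnS.
by rewrite addSn.
Qed.

Let tperm_gen (i j : 'I_n) : semb (tperm i j) \in gens.
Proof.
case: (ltngtP i j) => [lij|lji|/val_inj->].
- by apply: (@tperm_lt_gen (j - i).-1); rewrite prednK ?subn_gt0 // subnKC // ltnW.
- rewrite tpermC; apply: (@tperm_lt_gen (i - j).-1).
  by rewrite prednK ?subn_gt0 // subnKC // ltnW.
- by rewrite tperm1 semb1 group1.
Qed.

Let semb_gen s : semb s \in gens.
Proof.
have [ts -> _] := prod_tpermP s.
elim: ts => [|t ts IH]; first by rewrite big_nil semb1 group1.
by rewrite big_cons sembM groupM ?tperm_gen.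
Qed.

Let flip (j : 'I_n) : sperm n := SPerm 1%g [ffun i => i == j].

Let flip_gen j : flip j \in gens.
Proof.
have n_gt0 : (0 < n)%N by apply: leq_ltn_trans (ltn_ord j).
pose z := Ordinal n_gt0.
have -> : flip j = (semb (tperm z j) * simple z * semb (tperm z j))%g.
  apply: sperm_eq => i /=; first by rewrite mul1g tperm2.
  rewrite ffunE /= ffunE /= ffunE addFb ffunE /= !ffunE addbF.
  by rewrite (can2_eq (tpermK z j) (tpermK z j)) tpermL.
by rewrite !groupM ?semb_gen.
Qed.

Lemma sperm_gen w : w \in gens.
Proof.
have [k] := ubnP #|[set i | sbar w i]|; elim: k w => // k IH w.
have [bw0 _|[j]] := set_0Vmem [set i | sbar w i].
  have -> : w = semb (sabs w); last exact: semb_gen.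
  apply: sperm_eq => i //=; rewrite ffunE; apply/negbTE/negP => wi.
  by have := in_set0 i; rewrite -bw0 inE wi.
rewrite inE => wj; rewrite (cardsD1 j) inE wj add1n !ltnS => lek.
have -> : w = ((w * flip j) * flip j)%g.
  apply: sperm_eq => i /=; first by rewrite !mul1g.
  by rewrite ffunE /= !(ffunE, perm1) addbA addbb addFb.
rewrite groupM ?flip_gen // IH //; apply: leq_trans lek.
rewrite ltnS subset_leq_card //; apply/subsetP => i.
rewrite !inE ffunE /= !(ffunE, perm1).
by case: eqP => [->|_]; rewrite ?wj.
Qed.

Lemma word_exists w : exists k, [exists a : k.-tuple 'I_n, wprod a == w].
Proof.
have /gen_prodgP[k [c cS ->]] := sperm_gen w.
have {cS} cS i : exists j, c i == simple j.
  by have /imsetP[j _ ->] := cS i; exists j.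
pose a i := xchoose (cS i).
exists k; apply/existsP; exists [tuple a i | i < k]; apply/eqP.
rewrite /wprod big_tuple; apply: eq_bigr => i _.
by rewrite tnth_mktuple -(eqP (xchooseP (cS i))).
Qed.

Definition slength w : nat := ex_minn (word_exists w).

Lemma reduced_exists w :
  exists a : (slength w).-tuple 'I_n, wprod a == w.
Proof. by rewrite /slength; case: ex_minnP => k /existsP. Qed.

Definition reduced_word w : (slength w).-tuple 'I_n :=
  xchoose (reduced_exists w).

Lemma reduced_wordP w : wprod (reduced_word w) = w.
Proof. exact/eqP/(xchooseP (reduced_exists w)). Qed.

Lemma slength_min a : (slength (wprod a) <= size a)%N.
Proof.
rewrite /slength; case: ex_minnP => k _; apply.
by apply/existsP; exists (in_tuple a).
Qed.

End SignedPerm.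

Section DividedDifferences.
Variables (n : nat) (R : comNzRingType).
Implicit Types (f g : {mpoly R[n]}) (w : sperm n) (i : 'I_n).

(* The ring action with w x_i = x_{w_i}, where x_{-j} = - x_j. *)
Definition sact w f : {mpoly R[n]} :=
  f \mPo [tuple (-1) ^+ sbar w i * 'X_(sabs w i) | i < n].

Lemma sact_is_zmod_morphism w : zmod_morphism (sact w).
Proof. exact: raddfB. Qed.
Lemma sact_is_monoid_morphism w : monoid_morphism (sact w).
Proof. by split; [exact: rmorph1 | exact: rmorphM]. Qed.
HB.instance Definition _ w :=
  GRing.isZmodMorphism.Build {mpoly R[n]} {mpoly R[n]} (sact w)
    (sact_is_zmod_morphism w).
HB.instance Definition _ w :=
  GRing.isMonoidMorphism.Build {mpoly R[n]} {mpoly R[n]} (sact w)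
    (sact_is_monoid_morphism w).

Lemma sactX w i : sact w 'X_i = (-1) ^+ sbar w i * 'X_(sabs w i).
Proof. by rewrite /sact comp_mpolyXU -tnth_nth tnth_mktuple. Qed.

Definition droot i : {mpoly R[n]} :=
  if i == 0 :> nat then 2%:R * 'X_i else 'X_(prev_ord i) - 'X_i.

Fact divdiff_exists i f :
  exists g, g * droot i == f - sact (simple i) f.
Proof.
pose P f := exists g, g * droot i == f - sact (simple i) f.
have PC c : P c%:MP.
  by exists 0; rewrite mul0r /sact comp_mpolyC subrr.
have PD f1 f2 : P f1 -> P f2 -> P (f1 + f2).
  move=> [g1 /eqP e1] [g2 /eqP e2]; exists (g1 + g2).
  by rewrite mulrDl e1 e2 rmorphD opprD addrACA.
have PM f1 f2 : P f1 -> P f2 -> P (f1 * f2).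
  move=> [g1 /eqP e1] [g2 /eqP e2]; exists (g1 * f2 + sact (simple i) f1 * g2).
  rewrite mulrDl mulrAC e1 -mulrA e2 rmorphM /= mulrBl mulrBr.
  by rewrite addrA subrK.
have PX j : P 'X_j.
  rewrite /P sactX /simple /droot; case: ifP => i0 /=.
    rewrite ffunE perm1; case: eqP => [->|_].
      by exists 1; rewrite mul1r expr1 mulN1r opprK mulr_natl mulr2n.
    by exists 0; rewrite mul0r expr0 mul1r subrr.
  rewrite ffunE expr0 mul1r; case: tpermP => [->|->|_ _].
  - by exists 1; rewrite mul1r.
  - by exists (-1); rewrite mulN1r opprB.
  - by exists 0; rewrite mul0r subrr.
rewrite -/(P f); elim/mpolyind: f => [|c m f _ _ Pf].
  by rewrite -mpolyC0.
apply: PD Pf; rewrite -mul_mpolyC; apply: (PM) => //.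
rewrite mpolyXE_id; apply: (big_ind P) => [||j _]; [|exact: PM|].
  by rewrite -mpolyC1.
elim: (m j) => [|k IH]; first by rewrite expr0 -mpolyC1.
by rewrite exprS; apply: (PM).
Qed.

(* (f - s_i f) / (x_i - x_{i+1}), resp. (f - s_0 f) / (2 x_1). The quotient   *)
(* is unique when R is an integral domain with 2 != 0; then, by the braid     *)
(* relations, divdiffw below does not depend on the reduced word.             *)
Definition divdiff i f : {mpoly R[n]} := xchoose (divdiff_exists i f).

Lemma divdiffP i f : divdiff i f * droot i = f - sact (simple i) f.
Proof. exact/eqP/(xchooseP (divdiff_exists i f)). Qed.

Definition divdiff' i f : {mpoly R[n]} :=
  if i == 0 :> nat then divdiff i f else - divdiff i f.

Definition divdiffw w f : {mpoly R[n]} := foldr divdiff f (reduced_word w).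
Definition divdiffw' w f : {mpoly R[n]} := foldr divdiff' f (reduced_word w).

End DividedDifferences.

Definition weyl_inv n : {pred {mpoly int[n]}} :=
  [pred f | [forall w : sperm n, sact w f == f]].
Arguments weyl_inv : clear implicits.

Fact weyl_inv_subring n : subring_closed (weyl_inv n).
Proof.
split=> [|f g|f g]; rewrite !inE.
- by apply/forallP => w; rewrite rmorph1.
- move=> /forallP fP /forallP gP; apply/forallP => w.
  by rewrite rmorphB /= (eqP (fP w)) (eqP (gP w)).
- move=> /forallP fP /forallP gP; apply/forallP => w.
  by rewrite rmorphM /= (eqP (fP w)) (eqP (gP w)).
Qed.

Definition scalar_prod n (f g : {mpoly int[n]}) : {mpoly int[n]} :=
  divdiffw (w_zero n) (f * g).

(* f(- omega_0 X) = f(- x_n, ..., - x_1) *)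
Definition neg_rev n (f : {mpoly int[n]}) : {mpoly int[n]} :=
  f \mPo [tuple - 'X_(rev_ord i) | i < n].

Definition is_basis_over (M : comNzRingType) (A : {pred M}) (I : finType)
    (b : I -> M) : Prop :=
  (forall c : I -> M, (forall i, c i \in A) ->
     \sum_i c i * b i = 0 -> forall i, c i = 0) /\
  (forall f : M, exists c : I -> M,
     (forall i, c i \in A) /\ f = \sum_i c i * b i).

Section Pfaffian.
Variable m : nat.

Fact pf_even_subproof (i : 'I_m) : (i.*2 < m.*2)%N.
Proof. by rewrite ltn_double. Qed.
Fact pf_odd_subproof (i : 'I_m) : (i.*2.+1 < m.*2)%N.
Proof. by rewrite ltn_Sdouble. Qed.
Definition pf_even (i : 'I_m) : 'I_(m.*2) := Ordinal (pf_even_subproof i).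
Definition pf_odd (i : 'I_m) : 'I_(m.*2) := Ordinal (pf_odd_subproof i).

(* The perfect matchings {s(1), s(2)}, {s(3), s(4)}, ... of {1, ..., 2m},     *)
(* written with increasing pairs and increasing first entries.                *)
Definition is_matching (s : 'S_(m.*2)) : bool :=
  [forall i : 'I_m, s (pf_even i) < s (pf_odd i)]%N &&
  [forall i : 'I_m, forall j : 'I_m,
     (i < j)%N ==> (s (pf_even i) < s (pf_even j))%N].

Definition pfaffian (R : comNzRingType) (a : 'I_(m.*2) -> 'I_(m.*2) -> R) : R :=
  \sum_(s : 'S_(m.*2) | is_matching s)
    (-1) ^+ s * \prod_(i < m) a (s (pf_even i)) (s (pf_odd i)).

End Pfaffian.

Section Qtilde.
Variables (n : nat) (R : comNzRingType).

Definition Qtilde2 (i j : nat) : {mpoly R[n]} :=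
  mesym n R i * mesym n R j +
  2%:R * \sum_(1 <= k < j.+1)
           (-1) ^+ k * (mesym n R (i + k) * mesym n R (j - k)).

(* A partition is a weakly decreasing list; it is padded with one zero when   *)
(* its length is odd.                                                         *)
Definition Qtilde (la : seq nat) : {mpoly R[n]} :=
  pfaffian (fun i j : 'I_((uphalf (size la)).*2) =>
              Qtilde2 (nth 0%N la i) (nth 0%N la j)).

End Qtilde.

(* A strict partition with all parts at most n is encoded by the set          *)
(* L : {set 'I_n} of its parts, i standing for the part i + 1; the            *)
(* complementary partition is then ~: L.                                      *)
Definition parts n (L : {set 'I_n}) : seq nat :=
  rev [seq (val i).+1 | i <- enum L].

Section Schubert.
Variable n : nat.
Implicit Types (w : sperm n) (L : {set 'I_n}).

(* Z[X, Y] is taken as Z[Y][X]. *)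
Local Notation ZY := {mpoly int[n]}.
Local Notation ZYX := {mpoly {mpoly int[n]}[n]}.

Definition QtildeXY : ZYX :=
  \sum_(L : {set 'I_n})
    Qtilde n ZY (parts L) * (Qtilde n int (parts (~: L)))%:MP.

Definition DeltaXY : ZYX :=
  \prod_(i < n) \prod_(j < n | (i.+1 + j.+1 <= n)%N) ('X_i - ('X_j)%:MP).

Definition schubertXY w : ZYX :=
  (-1) ^+ (n * n.-1)./2 * divdiffw' (w^-1 * w_zero n)%g (DeltaXY * QtildeXY).

Definition schubert w : {mpoly int[n]} :=
  map_mpoly (meval (fun=> 0)) (schubertXY w).

Definition wlam_seq L : seq 'I_n := rev (enum L) ++ enum (~: L).

Fact size_wlam_seq L : size (wlam_seq L) = n.
Proof. by rewrite size_cat size_rev -!cardE cardsC card_ord. Qed.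

Fact wlam_inj L : injective (fun i : 'I_n => nth i (wlam_seq L) i).
Proof.
move=> i j /=; rewrite (set_nth_default i j) ?size_wlam_seq //.
move/eqP; rewrite nth_uniq ?size_wlam_seq // => [/eqP/val_inj //|].
rewrite cat_uniq rev_uniq !enum_uniq andbT; apply/hasPn => k.
by rewrite mem_rev !mem_enum inE.
Qed.

(* (\bar la_1, ..., \bar la_l, la'_k, ..., la'_1), where l = #|L| *)
Definition wlam L : sperm n :=
  SPerm (perm (@wlam_inj L)) [ffun i : 'I_n => (i < #|L|)%N].

Definition schubert_lam L : {mpoly int[n]} := schubert (wlam L).

Definition schubert2 (u : 'S_n) L : {mpoly int[n]} :=
  schubert (semb u) * schubert_lam L.

End Schubert.

(* Main.v *)
From HB Require Import structures.
Require Import Defs.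
From mathcomp Require Import all_boot all_order all_algebra all_fingroup.
From mathcomp Require Import mpoly.
From mathcomp Require Import zify ring lra.

(** Let d_i be the divided differences written with a prime, and let d_w be their
    composites. The scalar product is d_(w_0) (f g). As w_0 = (omega_0 w_0) omega_0 with
    lengths adding up, d_(w_0) = dV dS, where dS is the operator of omega_0 and dV that of
    omega_0 w_0. The operator dS is linear over symmetric polynomials and the Q~ are
    symmetric, so, once C_lambda = Q~_lambda is known,
      <C_u C_lambda, g C_mu> = dV (Q~_lambda Q~_mu dS (C_u g)),
    and both orthogonality relations split into a statement about S_n and one about the
    polynomials Q~.

    - For S_n ([type_A_orth], [type_A_dual]): C_u is d_(u^-1 omega_0) of the monomial
      x_2 x_3^2 ... x_n^(n-1), and C_(v omega_0)(- omega_0 X) is, up to sign, d_(v^-1) of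
      x^delta, the opposite staircase ([schub_semb], [phi_schub]). The operators can be
      moved from one factor to the other. The divided differences of S_n preserve the
      span of the monomials x^c with c_i < i, of which dS (x^delta x^c) = 0 unless c = 0
      ([dS_stair]), because otherwise x^delta x^c has two equal exponents.

    - For the Q~ ([dV_qpf]): dV (Q~_lambda Q~_mu) is 1 if mu is the complement of lambda
      and 0 otherwise. The divided difference d_0 contracts the Pfaffian with the
      elementary symmetric polynomials in x_2, ..., x_n ([d0_qpf]). From this one gets an
      operator that adds a part m to any Q~ ([chi_qpf]) and is self-adjoint for dV up to
      the sign (-1)^(n+m) ([chi_adj]). Moving the parts of lambda one by one into mu and
      sorting them there leaves dV (Q~_nu), which is 0 unless nu = (n, ..., 1).

    The products are as many as the elements of W_n and have a dual family. Over the
    field of fractions d_(w_0) is a combination of the elements of W_n, so duality says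
    that the product of two square matrices is 1; then so is the product in the other
    order, and this expands every polynomial in the products, with coefficients
    <f, b*>, which are invariant ([dual_expansion], [bas_expansion]). Independence
    follows by pairing with the dual family.

    Finally C_lambda = Q~_lambda ([schub_wlam]): both are symmetric, and both have the
    pairing [nu = lambda'] with every Q~_nu. For C_lambda, the operator that defines it
    becomes, on the other factor, that of w_(lambda') omega_0; the part w_(lambda') is a
    product of operators D_m that remove parts from Q~_nu ([dS_zw], [schub_zw_pair]). By
    the expansion above such pairings determine a symmetric polynomial.

    Everything rests on the operators d_w being well defined (Matsumoto's theorem,
    [ddw_reduced]), with lengths computed as numbers of inversions. Variables are
    numbered from 0 below, as x_0, ..., x_N with n = N + 1, and s_0, ..., s_N as in W_n. *)

Set Implicit Arguments.
Unset Strict Implicit.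
Unset Printing Implicit Defensive.

Import Order.TTheory GRing.Theory Num.Theory.
Local Open Scope ring_scope.

(** * Signed permutations and their length *)

Section Length.
Variable n : nat.
Implicit Types (u v w : sperm n) (i j k : 'I_n).

(** Signs are kept inside integers, so that descents, inversions and the effect of
    a simple reflection are all decided by comparing entries. *)
Definition entry w i : int := (-1) ^+ sbar w i * (sabs w i).+1%:Z.

Lemma entry_mul w u i : entry (w * u)%g i = (-1) ^+ sbar u i * entry w (sabs u i).
Proof. by rewrite /entry /= permM ffunE signr_addb mulrA. Qed.

Lemma entry_simple0 w i j : i = 0%N :> nat ->
  entry (w * simple i)%g j = if j == i then - entry w i else entry w j.
Proof.
move=> i0; rewrite entry_mul /simple i0 eqxx /= perm1 ffunE.
by case: eqP => [->|_]; rewrite ?mulN1r ?mul1r.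
Qed.

Lemma entry_simple w i j : i != 0%N :> nat ->
  entry (w * simple i)%g j = entry w (tperm (prev_ord i) i j).
Proof. by move=> i0; rewrite entry_mul /simple (negPf i0) /= ffunE mul1r. Qed.

Lemma norm_entry w i : `|entry w i| = (sabs w i).+1%:Z.
Proof. by rewrite /entry normrM normrX normrN1 expr1n mul1r. Qed.

Lemma entry_lt0 w i : (entry w i < 0) = sbar w i.
Proof. by rewrite /entry; case: (sbar w i); rewrite ?mulN1r ?mul1r. Qed.

Lemma entry_neq0 w i : entry w i != 0.
Proof. by rewrite -normr_eq0 norm_entry. Qed.

Lemma entry_eq_norm w i j : `|entry w i| = `|entry w j| -> i = j.
Proof. by rewrite !norm_entry => -[] /val_inj/perm_inj. Qed.

Lemma entry_inj w : injective (entry w).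
Proof. by move=> i j e; apply: (@entry_eq_norm w); rewrite e. Qed.

Lemma entryD_neq0 w i j : entry w i + entry w j != 0.
Proof.
apply/eqP => /addr0_eq e; have ij : i = j by apply: (@entry_eq_norm w); rewrite -e normrN.
move: e; rewrite ij => e; have := entry_neq0 w j; lia.
Qed.

Lemma sperm_entryP u v : entry u =1 entry v -> u = v.
Proof.
move=> e; apply: sperm_eq => i.
  by have := norm_entry u i; rewrite e norm_entry => -[] /val_inj.
by rewrite -!entry_lt0 e.
Qed.

(** The number of positive roots of type C made negative by [w]: a pair of
    positions carries the roots x_k - x_j and x_j + x_k, a position the root
    2 x_j. *)
Definition pair_invs w j k : nat :=
  (entry w k < entry w j)%R + (entry w j + entry w k < 0)%R.

Definition invs w : nat :=
  \sum_(p : 'I_n * 'I_n | (p.1 < p.2)%N) pair_invs w p.1 p.2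
  + \sum_j (entry w j < 0)%R.

Definition descent w i : bool :=
  if i == 0%N :> nat then entry w i < 0 else entry w i < entry w (prev_ord i).

Lemma simpleK i : (simple i * simple i = 1)%g.
Proof.
apply: sperm_entryP => j; case: (eqVneq (i : nat) 0%N) => i0.
  rewrite entry_simple0 // -[simple i]mul1g !entry_simple0 // eqxx opprK.
  by case: eqP => [->|].
by rewrite entry_simple // -[simple i]mul1g entry_simple // tpermK.
Qed.

(** A right descent s_i permutes the positive roots other than its own, and its own
    root stops being an inversion. *)
Lemma invs_descent w i : descent w i -> invs w = (invs (w * simple i)%g).+1.
Proof.
rewrite /descent; case: (eqVneq (i : nat) 0%N) => i0 d.
  rewrite /invs -addnS; congr (_ + _)%N.
    apply: eq_bigr => -[j k] /= jk; rewrite /pair_invs !entry_simple0 //.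
    have /negbTE-> : k != i by rewrite -val_eqE /= i0; lia.
    by case: eqP => // -> ; rewrite addnC; congr (_ + _)%N; congr nat_of_bool; lia.
  rewrite (bigD1 i) //= d [in RHS](bigD1 i) //= entry_simple0 // eqxx.
  have -> : (- entry w i < 0) = false by lia.
  rewrite add0n add1n; congr (_.+1); apply: eq_bigr => j /negPf ji.
  by rewrite entry_simple0 // ji.
set p := prev_ord i in d; set t := tperm p i.
have pi : i = p.+1 :> nat by rewrite /= prednK // lt0n.
rewrite /invs -addSn; congr (_ + _)%N; last first.
  rewrite (reindex_inj (@perm_inj _ t)) /=; apply: eq_bigr => j _.
  by rewrite entry_simple.
pose tt (q : 'I_n * 'I_n) := (t q.1, t q.2).
have ttK : involutive tt by case=> j k; rewrite /tt /= !tpermK.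
rewrite [in RHS](reindex_inj (inv_inj ttK)) /=.
rewrite [in LHS](bigD1 (p, i)) /=; last by rewrite pi.
rewrite [in RHS](bigD1 (i, p)) /=; last by rewrite tpermL tpermR pi.
rewrite {1 3}/pair_invs !entry_simple // !tpermL tpermK !tpermR d.
have -> : (entry w p < entry w i) = false by lia.
rewrite add0n addrC -addnA add1n; congr (_.+1); congr (_ + _)%N.
apply: eq_big => [[j k] /=|[j k] _] /=; last first.
  by rewrite /pair_invs !entry_simple // !tpermK.
rewrite !xpair_eqE -!val_eqE /t !permE /= -!val_eqE /=.
by do ![case: eqP => [?|?]] => /=; lia.
Qed.

Lemma descent_simple w i : descent (w * simple i)%g i = ~~ descent w i.
Proof.
rewrite /descent; case: (eqVneq (i : nat) 0%N) => i0.
  by rewrite entry_simple0 // eqxx oppr_lt0 -leNgt le_eqVlt eq_sym (negPf (entry_neq0 _ _)).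
rewrite !entry_simple // tpermL tpermR -leNgt le_eqVlt.
rewrite (inj_eq (@entry_inj w)); suff /negPf-> : prev_ord i != i by [].
by rewrite -val_eqE /=; lia.
Qed.

Lemma invs_ascent w i : ~~ descent w i -> invs (w * simple i)%g = (invs w).+1.
Proof. by move=> d; rewrite (@invs_descent _ i) ?descent_simple // -mulgA simpleK mulg1. Qed.

Lemma entry1 i : entry 1%g i = i.+1%:Z.
Proof. by rewrite /entry /= ffunE perm1 mul1r. Qed.

Lemma invs1 : invs 1%g = 0%N.
Proof.
by rewrite /invs !big1 // => [i _|[i j] /= ij]; rewrite /pair_invs ?entry1 //; lia.
Qed.

(** Without descents the entries are positive and increasing, so the i-th one is at
    least i; as they are a permutation, the sum of all entries forces equality. *)
Lemma no_descent w : (forall i, ~~ descent w i) -> w = 1%g.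
Proof.
move=> nd; have step (i : 'I_n) : (0 < i)%N -> entry w (prev_ord i) < entry w i.
  move=> i0; have := nd i; rewrite /descent gtn_eqF // -leNgt le_eqVlt.
  by rewrite (inj_eq (@entry_inj w)) -val_eqE /= ltn_eqF // ltn_predL.
have pos m (i : 'I_n) : i = m :> nat -> i.+1%:Z <= entry w i.
  elim: m i => [|m IH] i im.
    have := nd i; rewrite /descent im /= -leNgt => e; have := entry_neq0 w i; lia.
  have := IH (prev_ord i); rewrite /= im => /(_ erefl).
  by have := step i; rewrite im => /(_ isT); lia.
have le1 (i : 'I_n) : (i <= sabs w i)%N.
  have := pos _ i erefl; have := norm_entry w i; lia.
have pos0 i : sbar w i = false.
  by rewrite -entry_lt0; have := pos _ i erefl; lia.
suff s1 : sabs w = 1%g.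
  by apply: sperm_eq => i; rewrite ?s1 // pos0 ffunE.
apply/permP => i; rewrite perm1; apply/val_inj/eqP; rewrite eqn_leq le1 andbT.
have le_sum : (\sum_j (sabs w j : nat) = \sum_(j < n) j)%N.
  by rewrite [RHS](reindex_inj (@perm_inj _ (sabs w))).
rewrite leqNgt; apply/negP => lti; move: le_sum.
rewrite (bigD1 i) //= [RHS](bigD1 i) //= => e.
have : (\sum_(j < n | j != i) j <= \sum_(j | j != i) sabs w j)%N by apply: leq_sum.
have {}lti : (i < sabs w i)%N by [].
move: lti e; set a := (\sum_(_ < _ | _) _)%N; set b := (\sum_(_ < _ | _) _)%N; lia.
Qed.

Lemma wprod_cat a b : wprod (a ++ b) = (wprod a * wprod b)%g :> sperm n.
Proof. by rewrite /wprod big_cat. Qed.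

Lemma wprod_rcons a i : wprod (rcons a i) = (wprod a * simple i)%g :> sperm n.
Proof. by rewrite -cats1 wprod_cat /wprod big_seq1. Qed.

Lemma invs_wprod a : (invs (wprod a) <= size a)%N.
Proof.
elim/last_ind: a => [|a i IH]; first by rewrite /wprod big_nil invs1.
rewrite wprod_rcons size_rcons; case d: (descent (wprod a) i).
  by move: IH; rewrite (invs_descent d) => /ltnW IH; rewrite ltnW.
by rewrite invs_ascent ?d.
Qed.

Lemma word_of_length w : {a | wprod a = w & size a = invs w}.
Proof.
move e: (invs w) => m; elim: m w e => [|m IH] w e.
  exists [::] => //; rewrite /wprod big_nil (@no_descent w) // => i.
  by apply/negP => /invs_descent; rewrite e.
have [i d] : {i | descent w i}.
  case: (pickP (descent w)) => [i d|nd]; first by exists i.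
  by move: e; rewrite (@no_descent w) ?invs1 // => i; rewrite nd.
have [|a ea sa] := IH (w * simple i)%g; first by move: e; rewrite (invs_descent d) => -[].
by exists (rcons a i); rewrite ?size_rcons ?sa // wprod_rcons ea -mulgA simpleK mulg1.
Qed.

(** Each letter of a word changes the number of inversions by one, and it can be
    brought down to 0 by descents. *)
Lemma slengthE w : slength w = invs w.
Proof.
apply/eqP; rewrite eqn_leq; apply/andP; split.
  by have [a <- <-] := word_of_length w; apply: slength_min.
by rewrite -{1}(reduced_wordP w) (leq_trans (invs_wprod _)) // size_tuple.
Qed.

Lemma wprod_rev a : wprod (rev a) = (wprod a)^-1%g :> sperm n.
Proof.
elim: a => [|i a IH]; first by rewrite /wprod /= !big_nil invg1.
have simpleV : (simple i)^-1%g = simple i by apply/eqP; rewrite eq_invg_mul simpleK.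
by rewrite rev_cons wprod_rcons IH /wprod big_cons invMg simpleV.
Qed.

Lemma invsV w : invs w^-1%g = invs w.
Proof.
have le u : (invs u^-1%g <= invs u)%N.
  by have [a <- <-] := word_of_length u; rewrite -wprod_rev -size_rev invs_wprod.
by apply/eqP; rewrite eqn_leq le -{1}[w]invgK le.
Qed.

Lemma descentP w a i : wprod (rcons a i) = w -> (size a < invs w)%N -> descent w i.
Proof.
rewrite wprod_rcons => <-; rewrite descent_simple => lt; apply/negP => /invs_descent e.
by have := invs_wprod a; rewrite e; lia.
Qed.

Lemma entry_w_zero w i : entry (w * w_zero n)%g i = - entry w i.
Proof. by rewrite entry_mul /= ffunE mulN1r perm1. Qed.

Lemma entry_omega_zero w i : entry (w * omega_zero n)%g i = entry w (rev_ord i).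
Proof. by rewrite entry_mul /= ffunE mul1r permE. Qed.

Lemma entry_semb s i : entry (semb s) i = (s i).+1%:Z.
Proof. by rewrite /entry /= ffunE mul1r. Qed.

Definition n_pairs : nat := \sum_(p : 'I_n * 'I_n | (p.1 < p.2)%N) 1.

(** Right multiplication by -1 exchanges the inversions with the other positive
    roots, whose total number is n(n-1) + n. *)
Lemma invs_w_zero w : (invs w + invs (w * w_zero n)%g = n_pairs.*2 + n)%N.
Proof.
rewrite /invs addnACA -!big_split /= -muln2 big_distrl /=; congr (_ + _)%N.
  apply: eq_bigr => -[i j] /= ij; rewrite /pair_invs !entry_w_zero.
  have /eqP := entryD_neq0 w i j.
  have : entry w i != entry w j by rewrite (inj_eq (@entry_inj w)) -val_eqE ltn_eqF.
  lia.
rewrite -[RHS](card_ord n) -sum1_card; apply: eq_bigr => i _; rewrite entry_w_zero.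
have := entry_neq0 w i; lia.
Qed.

Lemma invs_semb s : invs (semb s) =
  (\sum_(p : 'I_n * 'I_n | (p.1 < p.2)%N) (s p.2 < s p.1))%N.
Proof.
rewrite /invs [X in (_ + X)%N]big1 ?addn0 => [|i _]; last by rewrite entry_semb.
apply: eq_bigr => -[i j] /= ij; rewrite /pair_invs !entry_semb; lia.
Qed.

Lemma omega_zeroM s :
  (semb s * omega_zero n)%g = semb (perm (@rev_ord_inj n) * s)%g.
Proof. by rewrite sembM. Qed.

Lemma invs_omega_zero s : (invs (semb s) + invs (semb s * omega_zero n)%g = n_pairs)%N.
Proof.
rewrite omega_zeroM !invs_semb.
pose tt (q : 'I_n * 'I_n) := (rev_ord q.2, rev_ord q.1).
have ttK : involutive tt by case=> j k; rewrite /tt /= !rev_ordK.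
rewrite [X in (_ + X)%N](reindex_inj (inv_inj ttK)) /=.
rewrite [X in (_ + X)%N](eq_bigl (fun p : 'I_n * 'I_n => (p.1 < p.2)%N)) => [|[i j]] /=; last first.
  have := ltn_ord i; have := ltn_ord j; lia.
rewrite /n_pairs -big_split /=; apply: eq_bigr => -[i j] /= ij.
rewrite !permM !permE !rev_ordK.
have : s i != s j by rewrite (inj_eq perm_inj) -val_eqE ltn_eqF.
rewrite -val_eqE /=; lia.
Qed.

Lemma n_pairsE : n_pairs = (n * n.-1)./2.
Proof.
rewrite -bin2 -bin2_sum big_mkord /n_pairs.
transitivity (\sum_(j < n) \sum_(i < n | (i < j)%N) 1)%N.
  by rewrite (exchange_big_dep xpredT) //= pair_big_dep.
apply: eq_bigr => j _; by rewrite (big_ord_narrow (ltnW (ltn_ord j))) sum1_card card_ord.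
Qed.

Lemma invs_eq0 w : invs w = 0%N -> w = 1%g.
Proof. by move=> e; apply: no_descent => i; apply/negP => /invs_descent; rewrite e. Qed.

(** * Braid relations in the hyperoctahedral group *)

Ltac split_ifs :=
  repeat match goal with
  | |- context [if ?b then _ else _] =>
      lazymatch b with
      | context [if _ then _ else _] => fail
      | _ => let e := fresh "e" in destruct b eqn:e; rewrite /=
      end
  end.

Lemma simple_far i j : (i.+1 < j)%N -> (simple i * simple j = simple j * simple i)%g.
Proof.
move=> ij; have j0 : j != 0%N :> nat by lia.
apply: (mulgI 1%g); rewrite !mulgA; apply: sperm_entryP => k.
case: (eqVneq (i : nat) 0%N) => i0.
  rewrite !(entry_simple0 _ _ i0, entry_simple _ _ j0) !entry1 !permE /= -!val_eqE /=.
  by split_ifs; lia.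
rewrite !entry_simple // !entry1 !permE /= -!val_eqE /=.
by split_ifs; lia.
Qed.

Lemma simple_braid3 i j : i != 0%N :> nat -> j = i.+1 :> nat ->
  (simple i * simple j * simple i = simple j * simple i * simple j)%g.
Proof.
move=> i0 ji; have j0 : j != 0%N :> nat by lia.
apply: (mulgI 1%g); rewrite !mulgA; apply: sperm_entryP => k.
rewrite !entry_simple // !entry1 !permE /= -!val_eqE /=.
by split_ifs; lia.
Qed.

Lemma simple_braid4 i j : i = 0%N :> nat -> j = 1%N :> nat ->
  (simple i * simple j * simple i * simple j = simple j * simple i * simple j * simple i)%g.
Proof.
move=> i0 j1; have j0 : j != 0%N :> nat by lia.
apply: (mulgI 1%g); rewrite !mulgA; apply: sperm_entryP => k.
rewrite !(entry_simple0 _ _ i0, entry_simple _ _ j0) !entry1 !permE /= -!val_eqE /=.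
by split_ifs; lia.
Qed.

(** If s_i and s_j are both right descents of w, then w ends with the whole braid
    word of i and j; this and its two analogues drive Matsumoto's theorem. *)
Lemma descents_far w i j : (i.+1 < j)%N -> descent w i -> descent w j ->
  invs w = (invs (w * simple i * simple j)%g).+2.
Proof.
move=> ij di dj; rewrite (invs_descent di) (@invs_descent _ j) //.
move: dj; rewrite /descent; have j0 : j != 0%N :> nat by lia.
rewrite (negPf j0); case: (eqVneq (i : nat) 0%N) => i0.
  by rewrite !entry_simple0 // -!val_eqE /= !ifF //; lia.
rewrite !entry_simple // !tpermD // -?val_eqE /=; lia.
Qed.

Lemma descents_braid3 w i j : i != 0%N :> nat -> j = i.+1 :> nat ->
  descent w i -> descent w j ->
  invs w = (invs (w * simple i * simple j * simple i)%g).+3.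
Proof.
move=> i0 ji di dj; have j0 : j != 0%N :> nat by lia.
have pj : prev_ord j = i by apply: val_inj; rewrite /= ji.
have d2 : descent (w * simple i)%g j.
  rewrite /descent (negPf j0) !entry_simple // pj tpermR tpermD -?val_eqE /=; try lia.
  by move: di dj; rewrite /descent (negPf j0) (negPf i0) pj => *; apply: lt_trans; eassumption.
have d3 : descent (w * simple i * simple j)%g i.
  rewrite /descent (negPf i0) !entry_simple // pj tpermL.
  rewrite [tperm i j (prev_ord i)]tpermD -?val_eqE /=; try lia.
  rewrite tpermL tpermD -?val_eqE /=; try lia.
  by move: dj; rewrite /descent (negPf j0) pj.
by rewrite (invs_descent di) (invs_descent d2) (invs_descent d3).
Qed.

Lemma descents_braid4 w i j : i = 0%N :> nat -> j = 1%N :> nat ->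
  descent w i -> descent w j ->
  invs w = (invs (w * simple i * simple j * simple i * simple j)%g).+4.
Proof.
move=> i0 j1 di dj; have j0 : j != 0%N :> nat by lia.
have pj : prev_ord j = i by apply: val_inj; rewrite /= i0 j1.
have ji : (j == i) = false by rewrite -val_eqE /= i0 j1.
move: (di) (dj); rewrite /descent i0 /= (negPf j0) pj => vi vj.
have d2 : descent (w * simple i)%g j.
  rewrite /descent (negPf j0) !entry_simple0 // pj eqxx ji; lia.
have d3 : descent (w * simple i * simple j)%g i.
  rewrite /descent i0 /= entry_simple // pj tpermL entry_simple0 // ji; lia.
have d4 : descent (w * simple i * simple j * simple i)%g j.
  rewrite /descent (negPf j0) !(entry_simple0 _ _ i0) // pj eqxx ji.
  rewrite !(entry_simple _ _ j0) // pj tpermL tpermR !entry_simple0 // eqxx ji; lia.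
by rewrite (invs_descent di) (invs_descent d2) (invs_descent d3) (invs_descent d4).
Qed.

End Length.

(** * Divided differences *)

(** The axioms under which divided differences are calculated: an integral domain
    with an action of W_n on distinct nonzero elements x_1, ..., x_n. The divided
    differences are the operators written with a prime, whose denominators are the
    simple roots 2 x_1 and x_{i+1} - x_i. *)
Record weyl_ring (n : nat) := WeylRing {
  wr_ring :> idomainType;
  wact : sperm n -> {rmorphism wr_ring -> wr_ring};
  var : 'I_n -> wr_ring;
  dif : 'I_n -> wr_ring -> wr_ring;
  sroot := fun i : 'I_n =>
    if i == 0%N :> nat then 2%:R * var i else var i - var (prev_ord i);
  wactM : forall u v f, wact (u * v)%g f = wact u (wact v f);
  wact1 : forall f, wact 1%g f = f;
  wact_var : forall w i, wact w (var i) = (-1) ^+ sbar w i * var (sabs w i);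
  two_neq0 : 2%:R != 0 :> wr_ring;
  var_neq0 : forall i, var i != 0;
  var_inj : injective var;
  difP : forall i f, dif i f * sroot i = f - wact (simple i) f }.

Arguments sroot {n}.

Section DividedDifferenceCalculus.
Variables (n : nat) (A : weyl_ring n).
Implicit Types (f g h : A) (w : sperm n) (i j : 'I_n).

Local Notation x := (@var n A).
Local Notation s i := (wact A (simple i)).
Local Notation d i := (@dif n A i).
Local Notation sroot := (sroot A).

Lemma sK i f : s i (s i f) = f.
Proof. by rewrite -wactM simpleK wact1. Qed.

Lemma s_var0 i j : i = 0%N :> nat -> s i (x j) = if j == i then - x j else x j.
Proof.
by move=> i0; rewrite wact_var /simple i0 /= ffunE perm1; case: ifP; rewrite ?mulN1r ?mul1r.
Qed.

Lemma s_var i j : i != 0%N :> nat -> s i (x j) = x (tperm (prev_ord i) i j).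
Proof. by move=> i0; rewrite wact_var /simple (negPf i0) /= ffunE mul1r. Qed.

Lemma prev_ord_neq i : i != 0%N :> nat -> (prev_ord i == i) = false.
Proof. by move=> i0; rewrite -val_eqE /=; lia. Qed.

Lemma sroot_neq0 i : sroot i != 0.
Proof.
rewrite /sroot; case: ifP => [_|/negbT i0]; last first.
  by rewrite subr_eq0 (inj_eq (@var_inj _ A)) eq_sym prev_ord_neq.
by rewrite mulf_neq0 ?two_neq0 ?var_neq0.
Qed.

Lemma s_sroot i : s i (sroot i) = - sroot i.
Proof.
rewrite /sroot; case: eqVneq => i0.
  by rewrite rmorphM rmorph_nat /= s_var0 // eqxx mulrN.
by rewrite rmorphB /= !s_var // tpermL tpermR opprB.
Qed.

(** The ring is a domain, so a divided difference is recognized by clearing its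
    denominator. *)
Lemma dif_uniq i f g : g * sroot i = f - s i f -> d i f = g.
Proof. by move=> e; apply: (mulIf (sroot_neq0 i)); rewrite difP e. Qed.

Lemma dif_is_zmod_morphism i : zmod_morphism (dif i : A -> A).
Proof.
by move=> f g; apply: dif_uniq; rewrite mulrBl !difP rmorphB /=; ring.
Qed.
HB.instance Definition _ i :=
  GRing.isZmodMorphism.Build A A (dif i) (dif_is_zmod_morphism i).

Lemma difM i f g : d i (f * g) = d i f * g + s i f * d i g.
Proof.
apply: dif_uniq; rewrite mulrDl mulrAC difP -mulrA difP rmorphM /=.
ring.
Qed.

Lemma dif_eq0 i f : s i f = f -> d i f = 0.
Proof. by move=> e; apply: dif_uniq; rewrite e subrr mul0r. Qed.

Lemma difMl i f g : s i f = f -> d i (f * g) = f * d i g.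
Proof. by move=> e; rewrite difM (dif_eq0 e) e mul0r add0r. Qed.

Lemma difMr i f g : s i g = g -> d i (f * g) = d i f * g.
Proof. by move=> e; rewrite mulrC difMl // mulrC. Qed.

Lemma s_dif i f : s i (d i f) = d i f.
Proof.
apply: (mulIf (sroot_neq0 i)); have := congr1 (s i) (difP i f).
rewrite rmorphM rmorphB /= sK s_sroot mulrN => /(congr1 -%R).
by rewrite opprK opprB difP.
Qed.

Lemma difK i f : d i (d i f) = 0.
Proof. by rewrite dif_eq0 // s_dif. Qed.

Lemma dif_s i f : d i (s i f) = - d i f.
Proof. by apply: dif_uniq; rewrite mulNr difP opprB sK. Qed.

Lemma sE i f : s i f = f - sroot i * d i f.
Proof. by rewrite mulrC difP subKr. Qed.

Lemma fixed_dif i f : d i f = 0 -> s i f = f.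
Proof. by rewrite sE => ->; rewrite mulr0 subr0. Qed.

(** Hence d_i is self-adjoint for f, g |-> D (f * g) as soon as D kills the image
    of d_i. *)
Lemma dif_adj i f g : d i f * g - f * d i g = d i (f * s i g).
Proof. rewrite difM dif_s !sE; ring. Qed.

Lemma s_eq0 i f : (s i f == 0) = (f == 0).
Proof. by apply/eqP/eqP => [e|->]; rewrite ?rmorph0 // -[f](sK i) e rmorph0. Qed.

Lemma dif_far i j f : (i.+1 < j)%N -> d i (d j f) = d j (d i f).
Proof.
move=> ij; have j0 : j != 0%N :> nat by lia.
have sji : s j (sroot i) = sroot i.
  rewrite /sroot; case: eqVneq => i0.
    rewrite rmorphM rmorph_nat /= s_var // tpermD -?val_eqE /=; [by []|lia|lia].
  by rewrite rmorphB /= !s_var // !tpermD // -?val_eqE /=; lia.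
have sij : s i (sroot j) = sroot j.
  rewrite /sroot (negPf j0) rmorphB /=; case: (eqVneq (i : nat) 0%N) => i0.
    by rewrite !s_var0 // -!val_eqE /= !ifF //; lia.
  by rewrite !s_var // !tpermD // -?val_eqE /=; lia.
apply: (mulIf (sroot_neq0 i)); rewrite difP.
apply: (mulIf (sroot_neq0 j)); rewrite mulrBl -{2}sij -rmorphM /= !difP.
rewrite mulrAC difP mulrBl -{2}sji -rmorphM /= !difP !rmorphB /=.
by rewrite -!wactM simple_far //; ring.
Qed.

End DividedDifferenceCalculus.

(** Both sides of a braid relation, cleared of denominators, are alternating
    sums over the dihedral group. Here [fi], [fij], ... stand for s_i f, s_i s_j f
    and so on, [a] and [b] for the two simple roots, and every hypothesis is one
    divided difference with its translates. *)
Lemma braid3_alternating (F : fieldType) (a b f fi fj fij fji fiji h hj hij k ki l : F) :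
  a != 0 -> b != 0 -> a + b != 0 ->
  h * a = f - fi -> hj * (a + b) = fj - fji -> hij * b = fij - fiji ->
  k * b = h - hj -> ki * (a + b) = h - hij -> l * a = k - ki ->
  l * (a * b * (a + b)) = f - fi - fj + fij + fji - fiji.
Proof.
move=> a0 b0 c0 /(canRL (mulfK a0)) -> /(canRL (mulfK c0)) -> /(canRL (mulfK b0)) ->.
move=> /(canRL (mulfK b0)) -> /(canRL (mulfK c0)) -> /(canRL (mulfK a0)) ->.
by field; rewrite c0 b0 a0.
Qed.

Lemma braid4_alternating_i (F : fieldType)
    (a b f fi fj fij fji fiji fjij fjiji h hj hij hjij k ki kji l lj m : F) :
  a != 0 -> b != 0 -> a + b != 0 -> a + 2 * b != 0 ->
  h * a = f - fi -> hj * (a + 2 * b) = fj - fji -> hij * (a + 2 * b) = fij - fiji ->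
  hjij * a = fjij - fjiji -> k * b = h - hj -> ki * (a + b) = h - hij ->
  kji * (a + b) = hj - hjij -> l * a = k - ki -> lj * (a + 2 * b) = k - kji ->
  m * b = l - lj ->
  m * (a * b * (a + b) * (a + 2 * b)) = f - fi - fj + fij + fji - fiji - fjij + fjiji.
Proof.
move=> a0 b0 c0 e0 /(canRL (mulfK a0)) -> /(canRL (mulfK e0)) -> /(canRL (mulfK e0)) ->.
move=> /(canRL (mulfK a0)) -> /(canRL (mulfK b0)) -> /(canRL (mulfK c0)) ->.
move=> /(canRL (mulfK c0)) -> /(canRL (mulfK a0)) -> /(canRL (mulfK e0)) ->.
move=> /(canRL (mulfK b0)) ->.
by field; rewrite e0 c0 b0 a0.
Qed.

Lemma braid4_alternating_j (F : fieldType)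
    (a b f fi fj fij fji fiji fjij fijij h hi hji hiji k kj kij l li m : F) :
  a != 0 -> b != 0 -> a + b != 0 -> a + 2 * b != 0 ->
  h * b = f - fj -> hi * (a + b) = fi - fij -> hji * (a + b) = fji - fjij ->
  hiji * b = fiji - fijij -> k * a = h - hi -> kj * (a + 2 * b) = h - hji ->
  kij * (a + 2 * b) = hi - hiji -> l * b = k - kj -> li * (a + b) = k - kij ->
  m * a = l - li ->
  m * (a * b * (a + b) * (a + 2 * b)) = f - fi - fj + fij + fji - fiji - fjij + fijij.
Proof.
move=> a0 b0 c0 e0 /(canRL (mulfK b0)) -> /(canRL (mulfK c0)) -> /(canRL (mulfK c0)) ->.
move=> /(canRL (mulfK b0)) -> /(canRL (mulfK a0)) -> /(canRL (mulfK e0)) ->.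
move=> /(canRL (mulfK e0)) -> /(canRL (mulfK b0)) -> /(canRL (mulfK c0)) ->.
move=> /(canRL (mulfK a0)) ->.
by field; rewrite e0 c0 b0 a0.
Qed.

Section BraidRelations.
Variables (n : nat) (A : weyl_ring n).
Implicit Types (f : A) (i j : 'I_n).

Local Notation s i := (wact A (simple i)).
Local Notation d i := (@dif n A i).
Local Notation sroot := (sroot A).
Local Notation x := (@var n A).
Local Notation "f %:F" := (tofrac f).

(* The translate by [g] of the defining equation of a divided difference, in the
   field of fractions; it produces the hypotheses of the alternating sums. *)
Lemma difF (g : {rmorphism A -> A}) i f r : g (sroot i) = r ->
  (g (d i f))%:F * r%:F = (g f)%:F - (g (s i f))%:F.
Proof. by move=> <-; rewrite -rmorphM -rmorphM -rmorphB -rmorphB /= difP. Qed.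

Let dF0 i f := @difF idfun i f _ erefl.
Let dF1 j i f r := @difF (wact A (simple j)) i f r.
Let dF2 k j i f r := @difF (wact A (simple k) \o wact A (simple j)) i f r.
Let dF3 l k j i f r :=
  @difF (wact A (simple l) \o wact A (simple k) \o wact A (simple j)) i f r.

Lemma dif_braid3 i j f : i != 0%N :> nat -> j = i.+1 :> nat ->
  d i (d j (d i f)) = d j (d i (d j f)).
Proof.
move=> i0 ji; have j0 : j != 0%N :> nat by lia.
have pj : prev_ord j = i by apply: val_inj; rewrite /= ji.
have Ri : sroot i = x i - x (prev_ord i) by rewrite /sroot (negPf i0).
have Rj : sroot j = x j - x i by rewrite /sroot (negPf j0) pj.
have sji : s j (sroot i) = sroot i + sroot j.
  by rewrite Ri Rj rmorphB /= !s_var // pj tpermL tpermD -?val_eqE /=; [ring|lia|lia].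
have sij : s i (sroot j) = sroot i + sroot j.
  by rewrite Ri Rj rmorphB /= !s_var // tpermR tpermD -?val_eqE /=; [ring|lia|lia].
have siji : s i (s j (sroot i)) = sroot j by rewrite sji rmorphD /= s_sroot sij; ring.
have sjij : s j (s i (sroot j)) = sroot i by rewrite sij rmorphD /= s_sroot sji; ring.
have F0 k : (sroot k)%:F != 0 by rewrite tofrac_eq0 sroot_neq0.
have c0 : (sroot i)%:F + (sroot j)%:F != 0 by rewrite -rmorphD /= -sij tofrac_eq0 s_eq0 sroot_neq0.
have E1 : (d i (d j (d i f)))%:F * ((sroot i)%:F * (sroot j)%:F *
    ((sroot i)%:F + (sroot j)%:F)) = f%:F - (s i f)%:F - (s j f)%:F +
  (s i (s j f))%:F + (s j (s i f))%:F - (s i (s j (s i f)))%:F.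
  have h1 := dF0 i f; have := dF1 f sji; have h3 := dF2 f siji.
  have h4 := dF0 j (d i f); have := dF1 (d i f) sij; have h6 := dF0 i (d j (d i f)).
  rewrite /= ![(_ + _)%:F]rmorphD /= !s_dif => h5 h2.
  exact: (braid3_alternating (F0 i) (F0 j) c0 h1 h2 h3 h4 h5 h6).
have c0' : (sroot j)%:F + (sroot i)%:F != 0 by rewrite addrC.
have E2 : (d j (d i (d j f)))%:F * ((sroot j)%:F * (sroot i)%:F *
    ((sroot j)%:F + (sroot i)%:F)) = f%:F - (s j f)%:F - (s i f)%:F +
  (s j (s i f))%:F + (s i (s j f))%:F - (s j (s i (s j f)))%:F.
  have h1 := dF0 j f; have := dF1 f sij; have h3 := dF2 f sjij.
  have h4 := dF0 i (d j f); have := dF1 (d j f) sji; have h6 := dF0 j (d i (d j f)).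
  rewrite /= ![(_ + _)%:F]rmorphD /= !s_dif ![(sroot i)%:F + _]addrC => h5 h2.
  exact: (braid3_alternating (F0 j) (F0 i) c0' h1 h2 h3 h4 h5 h6).
have g0 : (sroot i)%:F * (sroot j)%:F * ((sroot i)%:F + (sroot j)%:F) != 0.
  exact: (mulf_neq0 (mulf_neq0 (F0 i) (F0 j)) c0).
apply/eqP; rewrite -tofrac_eq; apply/eqP; apply: (mulIf g0); rewrite E1.
have -> : (sroot i)%:F * (sroot j)%:F * ((sroot i)%:F + (sroot j)%:F) =
  (sroot j)%:F * (sroot i)%:F * ((sroot j)%:F + (sroot i)%:F) by ring.
rewrite E2.
have -> : s i (s j (s i f)) = s j (s i (s j f)) by rewrite -!wactM ?mulgA simple_braid3.
by ring.
Qed.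

Lemma dif_braid4 i j f : i = 0%N :> nat -> j = 1%N :> nat ->
  d j (d i (d j (d i f))) = d i (d j (d i (d j f))).
Proof.
move=> i0 j1; have j0 : j != 0%N :> nat by lia.
have pj : prev_ord j = i by apply: val_inj; rewrite /= j1 i0.
have ji : (j == i) = false by rewrite -val_eqE /= i0 j1.
have Ri : sroot i = 2%:R * x i by rewrite /sroot i0.
have Rj : sroot j = x j - x i by rewrite /sroot (negPf j0) pj.
have sji : s j (sroot i) = sroot i + 2%:R * sroot j.
  by rewrite Ri Rj rmorphM rmorph_nat /= s_var // pj tpermL; ring.
have sij : s i (sroot j) = sroot i + sroot j.
  by rewrite Ri Rj rmorphB /= !s_var0 // ji eqxx; ring.
have siji : s i (s j (sroot i)) = sroot i + 2%:R * sroot j.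
  by rewrite sji rmorphD rmorphM rmorph_nat /= s_sroot sij; ring.
have sjij : s j (s i (sroot j)) = sroot i + sroot j.
  by rewrite sij rmorphD /= s_sroot sji; ring.
have sjiji : s j (s i (s j (sroot i))) = sroot i.
  by rewrite siji rmorphD rmorphM rmorph_nat /= s_sroot sji; ring.
have sijij : s i (s j (s i (sroot j))) = sroot j.
  by rewrite sjij rmorphD /= s_sroot sij; ring.
have F0 k : (sroot k)%:F != 0 by rewrite tofrac_eq0 sroot_neq0.
have c0 : (sroot i)%:F + (sroot j)%:F != 0 by rewrite -rmorphD /= -sij tofrac_eq0 s_eq0 sroot_neq0.
have e0 : (sroot i)%:F + 2 * (sroot j)%:F != 0.
  by rewrite -[2](rmorph_nat (@tofrac A)) -rmorphM -rmorphD /= -sji tofrac_eq0 s_eq0 sroot_neq0.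
have F2 : (sroot i + 2%:R * sroot j)%:F = (sroot i)%:F + 2 * (sroot j)%:F.
  by rewrite rmorphD rmorphM rmorph_nat.
have E1 : (d j (d i (d j (d i f))))%:F * ((sroot i)%:F * (sroot j)%:F *
    ((sroot i)%:F + (sroot j)%:F) * ((sroot i)%:F + 2 * (sroot j)%:F)) =
  f%:F - (s i f)%:F - (s j f)%:F + (s i (s j f))%:F + (s j (s i f))%:F -
  (s i (s j (s i f)))%:F - (s j (s i (s j f)))%:F + (s j (s i (s j (s i f))))%:F.
  have h1 := dF0 i f; have := dF1 f sji; have := dF2 f siji; have h4 := dF3 f sjiji.
  have h5 := dF0 j (d i f); have := dF1 (d i f) sij; have := dF2 (d i f) sjij.
  have h8 := dF0 i (d j (d i f)); have := dF1 (d j (d i f)) sji.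
  have h10 := dF0 j (d i (d j (d i f))).
  rewrite /= !F2 ![(_ + _)%:F]rmorphD /= !s_dif => h9 h7 h6 h3 h2.
  exact: (braid4_alternating_i (F0 i) (F0 j) c0 e0 h1 h2 h3 h4 h5 h6 h7 h8 h9 h10).
have E2 : (d i (d j (d i (d j f))))%:F * ((sroot i)%:F * (sroot j)%:F *
    ((sroot i)%:F + (sroot j)%:F) * ((sroot i)%:F + 2 * (sroot j)%:F)) =
  f%:F - (s i f)%:F - (s j f)%:F + (s i (s j f))%:F + (s j (s i f))%:F -
  (s i (s j (s i f)))%:F - (s j (s i (s j f)))%:F + (s i (s j (s i (s j f))))%:F.
  have h1 := dF0 j f; have := dF1 f sij; have := dF2 f sjij; have h4 := dF3 f sijij.
  have h5 := dF0 i (d j f); have := dF1 (d j f) sji; have := dF2 (d j f) siji.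
  have h8 := dF0 j (d i (d j f)); have := dF1 (d i (d j f)) sij.
  have h10 := dF0 i (d j (d i (d j f))).
  rewrite /= !F2 ![(_ + _)%:F]rmorphD /= !s_dif => h9 h7 h6 h3 h2.
  exact: (braid4_alternating_j (F0 i) (F0 j) c0 e0 h1 h2 h3 h4 h5 h6 h7 h8 h9 h10).
apply/eqP; rewrite -tofrac_eq; apply/eqP; apply: (mulIf (mulf_neq0 (mulf_neq0 (mulf_neq0 (F0 i) (F0 j)) c0) e0)).
by rewrite E1 E2 -!wactM ?mulgA -simple_braid4.
Qed.

(** * Composite divided differences *)

Definition ddw (a : seq 'I_n) f : A := foldr (@dif n A) f a.

Lemma ddw_cat a b f : ddw (a ++ b) f = ddw a (ddw b f).
Proof. exact: foldr_cat. Qed.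

Lemma ddw_rcons a i f : ddw (rcons a i) f = ddw a (d i f).
Proof. by rewrite -cats1 ddw_cat. Qed.

Lemma ddw_is_zmod_morphism a : zmod_morphism (ddw a).
Proof. by elim: a => [|i a IH] f g //=; rewrite IH raddfB. Qed.
HB.instance Definition _ a :=
  GRing.isZmodMorphism.Build A A (ddw a) (ddw_is_zmod_morphism a).

(** Matsumoto's theorem, by the usual induction on the last letters: if s_i and
    s_j both end reduced words of w, then so do both sides of their braid
    relation, preceded by the same word. *)
Theorem ddw_reduced a b f : wprod a = wprod b :> sperm n ->
  size a = invs (wprod a) -> size b = invs (wprod b) -> ddw a f = ddw b f.
Proof.
have mulsK (w : sperm n) i : (w * simple i * simple i = w)%g by rewrite -mulgA simpleK mulg1.
move e: (size a) => m; elim: m a b f e => [|m IH] a b f.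
  by move/size0nil => -> <-; rewrite /wprod big_nil invs1 => _ /size0nil->.
(* It suffices to find reduced words [c ++ x] and [c ++ y] for w s_i and w s_j
   whose tails x and y, followed by i and j, act in the same way. *)
have main i j c x y a' b' w g : wprod a' = (w * simple i)%g -> wprod b' = (w * simple j)%g ->
    size a' = m -> size b' = m -> invs (w * simple i)%g = m -> invs (w * simple j)%g = m ->
    wprod (c ++ x) = (w * simple i)%g -> wprod (c ++ y) = (w * simple j)%g ->
    size (c ++ x) = m -> size (c ++ y) = m ->
    ddw x (d i g) = ddw y (d j g) -> ddw a' (d i g) = ddw b' (d j g).
  move=> ea eb sa sb li lj ex ey sx sy exy.
  rewrite (IH a' (c ++ x)) ?ea ?ex ?sx ?li //.
  by rewrite -(IH (c ++ y) b') ?eb ?ey ?sy ?lj // !ddw_cat exy.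
have key i j a' b' g : (i < j)%N -> size a' = m -> size b' = m ->
    wprod (rcons a' i) = wprod (rcons b' j) -> invs (wprod (rcons a' i)) = m.+1 ->
    ddw a' (d i g) = ddw b' (d j g).
  move=> ij sa sb eab la; pose w := wprod (rcons a' i).
  have di : descent w i by apply: descentP (erefl _) _; rewrite la sa.
  have dj : descent w j by apply: descentP (esym eab) _; rewrite la sb.
  have wa : wprod a' = (w * simple i)%g by rewrite /w wprod_rcons mulsK.
  have wb : wprod b' = (w * simple j)%g by rewrite /w eab wprod_rcons mulsK.
  have li : invs (w * simple i)%g = m by have := invs_descent di; rewrite la => -[].
  have lj : invs (w * simple j)%g = m by have := invs_descent dj; rewrite la => -[].
  have {}main := main i j _ _ _ a' b' w g wa wb sa sb li lj.
  case: (ltngtP i.+1 j) => [far||ji]; last 2 first.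
  - by rewrite ltnS leqNgt ij.
  - have ww := word_of_length; case: (eqVneq (i : nat) 0%N) => i0.
      have j1 : j = 1%N :> nat by rewrite -ji i0.
      have [c ec sc] := ww _ (w * simple i * simple j * simple i * simple j)%g.
      have := descents_braid4 i0 j1 di dj; rewrite la -sc => -[em].
      apply: (main c [:: j; i; j] [:: i; j; i]); rewrite ?size_cat ?em /=.
      + by rewrite wprod_cat ec /wprod !big_cons big_nil mulg1 !mulgA !mulsK.
      + rewrite wprod_cat ec /wprod !big_cons big_nil mulg1 !mulgA.
        by rewrite -!(mulgA w) mulgA simple_braid4 // !mulgA !mulsK.
      + by rewrite addn3.
      + by rewrite addn3.
      + exact: dif_braid4.
    have [c ec sc] := ww _ (w * simple i * simple j * simple i)%g.
    have := descents_braid3 i0 (esym ji) di dj; rewrite la -sc => -[em].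
    apply: (main c [:: i; j] [:: j; i]); rewrite ?size_cat ?em /=.
    + by rewrite wprod_cat ec /wprod !big_cons big_nil mulg1 !mulgA !mulsK.
    + rewrite wprod_cat ec /wprod !big_cons big_nil mulg1 !mulgA.
      by rewrite -!(mulgA w) mulgA simple_braid3 // !mulgA !mulsK.
    + by rewrite addn2.
    + by rewrite addn2.
    + exact: dif_braid3.
  have [c ec sc] := word_of_length (w * simple i * simple j)%g.
  have := descents_far far di dj; rewrite la -sc => -[em].
  apply: (main c [:: j] [:: i]); rewrite ?size_cat ?em ?addn1 //=.
  - by rewrite wprod_cat ec /wprod big_seq1 mulsK.
  - by rewrite wprod_cat ec /wprod big_seq1 -(mulgA w) simple_far // mulgA mulsK.
  - exact/esym/dif_far.
elim/last_ind: a => // a i _; rewrite size_rcons => -[sa] eab.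
rewrite -eab => la; elim/last_ind: b eab => [|b j _ eab]; first by rewrite -la.
rewrite -la size_rcons => -[sb]; rewrite !ddw_rcons.
case: (ltngtP i j) => [ij|ji|/val_inj ij].
- by apply: key; rewrite ?sb -?la.
- by apply/esym/key; rewrite ?sb -?eab -?la.
- subst j; have di : descent (wprod (rcons a i)) i.
    by apply: descentP (erefl _) _; rewrite -la sa.
  move: (invs_descent di) eab; rewrite -la !wprod_rcons mulsK => -[lm] /mulIg eab.
  by apply: IH; rewrite ?sb ?sa -?eab.
Qed.

(* A reduced word of w may be chosen to end with any given descent of w. *)
Lemma descent_word a i : size a = invs (wprod a) -> descent (wprod a) i ->
  exists c, forall f, ddw a f = ddw c (d i f).
Proof.
move=> la di; have [c ec sc] := word_of_length (wprod a * simple i)%g.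
exists c => f; rewrite -ddw_rcons; apply: ddw_reduced => //.
  by rewrite wprod_rcons ec -mulgA simpleK mulg1.
by rewrite size_rcons sc wprod_rcons ec -mulgA simpleK mulg1 -invs_descent.
Qed.

Lemma ddw_nonreduced a f : (invs (wprod a) < size a)%N -> ddw a f = 0.
Proof.
elim/last_ind: a f => [|a i IH] f; first by rewrite ltn0.
rewrite size_rcons ltnS ddw_rcons => la.
have := invs_wprod a; rewrite leq_eqVlt => /orP[/eqP ea|/IH->//].
have di : descent (wprod a) i.
  apply/negPn/negP => /invs_ascent e; move: la.
  by rewrite wprod_rcons e ea ltnn.
by have [c ->] := descent_word (esym ea) di; rewrite difK raddf0.
Qed.

Definition dd w f : A := ddw (reduced_word w) f.

HB.instance Definition _ w := GRing.Additive.copy (dd w) (ddw (reduced_word w)).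

Lemma ddE a f : size a = invs (wprod a) -> dd (wprod a) f = ddw a f.
Proof.
by move=> la; apply: ddw_reduced; rewrite ?reduced_wordP // size_tuple slengthE.
Qed.

Lemma dd1 f : dd 1%g f = f.
Proof. by have := @ddE [::] f; rewrite /wprod big_nil invs1 => ->. Qed.

Lemma dd_comp u v f : invs (u * v)%g = (invs u + invs v)%N -> dd u (dd v f) = dd (u * v)%g f.
Proof.
have [a <- la] := word_of_length u; have [b <- lb] := word_of_length v.
by rewrite -wprod_cat => e; rewrite !ddE ?ddw_cat // size_cat la lb e.
Qed.

Lemma dd_comp0 u v f : invs (u * v)%g != (invs u + invs v)%N -> dd u (dd v f) = 0.
Proof.
have [a <- la] := word_of_length u; have [b <- lb] := word_of_length v.
rewrite -wprod_cat -la -lb => ne; rewrite !ddE // -ddw_cat ddw_nonreduced //.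
by rewrite size_cat ltn_neqAle ne -size_cat invs_wprod.
Qed.

Lemma dd_descent w i f : descent w i -> dd w f = dd (w * simple i)%g (d i f).
Proof.
move=> di; have [a ea la] := word_of_length (w * simple i)%g.
have ew : wprod (rcons a i) = w by rewrite wprod_rcons ea -mulgA simpleK mulg1.
rewrite -{1}ew ddE ?ddw_rcons -?ea ?ddE ?ea //.
by rewrite ew size_rcons la -invs_descent.
Qed.

Lemma dd_kill w i f : descent w i -> dd w (d i f) = 0.
Proof. by move=> di; rewrite (dd_descent _ di) difK raddf0. Qed.

End BraidRelations.

(** * Pfaffians *)

Lemma lift_perm_exists n (i : 'I_n.+1) (s : 'S_n.+1) : exists t, s = lift_perm i (s i) t.
Proof.
pose f k := odflt k (unlift (s i) (s (lift i k))).
have fE k : lift (s i) (f k) = s (lift i k).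
  have ne : s i != s (lift i k) by rewrite (inj_eq perm_inj) neq_lift.
  by rewrite /f; case: (unlift_some ne) => j -> ->.
have f_inj : injective f.
  by move=> j k /(congr1 (lift (s i))); rewrite !fE => /perm_inj/lift_inj.
exists (perm f_inj); apply/permP => j; case: (unliftP i j) => [k|] ->.
  by rewrite lift_perm_lift permE fE.
by rewrite lift_perm_id.
Qed.

Section PfaffianExpansion.
Variable m : nat.
Local Notation I2 := 'I_m.*2.+2.
Local Notation even0 := (ord0 : I2).
Local Notation odd0 := (lift ord0 ord0 : I2).

(* The matchings pairing 1 with the value [lift ord0 j]. *)
Let join (j : 'I_m.*2.+1) (t : 'S_m.*2) : 'S_m.*2.+2 :=
  lift_perm ord0 ord0 (lift_perm ord0 j t).

Let join_even0 j t : join j t even0 = ord0.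
Proof. by rewrite /join lift_perm_id. Qed.

Let join_odd0 j t : join j t odd0 = lift ord0 j.
Proof. by rewrite /join lift_perm_lift lift_perm_id. Qed.

Let join_lift j t k : join j t (lift ord0 (lift ord0 k)) = lift ord0 (lift j (t k)).
Proof. by rewrite /join !lift_perm_lift. Qed.

Let pf_even0 : pf_even (ord0 : 'I_m.+1) = even0 :> I2.
Proof. exact: val_inj. Qed.

Let pf_odd0 : pf_odd (ord0 : 'I_m.+1) = odd0 :> I2.
Proof. exact: val_inj. Qed.

Let pf_even_lift (i : 'I_m) : pf_even (lift ord0 i) = lift ord0 (lift ord0 (pf_even i)) :> I2.
Proof. exact: val_inj. Qed.

Let pf_odd_lift (i : 'I_m) : pf_odd (lift ord0 i) = lift ord0 (lift ord0 (pf_odd i)) :> I2.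
Proof. exact: val_inj. Qed.

Let lt_lift n (h : 'I_n.+1) (i j : 'I_n) : (lift h i < lift h j)%N = (i < j)%N.
Proof. by rewrite /= !ltnNge leq_bump2. Qed.

Let ord0P n (i : 'I_n.+1) : i = ord0 \/ exists k, i = lift ord0 k.
Proof. by case: (unliftP ord0 i) => [k ->|->]; [right; exists k|left]. Qed.

Let matching_join j t : is_matching (m := m.+1) (join j t) = is_matching t.
Proof.
apply/andP/andP => -[/forallP h1 /forallP h2]; split; apply/forallP => i.
- by have := h1 (lift ord0 i); rewrite pf_even_lift pf_odd_lift !join_lift !lt_lift.
- apply/forallP => k; have /forallP/(_ (lift ord0 k)) := h2 (lift ord0 i).
  by rewrite !pf_even_lift !join_lift !lt_lift.
- have [->|[i' ->]] := ord0P i; first by rewrite pf_even0 pf_odd0 join_even0 join_odd0.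
  by rewrite pf_even_lift pf_odd_lift !join_lift !lt_lift.
apply/forallP => k; have [->|[k' ->]] := ord0P k; first by rewrite ltn0.
have [->|[i' ->]] := ord0P i; first by rewrite pf_even0 pf_even_lift join_even0 join_lift.
by rewrite !pf_even_lift !join_lift !lt_lift; have /forallP := h2 i'; apply.
Qed.

Let matching0 (s : 'S_m.*2.+2) : is_matching (m := m.+1) s -> s even0 = ord0.
Proof.
case/andP => /forallP h1 /forallP h2; pose k := (s^-1)%g ord0.
have sk : s k = ord0 by rewrite permKV.
have half_lt : (k./2 < m.+1)%N by have := ltn_ord k; lia.
pose i : 'I_m.+1 := Ordinal half_lt.
have [ke|ko] : k = pf_even i :> nat \/ k = pf_odd i :> nat.
  rewrite /=; case: (boolP (odd k)) => ok; [right|left]; move: (odd_double_half k); lia.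
- have [i0|[i' ei]] := ord0P i.
    by move: sk; have -> : k = even0 by apply: val_inj; apply: (etrans ke); rewrite i0.
  have i_gt0 : ((ord0 : 'I_m.+1) < i)%N by rewrite ei.
  have := implyP (forallP (h2 ord0) i) i_gt0.
  have -> : pf_even i = k :> I2 by apply: val_inj; exact: (esym ke).
  by rewrite sk ltn0.
- have := h1 i; have -> : pf_odd i = k :> I2 by apply: val_inj; exact: (esym ko).
  by rewrite sk ltn0.
Qed.

Let joinP (s : 'S_m.*2.+2) : is_matching (m := m.+1) s -> exists j t, s = join j t.
Proof.
move=> /matching0 s0; have [t et] := lift_perm_exists ord0 s.
have [t' et'] := lift_perm_exists ord0 t.
by exists (t ord0), t'; rewrite et s0 {1}et'.
Qed.

Let join_inj j : injective (join j).
Proof.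
move=> t t' e; apply/permP => k; apply: (@lift_inj _ j); apply: (@lift_inj _ ord0).
by rewrite -!join_lift e.
Qed.

(** A matching pairs 1 with some j, and the remaining indices are matched by a
    permutation in two points less: this is the bijection [join], whose sign is
    that of j. *)
Lemma pfaffian_expand (R : comNzRingType) (a : 'I_m.+1.*2 -> 'I_m.+1.*2 -> R) :
  pfaffian a = \sum_(j < m.*2.+1) (-1) ^+ j * a (ord0 : I2) (lift ord0 j : I2) *
    pfaffian (fun k l : 'I_m.*2 => a (lift ord0 (lift j k) : I2) (lift ord0 (lift j l) : I2)).
Proof.
rewrite /pfaffian.
pose f (s : 'S_m.*2.+2) : 'I_m.*2.+1 := odflt ord0 (unlift ord0 (s odd0)).
have fE j t : f (join j t) = j by rewrite /f join_odd0 liftK.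
rewrite (partition_big f predT) //=; apply: eq_bigr => j _.
rewrite (eq_bigl (mem (join j @: [set t | is_matching t]))) => [|s]; last first.
  apply/andP/imsetP => [[ms /eqP fs]|[t]].
    have [j' [t es]] := joinP ms; exists t; last by rewrite es -fs es fE.
    by rewrite inE -(matching_join j') -es.
  by rewrite inE => mt ->; rewrite matching_join mt fE.
rewrite big_imset /=; last by move=> t t' _ _; apply: join_inj.
rewrite big_distrr /=; apply: eq_big => [t|t _]; first by rewrite inE.
rewrite big_ord_recl pf_even0 pf_odd0 join_even0 join_odd0 !odd_lift_perm /=.
rewrite signr_addb signr_odd !mulrA; congr (_ * _).
  by rewrite -!mulrA; congr (_ * _); rewrite mulrC.
by apply: eq_bigr => i _; rewrite pf_even_lift pf_odd_lift !join_lift.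
Qed.

End PfaffianExpansion.

(** * Pfaffians attached to a sequence *)

Section QFamily.
Variables (A : comNzRingType) (e : nat -> A).
Implicit Types (c : nat -> A) (F G : seq nat -> A) (l t : seq nat) (a b : nat).

(** With e_k for the k-th elementary symmetric polynomial, [qpair] and [qpf] are
    the polynomials Q~_(a,b) and Q~_l, for an arbitrary list l. *)
Definition cross a b : A := \sum_(1 <= k < b.+1) (-1) ^+ k * (e (a + k) * e (b - k)).

Definition qpair a b : A := e a * e b + 2%:R * cross a b.

Definition qpf l : A :=
  pfaffian (fun i j : 'I_(uphalf (size l)).*2 => qpair (nth 0%N l i) (nth 0%N l j)).

(** Signed sum over the deletion of one entry (see [delsumE]): contraction of
    [F], seen as an alternating form, with the functional [c]. *)
Fixpoint delsum c F l : A :=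
  if l is a :: l' then c a * F l' - delsum c (fun t => F (a :: t)) l' else 0.

Definition delete l j := take j l ++ drop j.+1 l.

Lemma delsumE c F l :
  delsum c F l = \sum_(j < size l) (-1) ^+ j * c (nth 0%N l j) * F (delete l j).
Proof.
elim: l F => [|a l IH] F; first by rewrite big_ord0.
rewrite big_ord_recl /= expr0 mul1r /delete take0 drop1 /= IH -sumrN; congr (_ + _).
by apply: eq_bigr => j _; rewrite exprS mulN1r !mulNr.
Qed.

Lemma eq_delsum c F G l : (forall t, (size t).+1 = size l -> F t = G t) ->
  delsum c F l = delsum c G l.
Proof.
elim: l F G => //= a l IH F G FG; rewrite FG //; congr (_ - _).
by apply: IH => t st; apply: FG; rewrite /= st.
Qed.

Lemma eq_delsumc c c' F l : {in l, c =1 c'} -> delsum c F l = delsum c' F l.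
Proof.
elim: l F => //= a l IH F cc; rewrite cc ?mem_head // IH // => b lb.
by rewrite cc // in_cons lb orbT.
Qed.

Lemma delsumD c F G l : delsum c (fun t => F t + G t) l = delsum c F l + delsum c G l.
Proof. by elim: l F G => [|a l IH] F G /=; rewrite ?addr0 // IH; ring. Qed.

Lemma delsumZ c z F l : delsum c (fun t => z * F t) l = z * delsum c F l.
Proof. by elim: l F => [|a l IH] F /=; rewrite ?mulr0 // IH; ring. Qed.

Lemma delsumcZ c z F l : delsum (fun k => z * c k) F l = z * delsum c F l.
Proof. by elim: l F => [|a l IH] F /=; rewrite ?mulr0 // IH; ring. Qed.

Lemma delsumcD c c' F l : delsum (fun k => c k + c' k) F l = delsum c F l + delsum c' F l.
Proof. by elim: l F => [|a l IH] F /=; rewrite ?addr0 // IH; ring. Qed.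

(** As for the contractions of an exterior algebra: the two deletions may be made in
    either order, and this changes the sign of one of them. *)
Lemma delsum_anti c c' F l :
  delsum c (delsum c' F) l = - delsum c' (delsum c F) l.
Proof.
elim: l F => [|a l IH] F /=; first by rewrite oppr0.
have E c1 c2 : delsum c1 (fun t => c2 a * F t - delsum c2 (fun u => F (a :: u)) t) l
   = c2 a * delsum c1 F l - delsum c1 (delsum c2 (fun u => F (a :: u))) l.
  rewrite -delsumZ -mulN1r -delsumZ -delsumD.
  by apply: eq_delsum => t _; rewrite mulN1r.
by rewrite !E IH; ring.
Qed.

Lemma delsum_square c F l : 2%:R * delsum c (delsum c F) l = 0.
Proof. by rewrite mulr_natl mulr2n {1}delsum_anti addNr. Qed.

Hypothesis e0 : e 0 = 1.

Lemma cross0 a : cross a 0 = 0.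
Proof. by rewrite /cross big_geq. Qed.

Lemma nth_delete l j k : nth 0%N (delete l j) k = nth 0%N l (bump j k).
Proof.
rewrite /delete nth_cat size_take_min /bump; case: (leqP j k) => jk.
  case: (ltnP j (size l)) => js.
    by rewrite ltnNge jk /= nth_drop; congr nth; lia.
  rewrite ltnNge (leq_trans js jk) /= nth_drop !nth_default //; lia.
rewrite add0n leq_min jk /=; case: ltnP => ks; first by rewrite nth_take.
rewrite nth_default ?size_drop ?nth_default //; lia.
Qed.

Lemma size_delete l j : (j < size l)%N -> size (delete l j) = (size l).-1.
Proof. by move=> js; rewrite size_cat size_takel ?size_drop; lia. Qed.

Lemma delete_size l : delete l (size l) = l.
Proof. by rewrite /delete take_size drop_oversize // cats0. Qed.

Let qpf_of m l := pfaffian (fun i j : 'I_m.*2 => qpair (nth 0%N l i) (nth 0%N l j)).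

Let qpf_ofE l : qpf l = qpf_of (uphalf (size l)) l. Proof. by []. Qed.

Let qpf_of_cons m a l : qpf_of m.+1 (a :: l) =
  \sum_(j < m.*2.+1) (-1) ^+ j * qpair a (nth 0%N l j) * qpf_of m (delete l j).
Proof.
rewrite /qpf_of pfaffian_expand; apply: eq_bigr => j _; congr (_ * _).
rewrite /pfaffian; apply: eq_bigr => s _; congr (_ * _).
by apply: eq_bigr => i _; rewrite !nth_delete.
Qed.

Lemma qpf_nil : qpf [::] = 1.
Proof.
rewrite /qpf /pfaffian (bigD1 1%g) /=; last by apply/andP; split; apply/forallP => -[].
rewrite big_ord0 odd_perm1 mulr1 big1 ?addr0 // => s /andP[_ /eqP[]].
by apply/permP => -[].
Qed.

(** An odd list is padded with a zero, and [qpair a 0 = e a], whence the last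
    summand. *)
Lemma qpf_row a l : qpf (a :: l) =
  e a * delsum e qpf l + 2%:R * delsum (cross a) qpf l
  + (if odd (size l) then 0 else e a * qpf l).
Proof.
have -> : e a * delsum e qpf l + 2%:R * delsum (cross a) qpf l = delsum (qpair a) qpf l.
  by rewrite -!delsumcZ -delsumcD.
rewrite qpf_ofE delsumE /= qpf_of_cons.
have del j : (j < size l)%N -> qpf (delete l j) = qpf_of (size l)./2 (delete l j).
  move=> js; rewrite qpf_ofE size_delete //; congr qpf_of; case: (size l) js => //= *; lia.
case: (boolP (odd (size l))) => ol.
  have sl : (size l)./2.*2.+1 = size l by rewrite -[RHS]odd_double_half ol.
  by rewrite sl addr0; apply: eq_bigr => j _; rewrite del.
have sl : (size l)./2.*2 = size l by rewrite -[RHS]odd_double_half (negPf ol).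
rewrite sl big_ord_recr /= nth_default // delete_size qpf_ofE uphalf_half (negPf ol) /=.
rewrite -signr_odd (negPf ol) mul1r; congr (_ + _).
  by apply: eq_bigr => j _; rewrite del.
by rewrite /qpair e0 cross0 mulr0 addr0 mulr1 add0n.
Qed.

(** The contraction of [qpf] with [e] vanishes on lists of even size and fixes
    [qpf] on the others, so the parity case disappears from the row expansion. *)
Lemma delsum_qpf l : delsum e qpf l = if odd (size l) then qpf l else 0.
Proof.
have [k] := ubnP (size l); elim: k l => // k IH [|a l] //=; rewrite ltnS => lk.
have {}IHl : delsum e qpf l = if odd (size l) then qpf l else 0 by apply: IH.
have E : delsum e (fun t => qpf (a :: t)) l =
    e a * delsum e qpf l + 2%:R * delsum e (delsum (cross a) qpf) l.
  rewrite -!delsumZ -delsumD; apply: eq_delsum => t st.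
  by rewrite qpf_row IH; [case: ifP => _; ring | lia].
rewrite E delsum_anti IHl qpf_row IHl.
have -> : delsum (cross a) (delsum e qpf) l = if odd (size l) then 0 else delsum (cross a) qpf l.
  case: ifP => ol; last first.
    by apply: eq_delsum => t st; rewrite IH; [rewrite -st /= in ol; move/negbFE: ol => -> | lia].
  rewrite -[RHS](mul0r (delsum (cross a) qpf l)) -delsumZ; apply: eq_delsum => t st.
  by rewrite IH; [rewrite -st /= in ol; rewrite (negPf ol) mul0r | lia].
by case: (odd (size l)) => /=; ring.
Qed.

(** The recursion used for all inductions on lists. *)
Lemma qpf_cons a l : qpf (a :: l) = e a * qpf l + 2%:R * delsum (cross a) qpf l.
Proof. by rewrite qpf_row delsum_qpf; case: ifP => _; ring. Qed.

(** Up to sign, the coefficient of t^(a+b) in E(t) E(-t), where E is the generating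
    series of [e]; it measures how far [qpf] is from alternating. *)
Definition sym_cross a b : A := e a * e b + cross a b + cross b a.

Lemma qpf_swap a b l :
  qpf (a :: b :: l) + qpf (b :: a :: l) = 2%:R * sym_cross a b * qpf l.
Proof.
have E a' b' : qpf (a' :: b' :: l) = e a' * qpf (b' :: l) + 2%:R * cross a' b' * qpf l
   - 2%:R * (e b' * delsum (cross a') qpf l
             + 2%:R * delsum (cross a') (delsum (cross b') qpf) l).
  rewrite qpf_cons /= -!delsumZ -delsumD.
  rewrite (eq_delsum (F := fun t => qpf (b' :: t)) _ (fun t _ => qpf_cons b' t)); ring.
by rewrite !E !qpf_cons delsum_anti /sym_cross; ring.
Qed.

Lemma qpf_double a l : 2%:R * qpf (a :: a :: l) = 2%:R * sym_cross a a * qpf l.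
Proof. by rewrite -qpf_swap mulr_natl mulr2n. Qed.

End QFamily.

Lemma rmorph_qpf (A B : comNzRingType) (phi : {rmorphism A -> B}) (e : nat -> A) l :
  phi (qpf e l) = qpf (phi \o e) l.
Proof.
rewrite /qpf /pfaffian rmorph_sum; apply: eq_bigr => t _.
rewrite rmorphM rmorph_sign rmorph_prod; congr (_ * _); apply: eq_bigr => i _.
rewrite /qpair rmorphD !rmorphM rmorph_nat /cross rmorph_sum; congr (_ + _ * _).
by apply: eq_bigr => k _; rewrite !rmorphM rmorph_sign.
Qed.

Lemma eq_qpf (A : comNzRingType) (e e' : nat -> A) l : e =1 e' -> qpf e l = qpf e' l.
Proof.
move=> ee'; rewrite /qpf /pfaffian; apply: eq_bigr => t _; congr (_ * _).
apply: eq_bigr => i _; rewrite /qpair /cross !ee'; congr (_ + _ * _).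
by apply: eq_bigr => k _; rewrite !ee'.
Qed.

(** * Elementary symmetric polynomials and the long root *)

Section Elementary.
Variables (N : nat) (A : weyl_ring N.+1).
Local Notation n := N.+1.
Implicit Types (f g h : A) (k m p a b : nat) (l : seq nat).

(* Positions and letters as natural numbers. *)
Local Notation x k := (var A (inord k : 'I_n)).
Local Notation s k := (wact A (simple (inord k : 'I_n))).
Local Notation d k := (@dif n A (inord k)).

Lemma s_x0 j : (j < n)%N -> s 0 (x j) = if j == 0%N then - x j else x j.
Proof. by move=> jn; rewrite s_var0 ?inordK // -val_eqE /= !inordK. Qed.

Lemma prev_inord k : (k < n)%N -> prev_ord (inord k : 'I_n) = inord k.-1.
Proof. by move=> kn; apply: val_inj; rewrite /= !inordK //; lia. Qed.

Lemma s_x k j : (0 < k < n)%N -> (j < n)%N ->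
  s k (x j) = x (if j == k.-1 then k else if j == k then k.-1 else j).
Proof.
move=> /andP[k0 kn] jn; rewrite s_var ?inordK -?lt0n // prev_inord // permE /=.
rewrite -!val_eqE /= !inordK //; last lia.
by case: eqP => // _; case: eqP.
Qed.

Lemma s_x_fix k j : (k < n)%N -> (j < n)%N -> j != k -> j.+1 != k -> s k (x j) = x j.
Proof.
case: k => [|k] kn jn jk jk'; first by rewrite s_x0 // (negPf jk).
by rewrite s_x //= (negPf jk) -eqSS (negPf jk').
Qed.

Lemma d_x k : (k < n)%N -> d k (x k) = 1.
Proof.
move=> kn; apply: dif_uniq; rewrite mul1r /sroot inordK //.
case: k kn => [|k] kn; first by rewrite s_x0 //=; ring.
by rewrite s_x //= eqxx gtn_eqF ?ltnSn // prev_inord.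
Qed.

(** [ee k p] is the p-th elementary symmetric polynomial in x_k, ..., x_N, and [es] is
    the same in degree p - j, hence 0 when p < j. *)
Definition egen k : {poly A} := \prod_(k <= i < n) (1 + x i *: 'X).
Definition ee k p : A := (egen k)`_p.
Definition es k j p : A := if (j <= p)%N then ee k (p - j) else 0.

Lemma egenS k : (k < n)%N -> egen k = (1 + x k *: 'X) * egen k.+1.
Proof. by move=> kn; rewrite /egen big_ltn. Qed.

Lemma egen_n k : (n <= k)%N -> egen k = 1.
Proof. by move=> nk; rewrite /egen big_geq. Qed.

Lemma eeS k p : (k < n)%N -> ee k p = ee k.+1 p + x k * es k.+1 1 p.
Proof.
move=> kn; rewrite /ee egenS // mulrDl mul1r coefD -scalerAl coefZ coefXM /es.
by case: p => [|p]; rewrite ?subn1.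
Qed.

Lemma egen_ind (Q : nat -> Prop) : (forall k, (n <= k)%N -> Q k) ->
  (forall k, (k < n)%N -> Q k.+1 -> Q k) -> forall k, Q k.
Proof.
move=> Qn QS k; have [j] := ubnP (n - k)%N; elim: j k => // j IH k.
have [nk _|kn] := leqP n k; first exact: Qn.
by move=> lt; apply: QS => //; apply: IH; lia.
Qed.

Lemma ee0 k : ee k 0 = 1.
Proof.
elim/egen_ind: k => k; first by move=> nk; rewrite /ee egen_n // coef1.
by move=> kn IH; rewrite eeS // /es /= mulr0 addr0.
Qed.

Lemma ee_oversize k p : (n - k < p)%N -> ee k p = 0.
Proof.
elim/egen_ind: k p => k.
  by move=> nk p; rewrite /ee egen_n // coef1; case: p.
move=> kn IH p lt; rewrite eeS // /es IH; last lia.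
by case: ifP => p0; rewrite ?IH ?mulr0 ?addr0 //; lia.
Qed.

Lemma s_egen k m : (k < n)%N -> m != k -> map_poly (s k) (egen m) = egen m.
Proof.
have mapf j i : map_poly (s j) (1 + x i *: 'X) = 1 + s j (x i) *: 'X :> {poly A}.
  by rewrite rmorphD rmorph1 /= map_polyZ map_polyX.
move=> kn; case: (ltngtP m k) => // mk _; last first.
  rewrite /egen rmorph_prod /=; apply: eq_big_nat => i /andP[mi iN].
  by rewrite mapf s_x_fix //; lia.
case: k kn mk => // k kn; rewrite ltnS => mk.
rewrite /egen (big_cat_nat (n := k)) //=; last exact: ltnW (ltnW kn).
rewrite [\prod_(k <= _ < _) _]big_ltn ?(ltnW kn) // [\prod_(k.+1 <= _ < _) _]big_ltn //.
rewrite !rmorphM /= !rmorph_prod !mapf !s_x ?(ltnW kn) //= ?eqxx ?(gtn_eqF (ltnSn _)) ?eqxx.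
congr (_ * _).
  by apply: eq_big_nat => i /andP[mi iN]; rewrite mapf s_x_fix //; lia.
rewrite mulrCA; congr (_ * (_ * _)).
by apply: eq_big_nat => i /andP[mi iN]; rewrite mapf s_x_fix //; lia.
Qed.

Lemma s_ee k m p : (k < n)%N -> m != k -> s k (ee m p) = ee m p.
Proof. by move=> kn mk; rewrite /ee -[in RHS](s_egen kn mk) coef_map. Qed.

Lemma s_es k m j p : (k < n)%N -> m != k -> s k (es m j p) = es m j p.
Proof. by move=> kn mk; rewrite /es; case: ifP; rewrite ?rmorph0 // s_ee. Qed.

(* [ee k p] is linear in x_k, with coefficients that s_k fixes. *)
Lemma d_ee k p : (k < n)%N -> d k (ee k p) = es k.+1 1 p.
Proof.
move=> kn; rewrite eeS // raddfD /= dif_eq0 ?s_ee //; last lia.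
by rewrite add0r difMr ?s_es ?d_x ?mul1r //; lia.
Qed.

Lemma d_es k j p : (k < n)%N -> d k (es k j p) = es k.+1 j.+1 p.
Proof.
move=> kn; rewrite /es; case: ifP => jp; last by rewrite raddf0 ifF //; lia.
rewrite d_ee // /es subn_gt0; case: ifP => // _; congr ee; lia.
Qed.

Definition sym f := forall k, (0 < k < n)%N -> s k f = f.

Lemma symM f g : sym f -> sym g -> sym (f * g).
Proof. by move=> sf sg k kn; rewrite rmorphM sf ?sg. Qed.

Lemma sym_ee p : sym (ee 0 p).
Proof. by move=> k /andP[k0 kn]; rewrite s_ee // ltn_eqF. Qed.

Local Notation e := (ee 0).
Local Notation q := (qpf e).
Local Notation e1 := (ee 1).
Local Notation c := (es 1 1).

Lemma sym_qpf l : sym (q l).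
Proof. by move=> k kn; rewrite rmorph_qpf; apply: eq_qpf => p /=; apply: sym_ee. Qed.

Lemma eE p : e p = e1 p + x 0 * c p.
Proof. exact: eeS. Qed.

Lemma s0_e p : s 0 (e p) = e1 p - x 0 * c p.
Proof. by rewrite eE rmorphD rmorphM /= s_ee // s_es // s_x0 //=; ring. Qed.

Lemma d0_e p : d 0 (e p) = c p.
Proof. exact: d_ee. Qed.

(** The images of the summands of [cross] telescope. *)
Lemma d0_cross a b : d 0 (cross e a b) = - (e1 a * c b).
Proof.
rewrite /cross raddf_sum /=.
pose G k := (-1) ^+ k * (e1 (a + k) * c (b - k)).
transitivity (\sum_(1 <= k < b.+1) (G k - G k.-1)).
  apply: eq_big_nat => k /andP[k0 kb].
  rewrite -[(-1) ^+ k]signr_odd mulr_sign (fun_if (d 0)) raddfN /= -mulr_sign signr_odd.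
  rewrite difM !d0_e s0_e eE /G; case: k k0 kb => // k _ kb /=.
  rewrite exprS {1 2 3 5}/es !addnS /= subn1 /=.
  rewrite [in RHS]/es; have -> : (0 < b - k)%N by lia.
  have -> : (b - k - 1)%N = (b - k.+1)%N by lia.
  by rewrite /es; case: ifP => _; ring.
rewrite big_add1 /= big_mkord -(big_mkord xpredT (fun k => G k.+1 - G k)).
rewrite telescope_sumr // /G addn0 subn0 expr0 mul1r subnn /es /= mulr0 mulr0 sub0r.
by [].
Qed.

Lemma dif_delsum (i : 'I_n) ca F l : dif i (delsum ca F l) =
  delsum (@dif n A i \o ca) F l
  + delsum (wact A (simple i) \o ca) (@dif n A i \o F) l.
Proof.
elim: l F => [|a l IH] F /=; first by rewrite raddf0 addr0.
by rewrite raddfB /= difM IH; ring.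
Qed.

(** The divided difference d_0 contracts the Pfaffians with the elementary symmetric
    polynomials in the variables other than x_0. By induction on the recursion
    [qpf_cons]; the terms with two contractions by the same functional vanish. *)
Lemma d0_qpf l : d 0 (q l) = delsum c q l.
Proof.
have [j] := ubnP (size l); elim: j l => // j IH [|a l] /=; rewrite ltnS => lj.
  by rewrite qpf_nil dif_eq0 ?rmorph1.
have IHt t : (size t <= size l)%N -> d 0 (q t) = delsum c q t.
  by move=> st; apply: IH; apply: leq_ltn_trans lj.
rewrite qpf_cons ?ee0 // raddfD /= difM d0_e IHt //.
rewrite difM dif_eq0 ?rmorph_nat // mul0r add0r dif_delsum.
rewrite (eq_delsumc (c := d 0 \o _) (c' := fun b => - e1 a * c b)); last first.
  by move=> b _ /=; rewrite d0_cross mulNr.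
rewrite delsumcZ (@eq_delsum _ _ (d 0 \o q) (delsum c q)); last first.
  by move=> t st /=; rewrite IHt // -st.
rewrite (eq_delsumc (c := s 0 \o _) (c' := fun b => cross e a b + 2%:R * x 0 * e1 a * c b)); last first.
  move=> b _ /=; rewrite sE d0_cross /sroot inordK //=; ring.
rewrite delsumcD delsumcZ.
have E : delsum c (fun t => q (a :: t)) l =
   e a * delsum c q l + 2%:R * delsum c (delsum (cross e a) q) l.
  by rewrite -!delsumZ -delsumD; apply: eq_delsum => t _; rewrite qpf_cons ?ee0.
rewrite E [delsum c (delsum (cross e a) q) l]delsum_anti s0_e eE.
have := delsum_square c q l; set D := delsum c (delsum c q) l => D0.
transitivity (c a * q l - (e1 a + x 0 * c a) * delsum c q l
   + 2%:R * delsum (cross e a) (delsum c q) l + 2%:R * x 0 * e1 a * (2%:R * D)); first ring.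
by rewrite D0; ring.
Qed.

End Elementary.

(** * Words in the simple reflections *)

Section Words.
Variable N : nat.
Local Notation n := N.+1.

(** The word [aw m] is s_(m-1) ... s_1 s_0. Its operator D_m removes parts from the
    Pfaffians, and [zw ms] is the reduced word of the increasing signed permutation
    whose negative entries are the opposites of [ms]; [ow n] is a reduced word of
    the longest element of S_n. *)
Fixpoint cw m : seq 'I_n := if m is m'.+1 then inord m :: cw m' else [::].
Definition aw m : seq 'I_n := rcons (cw m.-1) (inord 0).
Fixpoint zw (ms : seq nat) : seq 'I_n := if ms is m :: ms' then zw ms' ++ aw m else [::].
Fixpoint ow k : seq 'I_n := if k is k'.+1 then ow k' ++ cw k' else [::].

Fixpoint rho k : seq nat := if k is k'.+1 then k :: rho k' else [::].

Lemma gtn_trans : transitive gtn.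
Proof. by move=> y z t /= yz ty; apply: ltn_trans yz. Qed.

Lemma mem_rho k m : (m \in rho k) = (0 < m <= k)%N.
Proof.
elim: k => [|k IH] /=; first by rewrite in_nil; case: m.
by rewrite in_cons IH; case: (eqVneq m k.+1) => [->|]; rewrite ?ltnSn //; lia.
Qed.

Lemma entry_cw w m (i : 'I_n) : (m <= N)%N -> entry (w * wprod (cw m))%g i =
  entry w (if i == 0%N :> nat then inord m else if (i <= m)%N then inord i.-1 else i).
Proof.
elim: m w i => [|m IH] w i mN /=.
  rewrite /wprod big_nil mulg1; congr entry; case: ifP => [/eqP i0|i0].
    by apply: val_inj; rewrite /= inordK.
  by case: ifP => //; lia.
rewrite -cat1s wprod_cat mulgA {1}/wprod big_seq1 IH; last exact: ltnW.
have mn : (m < n)%N by lia.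
have pm : prev_ord (inord m.+1 : 'I_n) = inord m.
  by apply: val_inj; rewrite /= !inordK //; lia.
rewrite entry_simple ?inordK // pm; congr entry.
case: ifP => i0; first by rewrite tpermL.
have i1 : (i.-1 < n)%N by have := ltn_ord i; lia.
case: ifP => im.
  by rewrite ifT; [rewrite tpermD // -val_eqE /= !inordK //; lia | lia].
case: (eqVneq (i : nat) m.+1) => [e1|ne].
  have -> : i = inord m.+1 by apply: val_inj; rewrite /= inordK.
  by rewrite tpermR inordK // ltnSn.
by rewrite ifF; [rewrite tpermD // -val_eqE /= !inordK //; lia | lia].
Qed.

Lemma entry_aw w m (i : 'I_n) : (0 < m <= n)%N -> entry (w * wprod (aw m))%g i =
  if i == 0%N :> nat then - entry w (inord m.-1)
  else entry w (if (i < m)%N then inord i.-1 else i).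
Proof.
move=> /andP[m0 mn]; rewrite /aw wprod_rcons mulgA entry_simple0 ?inordK //.
have mN : (m.-1 <= N)%N by lia.
rewrite -val_eqE /= inordK //; case: ifP => i0; rewrite entry_cw // ?inordK // i0 //.
by congr entry; case: m m0 {mn mN}.
Qed.

Lemma entry_zw_rho k (i : 'I_n) : (k <= n)%N ->
  entry (wprod (zw (rho k))) i = if (i < k)%N then - (k - i)%N%:Z else i.+1%:Z.
Proof.
elim: k i => [|k IH] i kn /=; first by rewrite /wprod big_nil entry1.
have kn' : (k <= n)%N by lia.
rewrite wprod_cat entry_aw // !IH //.
case: ifP => i0; first by rewrite inordK // ltnn (eqP i0) /=.
have i1 : (i.-1 < n)%N by have := ltn_ord i; lia.
case: (ltnP i k.+1) => ik; last by rewrite ltnNge (ltnW ik).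
by rewrite inordK // ifT; [congr (- _); lia | lia].
Qed.

Lemma entry_ow k (i : 'I_n) : (k <= n)%N ->
  entry (wprod (ow k)) i = if (i < k)%N then (k - i)%N%:Z else i.+1%:Z.
Proof.
elim: k i => [|k IH] i kn /=; first by rewrite /wprod big_nil entry1.
have kn' : (k <= n)%N by lia.
rewrite wprod_cat entry_cw //; case: ifP => i0.
  by rewrite IH // inordK // ltnn (eqP i0) /= subn0.
have i1 : (i.-1 < n)%N by have := ltn_ord i; lia.
case: (ltnP i k.+1) => ik.
  by rewrite -ltnS ik IH // inordK // ifT; [congr (_%:Z); lia | lia].
by rewrite leqNgt ik /= IH // ltnNge (ltnW ik).
Qed.

Lemma wprod_ow : wprod (ow n) = omega_zero n.
Proof.
apply: sperm_entryP => i; rewrite entry_ow // ltn_ord.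
rewrite -[omega_zero n]mul1g entry_omega_zero entry1 /=; congr (_%:Z).
by have := ltn_ord i; lia.
Qed.

Lemma wprod_zw_rho : wprod (zw (rho n)) = (omega_zero n * w_zero n)%g.
Proof.
apply: sperm_entryP => i; rewrite entry_zw_rho // ltn_ord entry_w_zero.
rewrite -[omega_zero n]mul1g entry_omega_zero entry1 /=; congr (- _%:Z).
by have := ltn_ord i; lia.
Qed.

(* After v s_N ... s_1, where v = omega_0 w_0, the first entry is negative. *)
Lemma nonreduced_zw_rho :
  (invs (wprod (rcons (zw (rho n) ++ cw N) (inord 0))) <
   size (rcons (zw (rho n) ++ cw N) (inord 0)))%N.
Proof.
rewrite size_rcons wprod_rcons; set a := zw (rho n) ++ cw N.
have da : descent (wprod a) (inord 0).
  rewrite /descent inordK // eqxx /a wprod_cat entry_cw // inordK // eqxx entry_zw_rho //.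
  by rewrite inordK // ltnSn; lia.
by have := invs_wprod a; rewrite (invs_descent da); lia.
Qed.

End Words.

(** * The operator removing one part, and its adjoint *)

Section Orthogonality.
Variables (N : nat) (A : weyl_ring N.+1).
Local Notation n := N.+1.
Implicit Types (f g h : A) (k m p a b : nat) (l : seq nat).
Local Notation x k := (var A (inord k : 'I_n)).
Local Notation s k := (wact A (simple (inord k : 'I_n))).
Local Notation d k := (@dif n A (inord k)).
Local Notation ee := (ee A).
Local Notation es := (es A).
Local Notation e := (ee 0).
Local Notation e1 := (ee 1).
Local Notation q := (qpf e).
Local Notation c := (es 1 1).
Local Notation cw := (cw N).
Local Notation aw := (aw N).
Local Notation zw := (zw N).

Lemma ddw_cw_sym m f g : (m <= N)%N -> sym g -> ddw (cw m) (g * f) = g * ddw (cw m) f.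
Proof.
by move=> mN sg; elim: m mN => //= m IH mN; rewrite IH 1?ltnW // difMl // sg //; lia.
Qed.

Lemma ddw_cw_es m j p : (m <= N)%N -> ddw (cw m) (es 1 j p) = es m.+1 (j + m) p.
Proof.
elim: m => [|m IH] mN /=; first by rewrite addn0.
by rewrite IH 1?ltnW // d_es ?addnS.
Qed.

Lemma es0 k p : es k 0 p = ee k p.
Proof. by rewrite /es subn0. Qed.

Lemma es_n j p : es n j p = (p == j)%:R.
Proof.
rewrite /es; case: ltngtP => [jp|//|->]; last by rewrite subnn ee0.
by rewrite ee_oversize // subnn; lia.
Qed.

Lemma ddw_cw_delsum m ca l : (m <= N)%N ->
  ddw (cw m) (delsum ca q l) = delsum (ddw (cw m) \o ca) q l.
Proof.
move=> mN; suff H F : (forall t, sym (F t)) ->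
    ddw (cw m) (delsum ca F l) = delsum (ddw (cw m) \o ca) F l.
  by apply: H => t; apply: sym_qpf.
elim: l F => [|a l IH] F sF /=; first by rewrite raddf0.
by rewrite raddfB /= [ca a * _]mulrC ddw_cw_sym // IH // mulrC.
Qed.

(** Contraction by d_0 followed by d_1, ..., d_(m-1), which act on the coefficients
    only because the Pfaffians are symmetric. *)
Lemma ddw_aw m l : (0 < m <= n)%N -> ddw (aw m) (q l) = delsum (es m m) q l.
Proof.
case: m => // m mn; rewrite /aw ddw_rcons d0_qpf ddw_cw_delsum //.
by apply: eq_delsumc => p _ /=; rewrite ddw_cw_es // add1n.
Qed.

(** ** The operators adding a part *)

Local Notation tau := (ddw (cw N)).

Lemma tau_sym f g : sym g -> tau (g * f) = g * tau f.
Proof. exact: ddw_cw_sym. Qed.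

Lemma tau_e1 p : tau (e1 p) = (p == N)%:R.
Proof. by rewrite -es0 ddw_cw_es // es_n. Qed.

Lemma cS p : c p.+1 = e1 p.
Proof. by rewrite /es subn1. Qed.

(* By e1_(b+1) = e_(b+1) - x_0 e1_b, and similarly for a, the degrees a and b + 1 can
   be balanced into a + 1 and b up to terms on which tau is known. *)
Lemma tau_pair a b : (a <= N)%N -> (b <= N)%N ->
  tau (e1 a * e1 b) = if (N <= a + b)%N then e (a + b - N) else 0.
Proof.
elim: b a => [|b IH] a aN bN.
  rewrite ee0 mulr1 tau_e1 addn0; case: (eqVneq a N) => [->|ne].
    by rewrite leqnn subnn ee0.
  by rewrite ifF //; lia.
have E : e1 a * e1 b.+1 = e1 a.+1 * e1 b + (e b.+1 * e1 a - e a.+1 * e1 b).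
  by rewrite !eE !cS; ring.
rewrite E raddfD raddfB /= !(tau_sym _ (@sym_ee _ A _)).
rewrite !tau_e1 [b == N]ltn_eqF // mulr0n mulr0 subr0.
case: (eqVneq a N) => [->|ne].
  by rewrite mulr1n mulr1 [e1 n]ee_oversize ?mul0r ?raddf0 ?add0r ?ifT; [congr ee; lia|lia|lia].
by rewrite mulr0n mulr0 addr0 IH; [rewrite addSnnS | lia | lia].
Qed.

(** The operator [chi m] adds a part m in front (lemma [chi_qpf]); it is the multiple
    e_m plus a correction obtained from d_0 and the multiplier [ppol m]. In this form
    its adjoint can be computed: d_0 is self-adjoint for dV tau, and only the parity
    of [ppol m] in x_0 matters. *)
Definition ppol m : A := \sum_(b < n) (-1) ^+ b * (e (n + m - b) * e1 b).

Definition chi m f : A := e m * f - 2%:R * (-1) ^+ N * tau (ppol m * d 0 f).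

(* ppol m is the coefficient of z^(n+m) in E(z) E'(-z) = (1 + x_0 z) E'(z) E'(-z),
   where E' omits x_0, hence its parity in x_0; altconv is that of E'(z) E'(-z). *)
Let altconv k : A := \sum_(b < k.+1) (-1) ^+ b * (e1 (k - b) * e1 b).

Let altconvN k : altconv k = (-1) ^+ k * altconv k.
Proof.
rewrite {1}/altconv (reindex_inj rev_ord_inj) /= /altconv big_distrr /=.
apply: eq_bigr => b _; rewrite subSS subKn -1?ltnS // mulrA -exprD.
have -> : (-1) ^+ (k + b) = (-1) ^+ (k - b) :> A.
  have -> : (k + b = (k - b) + b.*2)%N by have := ltn_ord b; lia.
  by rewrite exprD -muln2 mulnC exprM sqrrN expr1n expr1n mulr1.
by rewrite [e1 b * _]mulrC.
Qed.

Let s0_altconv k : s 0 (altconv k) = altconv k.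
Proof.
rewrite /altconv rmorph_sum; apply: eq_bigr => b _.
by rewrite !rmorphM rmorph_sign !s_ee.
Qed.

Let ppolE m : (0 < m)%N -> ppol m = altconv (n + m) + x 0 * altconv (n + m).-1.
Proof.
move=> m0.
have trunc k (F : nat -> A) : (N <= k)%N ->
    \sum_(b < k.+1) (-1) ^+ b * (F b * e1 b) = \sum_(b < n) (-1) ^+ b * (F b * e1 b) :> A.
  move=> Nk; rewrite -!(big_mkord xpredT (fun b => (-1) ^+ b * (F b * e1 b))).
  rewrite (big_cat_nat (n := n)) //= [X in _ + X]big1_seq ?addr0 // => b.
  rewrite mem_index_iota => /andP[_ /andP[nb _]].
  by rewrite [e1 b]ee_oversize ?mulr0 //; lia.
rewrite /altconv (trunc (n + m)%N (fun b => e1 (n + m - b))) ?leq_addr //; last by lia.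
rewrite (trunc (N + m)%N (fun b => e1 (N + m - b))) ?leq_addr //=.
rewrite big_distrr /= -big_split /=; apply: eq_bigr => b _.
have -> : (n + m - b = (N + m - b).+1)%N by have := ltn_ord b; lia.
by rewrite eE cS; ring.
Qed.

Lemma s0_ppol m : (0 < m)%N -> s 0 (ppol m) = (-1) ^+ (n + m) * ppol m.
Proof.
move=> m0; rewrite ppolE // rmorphD rmorphM /= !s0_altconv s_x0 //= mulrDr -altconvN.
rewrite exprS [in LHS](altconvN (N + m)); ring.
Qed.

Lemma d0_ppol m : (0 < m)%N -> d 0 (ppol m) = altconv (N + m).
Proof.
by move=> m0; rewrite ppolE // raddfD /= dif_eq0 ?s0_altconv // add0r difMr ?d_x ?mul1r.
Qed.

Lemma alternating_sum p m : (m <= p)%N ->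
  2%:R * \sum_(m <= b < p) (-1) ^+ b = (-1) ^+ m - (-1) ^+ p :> A.
Proof.
elim: p => [|p IH]; first by rewrite leqn0 => /eqP ->; rewrite big_geq // subrr mulr0.
rewrite leq_eqVlt => /orP[/eqP <-|]; first by rewrite big_geq // subrr mulr0.
by rewrite ltnS => mp; rewrite big_nat_recr //= mulrDr IH // exprS; ring.
Qed.

Lemma tau_d0_ppol m : (0 < m <= n)%N ->
  2%:R * (-1) ^+ N * tau (d 0 (ppol m)) = e m * (1 - (-1) ^+ (n + m)).
Proof.
case/andP=> m0 mn; rewrite d0_ppol // /altconv raddf_sum /=.
have -> : \sum_(b < (N + m).+1) tau ((-1) ^+ b * (e1 (N + m - b) * e1 b)) =
    \sum_(m <= b < n) (-1) ^+ b * e m.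
  have sgn_tau b f : tau ((-1) ^+ b * f) = (-1) ^+ b * tau f.
    by rewrite -[(-1) ^+ b]signr_odd !mulr_sign (fun_if tau) raddfN.
  rewrite -(big_mkord xpredT (fun b => tau ((-1) ^+ b * (e1 (N + m - b) * e1 b)))).
  rewrite (big_cat_nat (n := m)) //=; last lia.
  rewrite (big_cat_nat (m := m) (n := n)) //=; last lia.
  rewrite [X in X + _]big1_seq ?add0r => [|b]; last first.
    rewrite mem_index_iota => /andP[_ /andP[_ bm]].
    by rewrite [e1 (_ - b)]ee_oversize ?mul0r ?mulr0 ?raddf0 //; lia.
  rewrite [X in _ + X]big1_seq ?addr0 => [|b]; last first.
    rewrite mem_index_iota => /andP[_ /andP[nb _]].
    by rewrite [e1 b]ee_oversize ?mulr0 ?raddf0 //; lia.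
  apply: eq_big_nat => b /andP[mb bn].
  rewrite sgn_tau tau_pair; [|lia|lia].
  by rewrite ifT; [congr (_ * ee _ _); lia | lia].
rewrite -big_distrl /=.
have sq : (-1) ^+ N * (-1) ^+ N = 1 :> A by rewrite -exprMn mulrNN mulr1 expr1n.
set S := \sum_(_ <= b < _) _; transitivity ((-1) ^+ N * (2%:R * S) * e m); first by ring.
rewrite /S alternating_sum // addSn !exprS exprD.
transitivity (((-1) ^+ N * (-1) ^+ m + (-1) ^+ N * (-1) ^+ N) * e m); first by ring.
by rewrite sq; ring.
Qed.

(* The operator tau turns the product of [ppol m] and a coefficient of d_0 into
   the coefficient of the recursion [qpf_cons]. *)
Lemma tau_ppol_c m p : (p <= n)%N -> tau (ppol m * c p) = (-1) ^+ n * cross e m p.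
Proof.
case: p => [_|p pn]; first by rewrite /es mulr0 raddf0 cross0 mulr0.
rewrite cS /ppol big_distrl raddf_sum /= /cross big_distrr /=.
have -> : \sum_(1 <= j < p.+2) (-1) ^+ n * ((-1) ^+ j * (e (m + j) * e (p.+1 - j))) =
    \sum_(1 <= j < n.+1) if (j <= p.+1)%N then
       (-1) ^+ n * ((-1) ^+ j * (e (m + j) * e (p.+1 - j))) else 0.
  rewrite [RHS](big_cat_nat (n := p.+2)) //= [X in _ + X]big1_seq ?addr0 => [|j].
    by apply: eq_big_nat => j /andP[_ jp]; rewrite -ltnS jp.
  by rewrite mem_index_iota => /andP[_ /andP[jp _]]; rewrite leqNgt jp.
rewrite big_add1 /= big_mkord [RHS](reindex_inj rev_ord_inj) /=.
apply: eq_bigr => b _; have bn := ltn_ord b.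
have sgn_tau f : tau ((-1) ^+ b * f) = (-1) ^+ b * tau f.
  by rewrite -[(-1) ^+ b]signr_odd !mulr_sign (fun_if tau) raddfN.
rewrite -!mulrA sgn_tau (tau_sym _ (@sym_ee _ A _)) tau_pair //.
have -> : (n - b.+1).+1 = (n - b)%N by lia.
case: (leqP N (b + p)) => bp; last by rewrite ifF ?mulr0 //; lia.
rewrite ifT; last lia.
rewrite mulrA -exprD; congr (_ * (_ * _)); [|congr ee; lia|congr ee; lia].
have -> : (n + (n - b) = b + (n - b).*2)%N by lia.
by rewrite exprD -muln2 mulnC exprM sqrrN expr1n expr1n mulr1.
Qed.

Lemma chi_qpf m l : all (leq^~ n) l -> chi m (q l) = q (m :: l).
Proof.
move=> /allP ln; rewrite /chi d0_qpf qpf_cons ?ee0 //.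
have -> : tau (ppol m * delsum c q l) = delsum (fun p => tau (ppol m * c p)) q l.
  suff H F : (forall t, sym (F t)) -> 
      tau (ppol m * delsum c F l) = delsum (fun p => tau (ppol m * c p)) F l.
    by apply: H => t; apply: sym_qpf.
  elim: l F {ln} => [|a l IH] F sF /=; first by rewrite mulr0 raddf0.
  rewrite mulrBr raddfB /= IH // mulrA [_ * F l]mulrC (tau_sym _ (sF l)).
  by rewrite [F l * _]mulrC.
rewrite (@eq_delsumc _ _ (fun p => (-1) ^+ n * cross e m p)) => [|p /ln pn]; last first.
  exact: tau_ppol_c.
rewrite delsumcZ exprS.
have sq : (-1) ^+ N * (-1) ^+ N = 1 :> A by rewrite -exprMn mulrNN mulr1 expr1n.
transitivity (e m * q l + 2%:R * ((-1) ^+ N * (-1) ^+ N) * delsum (cross e m) q l).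
  by ring.
by rewrite sq mulr1.
Qed.

(** * Orthogonality of the Pfaffians *)

(** The operator of omega_0 w_0, see [dVE]. *)
Definition dV f : A := ddw (zw (rho n)) f.

HB.instance Definition _ := GRing.Additive.copy dV (ddw (zw (rho n))).

Lemma dV_tau_d0 f : dV (tau (d 0 f)) = 0.
Proof. by rewrite /dV -ddw_cat -ddw_rcons ddw_nonreduced // nonreduced_zw_rho. Qed.

(** Adding the part m is self-adjoint up to the sign (-1)^(n+m): d_0 is
    self-adjoint for dV tau because dV tau d_0 = 0, and the multiplier [ppol m]
    has parity (-1)^(n+m) in x_0. *)
Lemma chi_adj m f g : (0 < m <= n)%N -> sym f -> sym g ->
  dV (chi m f * g) = (-1) ^+ (n + m) * dV (f * chi m g).
Proof.
move=> mn sf sg; have m0 : (0 < m)%N by case/andP: mn.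
pose p := ppol m; pose ep : A := (-1) ^+ (n + m).
have dVsgn k h : dV ((-1) ^+ k * h) = (-1) ^+ k * dV h.
  by rewrite -[(-1) ^+ k]signr_odd !mulr_sign (fun_if dV) raddfN.
have tausgn k h : tau ((-1) ^+ k * h) = (-1) ^+ k * tau h.
  by rewrite -[(-1) ^+ k]signr_odd !mulr_sign (fun_if tau) raddfN.
have swap : dV (tau (p * d 0 f) * g) =
    dV (f * g * tau (d 0 p)) + ep * dV (f * tau (p * d 0 g)).
  have -> : tau (p * d 0 f) * g = tau (p * g * d 0 f).
    by rewrite mulrC -tau_sym //; congr (tau _); ring.
  have := dif_adj (inord 0) f (p * g).
  move/(canRL (subrK _)) => E; rewrite mulrC E raddfD raddfD /= dV_tau_d0 add0r.
  rewrite difM s0_ppol // mulrDr raddfD raddfD /=; congr (_ + _).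
    by rewrite -tau_sym; [congr (dV (tau _)); ring | exact: symM].
  rewrite -dVsgn -/p; congr (dV _).
  transitivity (tau ((-1) ^+ (n + m) * (f * (p * d 0 g)))); first by congr tau; ring.
  by rewrite tausgn tau_sym // /ep; ring.
have dV2 h : dV (2%:R * h) = 2%:R * dV h by rewrite !mulr_natl raddfMn.
have top : 2%:R * ((-1) ^+ N * dV (f * g * tau (d 0 p))) =
    dV (e m * (f * g)) - ep * dV (e m * (f * g)).
  rewrite -dVsgn -dV2 -dVsgn -raddfB /=; congr (dV _).
  transitivity (f * g * (2%:R * (-1) ^+ N * tau (d 0 p))); first by ring.
  by rewrite tau_d0_ppol // /ep; ring.
transitivity (dV (e m * (f * g)) - 2%:R * ((-1) ^+ N * dV (tau (p * d 0 f) * g))).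
  by rewrite -dVsgn -dV2 -raddfB; congr (dV _); rewrite /chi -/p; ring.
transitivity (ep * (dV (e m * (f * g)) - 2%:R * ((-1) ^+ N * dV (f * tau (p * d 0 g))))).
  rewrite swap [(-1) ^+ N * (_ + _)]mulrDr [2%:R * (_ + _)]mulrDr top; ring.
by rewrite -[(-1) ^+ N * _]dVsgn -dV2 -raddfB; congr (_ * dV _); rewrite /chi -/p; ring.
Qed.

Definition winv f := forall k, (k < n)%N -> s k f = f.

Lemma winv_sym f : winv f -> sym f.
Proof. by move=> wf k /andP[_ kn]; apply: wf. Qed.

Lemma ddw_winv (a : seq 'I_n) f g : winv g -> ddw a (g * f) = g * ddw a f.
Proof.
move=> wg; elim: a => //= i a ->; rewrite difMl //.
by have := wg i (ltn_ord i); rewrite inord_val.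
Qed.

Lemma dV_winv f g : winv g -> dV (g * f) = g * dV f.
Proof. exact: ddw_winv. Qed.

(** The coefficients of E(t) E(-t) are invariant under W_n, since x_0 enters only
    through 1 - x_0^2 t^2. *)
Lemma winv_sym_cross a b : winv (sym_cross e a b).
Proof.
case=> [|k] kn.
  apply: fixed_dif; rewrite /sym_cross !raddfD /= difM !d0_e !d0_cross s0_e !eE; ring.
rewrite /sym_cross /cross !(rmorphD, rmorphM) /= !rmorph_sum.
have se p : s k.+1 (e p) = e p by apply: sym_ee.
by rewrite !se; congr (_ + _ + _); apply: eq_bigr => j _; rewrite !rmorphM rmorph_sign !se.
Qed.

Lemma chi_is_zmod_morphism m : zmod_morphism (chi m).
Proof. by move=> f g; rewrite /chi raddfB /= [ppol m * _]mulrBr raddfB /=; ring. Qed.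
HB.instance Definition _ m :=
  GRing.isZmodMorphism.Build A A (chi m) (chi_is_zmod_morphism m).

Lemma chi_winv m f g : winv g -> chi m (g * f) = g * chi m f.
Proof.
move=> wg; rewrite /chi difMl ?wg // [ppol m * _]mulrCA (tau_sym _ (winv_sym wg)).
by ring.
Qed.

Lemma qpf_cat u t : all (leq^~ n) u -> all (leq^~ n) t ->
  q (u ++ t) = foldr chi (q t) u.
Proof.
move=> + tn; elim: u => //= a u IH /andP[an un].
by rewrite -IH // chi_qpf // all_cat un tn.
Qed.

(* The operators [chi] allow a relation between the last entries of a list to be
   preceded by arbitrary entries. *)
Lemma qpf_swap_in u m a l : all (leq^~ n) (u ++ m :: a :: l) ->
  q (u ++ m :: a :: l) = - q (u ++ a :: m :: l) + 2%:R * sym_cross e m a * q (u ++ l).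
Proof.
rewrite all_cat /= => /and4P[un mn an ln].
rewrite !qpf_cat //= ?mn ?an ?ln //.
have -> : q (m :: a :: l) = - q (a :: m :: l) + 2%:R * sym_cross e m a * q l.
  by rewrite -qpf_swap ?ee0 //; ring.
elim: u un => //= b u IH /andP[_ un]; rewrite IH // raddfD raddfN /= chi_winv //.
by move=> k kn; rewrite rmorphM rmorph_nat winv_sym_cross.
Qed.

Lemma qpf_double_in u a l : all (leq^~ n) (u ++ a :: a :: l) ->
  q (u ++ a :: a :: l) = sym_cross e a a * q (u ++ l).
Proof.
rewrite all_cat /= => /and4P[un an _ ln]; rewrite !qpf_cat //= ?an ?ln //.
have -> : q (a :: a :: l) = sym_cross e a a * q l.
  by apply: (mulfI (two_neq0 A)); rewrite qpf_double ?ee0 // mulrA.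
elim: u un => //= b u IH /andP[_ un]; rewrite IH // chi_winv //.
exact: winv_sym_cross.
Qed.

(** Sorting a new part into a decreasing list, under a functional that kills
    the lists obtained by deleting a part not smaller than the new one. *)
Lemma insert_part (Phi : {additive A -> A}) m u l :
    (forall f g, winv g -> Phi (g * f) = g * Phi f) ->
    (m <= n)%N -> all (leq^~ n) u -> all (leq^~ n) l -> sorted gtn l ->
    (forall a, a \in l -> (m <= a)%N -> Phi (q (u ++ rem a l)) = 0) ->
  if m \in l then Phi (q (u ++ m :: l)) = 0
  else exists l1 l2, [/\ l = l1 ++ l2, all (gtn^~ m) l1, all (ltn^~ m) l2 &
    Phi (q (u ++ m :: l)) = (-1) ^+ size l1 * Phi (q (u ++ l1 ++ m :: l2))].
Proof.
move=> PhiZ mn; elim: l u => [|a l IH] u un /=.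
  by move=> _ _ _; exists [::], [::]; rewrite expr0 mul1r.
case/andP=> an ln sl dell; have al : all (gtn a) l by apply: order_path_min sl; exact: gtn_trans.
have anl : a \notin l by apply/negP => /(allP al) /=; lia.
rewrite in_cons; case: (ltngtP a m) => [am|ma|eam]; last first.
- rewrite /= -eam qpf_double_in ?all_cat /= ?un ?an ?ln //.
  rewrite PhiZ; last exact: winv_sym_cross.
  by have := dell a (mem_head _ _); rewrite eam leqnn /= eqxx => ->; rewrite ?mulr0.
- rewrite orFb.
  have -> : Phi (q (u ++ m :: a :: l)) = - Phi (q (rcons u a ++ m :: l)).
    rewrite qpf_swap_in ?all_cat /= ?un ?mn ?an ?ln // raddfD raddfN /=.
    rewrite PhiZ => [|k kn]; last by rewrite rmorphM rmorph_nat winv_sym_cross.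
    have := dell a (mem_head _ _) (ltnW ma); rewrite /= eqxx => ->.
    by rewrite mulr0 addr0 cat_rcons.
  have := IH (rcons u a); rewrite all_rcons un an ln => /(_ isT isT (path_sorted sl)).
  case: ifP => ml IH'; last first.
    have [|l1 [l2 [-> h1 h2 ->]]] := IH'.
      move=> b bl mb; have := dell b; rewrite in_cons bl orbT => /(_ isT mb) /=.
      by rewrite cat_rcons; case: eqP => // ab; move: anl; rewrite ab bl.
    exists (a :: l1), l2; rewrite /= h1 h2 ma exprS mulN1r mulNr cat_rcons.
    by split.
  rewrite IH' ?oppr0 // => b bl mb; have := dell b; rewrite in_cons bl orbT => /(_ isT mb) /=.
  by rewrite cat_rcons; case: eqP => // ab; move: anl; rewrite ab bl.
- have ml : m \in l = false by apply/negP => /(allP al) /=; lia.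
  rewrite orFb ml; exists [::], (a :: l); rewrite /= am expr0 mul1r; split=> //.
  by apply/allP => b /(allP al) /=; lia.
Qed.

Definition strict k l := sorted gtn l && all (fun m => 0 < m <= k)%N l.

Lemma strict_rho k : strict k (rho k).
Proof.
apply/andP; split; last by apply/allP => m; rewrite mem_rho.
elim: k => //= k IH; rewrite path_sortedE; last exact: gtn_trans.
by rewrite IH andbT; apply/allP => m; rewrite mem_rho /=; lia.
Qed.

Lemma strict_eq k l t : strict k l -> strict k t -> l =i t -> l = t.
Proof.
move=> /andP[sl _] /andP[st _]; apply: (@irr_sorted_eq _ gtn) => //.
  exact: gtn_trans.
by move=> x /=; rewrite ltnn.
Qed.

(* In strict lists of parts at most k + 1, only the part k + 1 can be removed by
   D_(k+1), and it comes first. *)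
Lemma delsum_top k l : strict k.+1 l -> delsum (es k.+1 k.+1) q l =
  if l is a :: t then if a == k.+1 then q t else 0 else 0.
Proof.
case: l => //= a l /andP[/= sl /andP[ak _]].
have al : all (gtn a) l by apply: order_path_min sl; exact: gtn_trans.
rewrite (@eq_delsumc _ _ (fun b => 0 * es 0 0 b)) => [|b /(allP al) ba]; last first.
  by rewrite mul0r /es ifF //; move: ba => /=; lia.
rewrite delsumcZ mul0r subr0 /es; case: eqP => [->|ne]; first by rewrite leqnn subnn ee0 mul1r.
by rewrite ifF ?mul0r //; lia.
Qed.

Lemma strict_behead k a l : strict k (a :: l) -> strict a.-1 l.
Proof.
move=> /andP[/= sl /andP[ak la]].
have al : all (gtn a) l by apply: order_path_min sl; exact: gtn_trans.
rewrite /strict (path_sorted sl) /=; apply/allP => b bl.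
have := allP al b bl; have := allP la b bl => /=; lia.
Qed.

Lemma ddw_rho k l : (k <= n)%N -> strict k l ->
  ddw (zw (rho k)) (q l) = (l == rho k)%:R.
Proof.
elim: k l => [|k IH] l kn sl /=.
  case: l sl => [|a l] /andP[_ /=]; first by rewrite qpf_nil.
  by case: a.
rewrite ddw_cat ddw_aw ?delsum_top //; case: l sl => [|a l] sl; first by rewrite raddf0.
rewrite eqseq_cons; case: eqP => [ak|_]; last by rewrite raddf0.
by rewrite IH 1?ltnW //; have := strict_behead sl; rewrite ak.
Qed.

Lemma strict_le k l : strict k l -> all (leq^~ k) l.
Proof. by case/andP=> _; apply: sub_all => m /andP[]. Qed.

Lemma strict_uniq k l : strict k l -> uniq l.
Proof.
case/andP=> sl _; apply: (@sorted_uniq _ gtn) => //; first exact: gtn_trans.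
by move=> m /=; rewrite ltnn.
Qed.

Lemma strict_subseq k l t : subseq t l -> strict k l -> strict k t.
Proof.
move=> tl /andP[sl al]; rewrite /strict (subseq_sorted gtn_trans tl sl) /=.
by apply/allP => m /(mem_subseq tl) /(allP al).
Qed.

Definition complementary l (t : seq nat) := all (fun m => (m \in t) != (m \in l)) (rho n).

(** Move the largest part m of [m :: l] to the other factor and sort it in: the
    sign (-1)^(n+m) of the adjunction is that of passing all parts above m. *)
Theorem dV_qpf l t : strict n l -> strict n t ->
  dV (q l * q t) = (complementary l t)%:R.
Proof.
elim: l t => [|m l IH] t sl st.
  rewrite qpf_nil mul1r /dV ddw_rho //; congr (nat_of_bool _)%:R.
  apply/eqP/allP => [-> m -> //|h]; apply: (strict_eq st (strict_rho n)) => m.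
  apply/idP/idP => [mt|/h]; last by rewrite in_nil; case: (m \in t).
  by rewrite mem_rho; case/andP: st => _ /allP/(_ m mt).
have sl' : strict m.-1 l := strict_behead sl.
have m_in : (0 < m <= n)%N by case/andP: sl => _ /andP[].
have lm k : k \in l -> (k < m)%N by case/andP: sl' => _ /allP h /h /=; lia.
have sln : strict n l.
  by apply: strict_subseq sl; apply: subseq_cons.
have [m0 mn] : (0 < m)%N /\ (m <= n)%N by apply/andP.
rewrite -chi_qpf ?strict_le // chi_adj ?chi_qpf ?strict_le //; try exact: sym_qpf.
pose Phi f := dV (q l * f).
have PhiB : zmod_morphism Phi by move=> f g; rewrite /Phi mulrBr raddfB.
pose PhiA : {additive A -> A} := HB.pack Phi (GRing.isZmodMorphism.Build A A Phi PhiB).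
have PhiZ f g : winv g -> PhiA (g * f) = g * PhiA f.
  by move=> wg; rewrite /= /Phi mulrCA dV_winv.
have dell a : a \in t -> (m <= a)%N -> PhiA (q ([::] ++ rem a t)) = 0.
  move=> ta ma; rewrite /= /Phi IH ?(strict_subseq (rem_subseq a t)) //.
  suff -> : complementary l (rem a t) = false by [].
  apply/negP => /allP/(_ a); rewrite mem_rho mem_rem_uniq ?(strict_uniq st) // inE eqxx /=.
  have -> : a \in l = false by apply/negP => /lm; lia.
  by case/andP: st => _ /allP/(_ a ta) /= -> /(_ isT).
have st' : sorted gtn t by case/andP: st.
have := insert_part PhiZ mn (isT : all (leq^~ n) [::]) (strict_le st) st' dell.
rewrite -/(Phi _) /=; case: ifP => mt.
  move=> ->; rewrite mulr0; suff -> : complementary (m :: l) t = false by [].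
  by apply/negP => /allP/(_ m); rewrite mem_rho m_in mt mem_head => /(_ isT).
move=> [t1 [t2 [et h1 h2 ->]]].
have mem2 k : k \in t1 ++ m :: t2 = (k == m) || (k \in t).
  by rewrite et !mem_cat in_cons; do ![case: (_ \in _) | case: (_ == _)].
have st2 : strict n (t1 ++ m :: t2).
  have gt12 a : a \in t1 -> all (gtn a) t2.
    move=> /(allP h1) /= ma; apply/allP => b /(allP h2) /= bm.
    by apply: ltn_trans bm ma.
  apply/andP; split; last first.
    apply/allP => k; rewrite mem2 => /orP[/eqP -> //|kt].
    by case/andP: st => _ /allP; apply.
  rewrite (sorted_pairwise gtn_trans) pairwise_cat /=.
  have := st'; rewrite et (sorted_pairwise gtn_trans) pairwise_cat => /and3P[_ -> ->].
  rewrite andbT; apply/andP; split; last by apply: sub_all h2 => b.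
  apply/allrelP => a b a1; rewrite in_cons => /orP[/eqP->|b2]; first exact: (allP h1).
  exact: allP (gt12 a a1) b b2.
rewrite /Phi IH //.
have -> : complementary l (t1 ++ m :: t2) = complementary (m :: l) t.
  apply: eq_in_all => k _; rewrite mem2 in_cons.
  case: (eqVneq k m) => [->|] //=; rewrite mt.
  by have -> : m \in l = false by apply/negP => /lm; rewrite ltnn.
case: (boolP (complementary _ _)) => [cl|]; last by rewrite !mulr0.
have -> : size t1 = (n - m)%N.
  rewrite -[RHS](size_iota m.+1); apply: perm_size.
  apply: uniq_perm; rewrite ?iota_uniq //.
    by have := strict_uniq st; rewrite et cat_uniq => /and3P[].
  move=> k; rewrite mem_iota; apply/idP/idP => [k1|].
    have /andP[_ /allP/(_ k)] := st; rewrite et mem_cat k1 => /(_ isT) /andP[_ kn].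
    by rewrite addSn subnKC // ltnS kn andbT; apply: (allP h1).
  rewrite addSn subnKC // ltnS => /andP[mk kn]; have krho : k \in rho n by rewrite mem_rho (leq_trans _ mk).
  have := allP cl k krho; rewrite in_cons (gtn_eqF mk) orFb.
  have -> : k \in l = false by apply/negP => /lm; rewrite ltnNge (ltnW mk).
  case: (boolP (k \in t)) => // kt _; move: kt.
  rewrite et mem_cat => /orP[//|/(allP h2) /=]; by rewrite ltnNge (ltnW mk).
rewrite mulr1 -exprD; have -> : (n + m + (n - m) = n.*2)%N by lia.
by rewrite -muln2 mulnC exprM sqrrN expr1n expr1n.
Qed.

End Orthogonality.

(** * Longest elements and adjoints *)

Section LongestElements.
Variable N : nat.
Local Notation n := N.+1.
Implicit Types (u v w : sperm n) (i j : 'I_n) (t : 'S_n).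
Local Notation w0 := (w_zero n).
Local Notation omega0 := (omega_zero n).
Local Notation cw := (cw N).
Local Notation aw := (aw N).
Local Notation zw := (zw N).
Local Notation ow := (ow N).
Local Notation np := (n_pairs n).

Lemma size_cw m : size (cw m) = m.
Proof. by elim: m => //= m ->. Qed.

Lemma size_aw m : (0 < m)%N -> size (aw m) = m.
Proof. by case: m => // m _; rewrite size_rcons size_cw. Qed.

Lemma size_ow k : size (ow k) = (k * k.-1)./2.
Proof.
rewrite -bin2; elim: k => //= k IH.
by rewrite size_cat size_cw IH binS bin1.
Qed.

Lemma size_ow_n : size (ow n) = np.
Proof. by rewrite size_ow n_pairsE. Qed.

Lemma size_zw l : all (ltn 0) l -> size (zw l) = sumn l.
Proof. by elim: l => //= m l IH /andP[m0 l0]; rewrite size_cat IH // size_aw // addnC. Qed.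

Lemma w_zero_central w : (w * w0 = w0 * w)%g.
Proof. by apply: sperm_eq => i /=; rewrite ?mulg1 ?mul1g // !ffunE perm1 addbC. Qed.

Lemma sembV t : semb t^-1%g = (semb t)^-1%g.
Proof. by apply: (mulgI (semb t)); rewrite -sembM mulVg mulgV. Qed.

Lemma semb_inj : injective (@semb n).
Proof. by move=> t t' /(congr1 (@sabs n)). Qed.

Lemma omega_zeroE : omega0 = semb (perm (@rev_ord_inj n)). Proof. by []. Qed.

Lemma omega_zeroK : (omega0 * omega0 = 1)%g.
Proof.
apply: sperm_entryP => i; rewrite -[omega0]mul1g -mulgA mul1g mulgA.
by rewrite !entry_omega_zero rev_ordK.
Qed.

Lemma omega_zeroV : (omega0^-1 = omega0)%g.
Proof. by apply/eqP; rewrite eq_invg_mul omega_zeroK. Qed.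

Lemma w_zeroK : (w0 * w0 = 1)%g.
Proof.
by apply: sperm_entryP => i; rewrite -[w0]mul1g -mulgA mul1g mulgA !entry_w_zero opprK.
Qed.

Lemma invs_omega0 : invs omega0 = np.
Proof. by have := invs_omega_zero (1%g : 'S_n); rewrite semb1 invs1 mul1g. Qed.

Lemma invs_w0 : invs w0 = (np.*2 + n)%N.
Proof. by have := invs_w_zero (1%g : sperm n); rewrite invs1 mul1g. Qed.

Lemma invs_omega0_w0 : invs (omega0 * w0)%g = (np + n)%N.
Proof. by have := invs_w_zero omega0; rewrite invs_omega0 -addnn; lia. Qed.

Lemma w_zeroE : (omega0 * w0 * omega0 = w0)%g.
Proof. by rewrite w_zero_central -mulgA omega_zeroK mulg1. Qed.

Lemma invs_mul_le u v : (invs (u * v)%g <= invs u + invs v)%N.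
Proof.
have [a <- <-] := word_of_length u; have [b <- <-] := word_of_length v.
by rewrite -wprod_cat -size_cat invs_wprod.
Qed.

Lemma descent_w_zero i : descent w0 i.
Proof.
rewrite /descent -[w0]mul1g !entry_w_zero !entry1; case: ifP => // i0.
by rewrite /=; lia.
Qed.

Lemma simple_semb i : i != 0%N :> nat -> simple i = semb (tperm (prev_ord i) i).
Proof. by move=> i0; rewrite /simple (negPf i0). Qed.

(** Descending from a permutation never uses s_0, as its entries are positive. *)
Lemma semb_word t : exists a, [/\ wprod a = semb t, size a = invs (semb t) &
  all (fun i : 'I_n => i != 0%N :> nat) a].
Proof.
move e: (invs (semb t)) => m; elim: m t e => [|m IH] t e.
  by exists [::]; rewrite /wprod big_nil (invs_eq0 e).
have [i d] : {i | descent (semb t) i}.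
  case: (pickP (descent (semb t))) => [i d|nd]; first by exists i.
  by move: e; rewrite (@no_descent _ (semb t)) ?invs1 // => i; rewrite nd.
have i0 : i != 0%N :> nat.
  by move: d; rewrite /descent; case: eqP => // _; rewrite entry_semb.
have e' : (semb t * simple i)%g = semb (tperm (prev_ord i) i * t)%g.
  by rewrite simple_semb // sembM.
have [|a [ea sa za]] := IH (tperm (prev_ord i) i * t)%g.
  by move: e; rewrite (invs_descent d) -e' => -[].
exists (rcons a i); rewrite all_rcons i0 za size_rcons sa; split=> //.
by rewrite wprod_rcons ea -e' -mulgA simpleK mulg1.
Qed.

End LongestElements.

Section Adjoints.
Variables (N : nat) (A : weyl_ring N.+1).
Local Notation n := N.+1.
Implicit Types (f g h : A) (u v w : sperm n) (i j : 'I_n) (t : 'S_n) (a : seq 'I_n).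
Local Notation w0 := (w_zero n).
Local Notation omega0 := (omega_zero n).
Local Notation s i := (wact A (simple i)).
Local Notation np := (n_pairs n).

Definition dS f : A := ddw (ow N n) f.

HB.instance Definition _ := GRing.Additive.copy dS (ddw (ow N n)).

Lemma dSE f : dS f = dd omega0 f.
Proof. by rewrite -wprod_ow ddE // wprod_ow invs_omega0 size_ow_n. Qed.

Lemma sumn_rho : sumn (rho n) = (np + n)%N.
Proof. rewrite n_pairsE; elim: (n) => // k; rewrite -!bin2 binS bin1 /=; lia. Qed.

Lemma dVE f : dV f = dd (omega0 * w0)%g f.
Proof.
rewrite -wprod_zw_rho ddE // wprod_zw_rho invs_omega0_w0 size_zw ?sumn_rho //.
by apply/allP => m; rewrite mem_rho => /andP[].
Qed.

(** From w_0 = (omega_0 w_0) omega_0, where the lengths add up. *)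
Lemma dd_w0 f : dd w0 f = dV (dS f).
Proof.
rewrite dVE dSE dd_comp w_zeroE // invs_w0 invs_omega0_w0 invs_omega0 -addnn; lia.
Qed.

Lemma invs_simple i : invs (simple i) = 1%N.
Proof.
have : ~~ descent 1%g i by rewrite /descent !entry1; case: ifP => //= i0; lia.
by move=> /invs_ascent; rewrite invs1 mul1g.
Qed.

Lemma dd_simple i f : dd (simple i) f = dif i f.
Proof.
have e : wprod [:: i] = simple i by rewrite /wprod big_seq1.
by have := @ddE n A [:: i] f; rewrite e => -> //=; rewrite invs_simple.
Qed.

Lemma s_dd_w0 i f : s i (dd w0 f) = dd w0 f.
Proof.
apply: fixed_dif; rewrite -dd_simple dd_comp0 // invs_simple.
by have := invs_w_zero (simple i); rewrite invs_w0 invs_simple; lia.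
Qed.

Lemma winv_dd_w0 f : winv (dd w0 f).
Proof. by move=> k _; apply: s_dd_w0. Qed.

Lemma s_dS i f : i != 0%N :> nat -> s i (dS f) = dS f.
Proof.
move=> i0; apply: fixed_dif; rewrite dSE -dd_simple dd_comp0 // invs_simple.
have := invs_omega_zero (tperm (prev_ord i) i).
by rewrite -simple_semb // invs_simple invs_omega0; lia.
Qed.

Lemma sym_dS f : sym (dS f).
Proof. by move=> k kn; apply: s_dS; case/andP: kn => k0 kn; rewrite inordK // -lt0n. Qed.

Lemma dS_sym f g : sym g -> dS (g * f) = g * dS f.
Proof.
have cwS m f' : sym g -> (m <= N)%N -> ddw (cw N m) (g * f') = g * ddw (cw N m) f'.
  by move=> *; apply: ddw_cw_sym.
move=> sg; suff H k f' : (k <= n)%N -> ddw (ow N k) (g * f') = g * ddw (ow N k) f'.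
  exact: H.
elim: k f' => //= k IH f' kn; rewrite !ddw_cat cwS //.
by rewrite IH // ltnW.
Qed.

(** An operator killing the images of all letters of a word turns it into its
    reverse when moving it to the other factor. *)
Lemma ddw_adj (D : {additive A -> A}) a f g :
  (forall i h, i \in a -> D (dif i h) = 0) ->
  D (ddw a f * g) = D (f * ddw (rev a) g).
Proof.
elim: a g => //= i a IH g Da; rewrite rev_cons ddw_rcons.
rewrite -IH => [|j h ja]; last by rewrite Da // in_cons ja orbT.
have := dif_adj i (ddw a f) g; move/(canRL (subrK _)) ->.
by rewrite raddfD /= Da ?mem_head ?add0r.
Qed.

Lemma dd_adj w f g : dd w0 (dd w f * g) = dd w0 (f * dd w^-1%g g).
Proof.
have [a <- la] := word_of_length w.
rewrite ddE // -wprod_rev ddE ?wprod_rev ?invsV ?size_rev //.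
by apply: ddw_adj => i h _; rewrite /= dd_kill // descent_w_zero.
Qed.

Lemma descent_omega_zero i : i != 0%N :> nat -> descent omega0 i.
Proof.
move=> i0; rewrite /descent (negPf i0) !entry_semb !permE /=.
have := ltn_ord i; lia.
Qed.

Lemma dS_dif i f : i != 0%N :> nat -> dS (dif i f) = 0.
Proof. by move=> i0; rewrite dSE dd_kill // descent_omega_zero. Qed.

Lemma dS_fixed i f : i != 0%N :> nat -> s i f = f -> dS f = 0.
Proof.
by move=> i0 sf; rewrite dSE (dd_descent _ (descent_omega_zero i0)) dif_eq0 // raddf0.
Qed.

Lemma dS_s i f : i != 0%N :> nat -> dS (s i f) = - dS f.
Proof.
move=> i0; apply/eqP; rewrite -addr_eq0 -raddfD /= (dS_fixed i0) //.
by rewrite rmorphD /= sK addrC.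
Qed.

Lemma dS_adj t f g : dS (dd (semb t) f * g) = dS (f * dd (semb t^-1) g).
Proof.
have [a [ea la za]] := semb_word t; rewrite sembV -ea ddE ?ea // -ea -wprod_rev.
rewrite ddE ?wprod_rev ?invsV ?size_rev ?ea //.
by apply: ddw_adj => i h /(allP za) /= i0; rewrite dS_dif.
Qed.

Lemma odd_perm_word t a : wprod a = semb t -> all (fun i => i != 0%N :> nat) a ->
  odd_perm t = odd (size a).
Proof.
move=> ea za; have <- : sabs (semb t) = t by [].
rewrite -ea; elim: a za {ea} => [|i a IH] /=; first by rewrite /wprod big_nil odd_perm1.
case/andP=> i0 za; rewrite -cat1s wprod_cat /wprod big_seq1 /= odd_permM.
rewrite -/(wprod a) IH // simple_semb //= odd_tperm addbC.
by have -> : prev_ord i != i by rewrite -val_eqE /=; lia.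
Qed.

Lemma odd_permE t : odd_perm t = odd (invs (semb t)).
Proof. by have [a [ea <- za]] := semb_word t; apply: odd_perm_word. Qed.

(* Applied to a transposition that fixes f, this gives dS f = 0. *)
Lemma dS_semb t f : dS (wact A (semb t) f) = (-1) ^+ odd_perm t * dS f.
Proof.
have [a [ea _ za]] := semb_word t; rewrite (odd_perm_word ea za).
rewrite -ea signr_odd; elim: a za {ea} => [|i a IH] /=.
  by rewrite /wprod big_nil wact1 mul1r.
case/andP=> i0 za; rewrite -cat1s wprod_cat {1}/wprod big_seq1 wactM.
by rewrite dS_s // IH // exprS mulN1r mulNr.
Qed.

End Adjoints.

(** * Staircase monomials *)

Section Staircase.
Variables (N : nat) (A : weyl_ring N.+1).
Local Notation n := N.+1.
Implicit Types (f g h u : A) (i j : 'I_n) (t : 'S_n) (c : 'I_n -> nat) (k m p D : nat).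
Local Notation x k := (var A (inord k : 'I_n)).
Local Notation s k := (wact A (simple (inord k : 'I_n))).
Local Notation d k := (@dif n A (inord k)).
Local Notation ee := (ee A).
Local Notation es := (es A).
Local Notation q := (qpf (ee 0)).
Local Notation np := (n_pairs n).

Definition mono c : A := \prod_i var A i ^+ c i.

Lemma eq_mono c c' : c =1 c' -> mono c = mono c'.
Proof. by move=> cc; apply: eq_bigr => i _; rewrite cc. Qed.

Lemma monoM c c' : mono c * mono c' = mono (fun i => c i + c' i)%N.
Proof. by rewrite -big_split; apply: eq_bigr => i _; rewrite exprD. Qed.

Lemma mono_eq1 c : (forall i, c i = 0%N) -> mono c = 1.
Proof. by move=> c0; rewrite /mono big1 // => i _; rewrite c0. Qed.

Lemma var_mono j : var A j = mono (fun i => i == j).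
Proof.
rewrite /mono (bigD1 j) //= eqxx expr1 big1 ?mulr1 // => i /negPf ->.
by rewrite expr0.
Qed.

Lemma wact_semb_mono t c : wact A (semb t) (mono c) = mono (c \o (t^-1)%g).
Proof.
rewrite /mono rmorph_prod [RHS](reindex_inj (@perm_inj _ t)) /=; apply: eq_bigr => i _.
by rewrite rmorphXn /= wact_var /= ffunE mul1r permK.
Qed.

Lemma s_mono_fix i c : i != 0%N :> nat -> c i = c (prev_ord i) ->
  wact A (simple i) (mono c) = mono c.
Proof.
move=> i0 ci; rewrite simple_semb // wact_semb_mono; apply: eq_mono => j /=.
by rewrite tpermV; case: tpermP => // ->.
Qed.

(** The staircase monomial x^delta in the first k variables. *)
Definition xdel k : A := mono (fun i => k.-1 - i)%N.

(* Interpolates between [xdel k.+1] and [xdel k]. *)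
Let stg k m : A := mono (fun i => k - i - (i < m)%N)%N.

Let stg0 k : stg k 0 = xdel k.+1.
Proof. by apply: eq_mono => i; rewrite subn0. Qed.

Let stgk k : stg k k = xdel k.
Proof. by apply: eq_mono => i; case: k => [|k] /=; lia. Qed.

Let stgS k m : (m < k <= N)%N -> stg k m = stg k m.+1 * x m.
Proof.
move=> mk; rewrite var_mono monoM; apply: eq_mono => i.
by rewrite -val_eqE /= inordK; lia.
Qed.

Lemma ddw_cw_stair k m p : (m <= k <= N)%N ->
  ddw (cw N m) (xdel k.+1 * ee 1 p) = (-1) ^+ m * stg k m * ee m.+1 p.
Proof.
elim: m => [|m IH] mk /=; first by rewrite stg0 expr0 mul1r.
rewrite IH; last lia.
have mN : (m.+1 < n)%N by lia.
have sst : s m.+1 (stg k m.+1) = stg k m.+1.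
  apply: s_mono_fix; first by rewrite inordK.
  by rewrite /= inordK //=; lia.
have E : x m * ee m.+1 p = ee m p.+1 - ee m.+1 p.+1.
  by rewrite [ee m _]eeS ?(ltnW mN) // /es subn1 /=; ring.
rewrite stgS; last lia.
rewrite -mulrA -[stg k m.+1 * _ * _]mulrA E.
have sg h : d m.+1 ((-1) ^+ m * h) = (-1) ^+ m * d m.+1 h.
  by rewrite -[(-1) ^+ m]signr_odd !mulr_sign (fun_if (d m.+1)) raddfN.
rewrite sg difMl // raddfB /= d_ee // dif_eq0 ?s_ee //; last lia.
by rewrite sub0r /es subn1 /= exprS; ring.
Qed.

Lemma ddw_cw_xdel k p : (k <= N)%N ->
  ddw (cw N k) (xdel k.+1 * ee 1 p) = (-1) ^+ k * xdel k * ee k.+1 p.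
Proof. by move=> kN; rewrite ddw_cw_stair ?leqnn // stgk. Qed.

Lemma ddw_sign (a : seq 'I_n) k f : ddw a ((-1) ^+ k * f) = (-1) ^+ k * ddw a f.
Proof. by rewrite -[(-1) ^+ k]signr_odd !mulr_sign (fun_if (ddw a)) raddfN. Qed.

Lemma dS_xdel : dS (xdel n) = (-1) ^+ np :> A.
Proof.
rewrite -(size_ow_n N) /dS; suff H k : (k <= n)%N ->
    ddw (ow N k) (xdel k) = (-1) ^+ size (ow N k) :> A by apply: H.
elim: k => [|k IH] kn /=; first by rewrite /xdel mono_eq1.
have {1}-> : xdel k.+1 = xdel k.+1 * ee 1 0 by rewrite ee0 mulr1.
rewrite ddw_cat ddw_cw_xdel //.
by rewrite ee0 mulr1 ddw_sign IH 1?ltnW // size_cat size_cw exprD mulrC.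
Qed.

Lemma s0_mono c : s 0 (mono c) = (-1) ^+ c (inord 0) * mono c.
Proof.
rewrite /mono rmorph_prod (bigD1 (inord 0)) //= [in RHS](bigD1 (inord 0)) //=.
rewrite rmorphXn /= s_x0 //= [(- var A _) ^+ _]exprNn -mulrA; congr (_ * (_ * _)); apply: eq_bigr => i i0.
rewrite rmorphXn /= s_var0 ?inordK // ifF //; exact: negPf.
Qed.

Lemma d0_xdel k : (0 < k < n)%N -> d 1 (d 0 (xdel k.+1)) = 0.
Proof.
move=> /andP[k0 kn]; case: (boolP (odd k)) => ok; last first.
  rewrite (dif_eq0 (f := xdel _)) ?raddf0 // s0_mono inordK // subn0 /=.
  by rewrite -signr_odd (negPf ok) mul1r.
rewrite -stg0 stgS; last lia.
have s1 : s 1 (stg k 1) = stg k 1.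
  have n1 : (1 < n)%N by lia.
  by apply: s_mono_fix; rewrite /= inordK //=; lia.
have s0 : s 0 (stg k 1) = stg k 1.
  rewrite s0_mono inordK // -signr_odd; have -> : odd (k - 0 - (0 < 1)%N) = false.
    by rewrite subn0 subn1; case: (k) k0 ok => //= ? _ /negPf.
  by rewrite mul1r.
by rewrite difMl // d_x // mulr1 dif_eq0.
Qed.

Lemma s0_xdel k : s 0 (xdel k.+1) = (-1) ^+ k * xdel k.+1.
Proof. by rewrite s0_mono inordK // subn0. Qed.

(** On staircases D_k extracts parts with coefficients in x_k, ..., x_N. *)
Lemma ddw_aw_xdel k l : (0 < k <= n)%N ->
  ddw (aw N k) (xdel k * q l) = xdel k.-1 * delsum (es k 1) q l.
Proof.
case: k => // k kn; rewrite /aw ddw_rcons /=.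
rewrite difM d0_qpf raddfD /=.
have -> : ddw (cw N k) (d 0 (xdel k.+1) * q l) = 0.
  rewrite mulrC ddw_cw_sym //; last exact: sym_qpf.
  have [k0|k0] := posnP k.
    by rewrite k0 /xdel mono_eq1 // (dif_eq0 (f := 1)) ?rmorph1 // mulr0.
  have H m : (0 < m)%N -> ddw (cw N m) (d 0 (xdel k.+1)) = 0.
    elim: m => // m IH _ /=; have [m0|m0] := posnP m; last by rewrite IH ?raddf0.
    by rewrite m0 /= d0_xdel // k0.
  by rewrite H // mulr0.
rewrite add0r s0_xdel; suff H (F : seq nat -> A) : (forall r, sym (F r)) ->
    ddw (cw N k) ((-1) ^+ k * xdel k.+1 * delsum (es 1 1) F l) =
    xdel k * delsum (es k.+1 1) F l by apply: H => r; apply: sym_qpf.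
elim: l F => [|a l IH] F sF /=; first by rewrite !mulr0 raddf0.
rewrite mulrBr raddfB /= IH // mulrBr; congr (_ - _).
rewrite mulrA [_ * F l]mulrC ddw_cw_sym // -mulrA ddw_sign {1}/es; case: ifP => a0.
  rewrite ddw_cw_xdel //; have sq : (-1) ^+ k * (-1) ^+ k = 1 :> A.
    by rewrite -exprMn mulrNN mulr1 expr1n.
  transitivity (((-1) ^+ k * (-1) ^+ k) * (xdel k * (ee k.+1 (a - 1) * F l))); first by ring.
  by rewrite sq mul1r /es a0.
by rewrite mulr0 raddf0 /es a0 mul0r !mulr0.
Qed.

Lemma ee_top k : (k <= n)%N -> ee k (n - k) = \prod_(k <= i < n) x i.
Proof.
move: k; apply: (@egen_ind N) => k.
  by move=> nk kn; rewrite big_geq // (_ : n - k = 0)%N ?ee0 //; lia.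
move=> kn IH _; rewrite big_ltn // -IH // eeS // ee_oversize ?add0r; last lia.
by rewrite /es ifT; [congr (_ * ee _ _); lia | lia].
Qed.

Lemma delsum_last ca F l p : {in l, forall b, ca b = 0} ->
  delsum ca F (rcons l p) = (-1) ^+ size l * ca p * F l :> A.
Proof.
elim: l F => [|a l IH] F c0 /=; first by rewrite subr0 mul1r.
rewrite c0 ?mem_head // mul0r IH => [|b lb]; last by rewrite c0 // in_cons lb orbT.
by rewrite exprS; ring.
Qed.

Lemma size_rho k : size (rho k) = k.
Proof. by elim: k => //= k ->. Qed.

Lemma nth_rho k p : (p < k)%N -> nth 0%N (rho k) p = (k - p)%N.
Proof. by elim: k p => // k IH [|p] //= pk; rewrite IH. Qed.

Definition ymono : A := mono (fun i => i).

(** Applying D_n, D_(n-1), ..., D_1 extracts the parts 1, 2, ..., n in turn, with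
    coefficients 1, x_N, x_(N-1) x_N, and so on. *)
Lemma dV_top : dV (xdel n * q (rho n)) = (-1) ^+ np * ymono.
Proof.
pose Y k : A := \prod_(1 <= m < k.+1) \prod_(m <= i < n) x i.
have main k g : (k <= n)%N -> (forall p, (p < k)%N -> s p g = g) ->
    ddw (zw N (rho k)) (xdel k * (g * q (take k (rho n)))) =
    (-1) ^+ size (ow N k) * (Y k * g).
  elim: k g => [|k IH] g kn sg.
    by rewrite take0 qpf_nil /= /xdel mono_eq1 // /Y big_geq // !mul1r mulr1.
  have ksz : (k < size (rho n))%N by rewrite size_rho.
  rewrite (take_nth 0%N ksz) nth_rho //; set l := take k _.
  rewrite [zw N _]/(zw N (rho k) ++ aw N k.+1) ddw_cat.
  have -> : xdel k.+1 * (g * q (rcons l (n - k)%N)) = g * (xdel k.+1 * q (rcons l (n - k)%N)) by ring.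
  have sga f : ddw (aw N k.+1) (g * f) = g * ddw (aw N k.+1) f.
    have : all (fun i : 'I_n => i < k.+1)%N (aw N k.+1).
      rewrite /aw all_rcons inordK //=; elim: (k) kn => //= m IHm mn.
      by rewrite inordK // ltnSn; apply: sub_all (IHm (ltnW mn)) => i /=; lia.
    elim: (aw _ _) => //= i a IHa /andP[ik ak]; rewrite IHa // difMl //.
    by have := sg i ik; rewrite inord_val.
  have szl : size l = k by rewrite /l size_takel // ltnW.
  rewrite sga ddw_aw_xdel //= delsum_last; last first.
    move=> b /(nthP 0%N)[p]; rewrite szl => pk <-.
    rewrite /l nth_take // nth_rho ?(ltn_trans pk) // /es ifT; last by lia.
    by apply: ee_oversize; lia.
  have el : es k.+1 1 (n - k) = \prod_(k.+1 <= i < n) x i.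
    by rewrite /es ifT; [rewrite -ee_top //; congr ee; lia | lia].
  rewrite el szl.
  have -> : g * (xdel k * ((-1) ^+ k * \prod_(k.+1 <= i < n) x i * q l)) =
     (-1) ^+ k * (xdel k * ((g * \prod_(k.+1 <= i < n) x i) * q l)) by ring.
  rewrite ddw_sign IH 1?ltnW //; last first.
    move=> j jk; rewrite rmorphM /= sg 1?ltnW // rmorph_prod; congr (_ * _).
    by apply: eq_big_nat => i /andP[ki iN]; rewrite s_x_fix //; lia.
  rewrite size_cat size_cw exprD /Y [in RHS]big_nat_recr //=; ring.
have -> : dV (xdel n * q (rho n)) = ddw (zw N (rho n)) (xdel n * (1 * q (take n (rho n)))).
  by rewrite mul1r take_oversize // size_rho.
rewrite main // => [|j _]; last by rewrite rmorph1.
rewrite size_ow_n mulr1; congr (_ * _); rewrite /Y /ymono /mono.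
under eq_bigr => m _ do rewrite (big_nat_widenl _ 0) //.
rewrite (exchange_big_dep_nat xpredT) //= big_mkord; apply: eq_bigr => i _.
rewrite inord_val (eq_bigl (fun m => xpredT m && (m < i.+1)%N)) => [|m]; last by rewrite ltnS.
rewrite -(big_nat_widen 1 i.+1 n.+1 xpredT) ?ltnS ?(ltnW (ltn_ord i)) //.
by rewrite prodr_const_nat subn1.
Qed.

(** * Spans of monomials *)

Inductive aspan (P : A -> Prop) : A -> Prop :=
| aspan_gen u : P u -> aspan P u
| aspan0 : aspan P 0
| aspanB f g : aspan P f -> aspan P g -> aspan P (f - g).

Lemma aspanN P f : aspan P f -> aspan P (- f).
Proof. by rewrite -sub0r; apply: aspanB; apply: aspan0. Qed.

Lemma aspanD P f g : aspan P f -> aspan P g -> aspan P (f + g).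
Proof. by move=> Pf Pg; rewrite -[g]opprK; apply: aspanB => //; apply: aspanN. Qed.

Lemma aspan_sum P (I : Type) (r : seq I) (F : I -> A) :
  (forall z, aspan P (F z)) -> aspan P (\sum_(z <- r) F z).
Proof. by move=> PF; apply: big_ind => //; [apply: aspan0 | apply: aspanD]. Qed.

Lemma aspan_map P Q (phi : {additive A -> A}) f :
  (forall u, P u -> aspan Q (phi u)) -> aspan P f -> aspan Q (phi f).
Proof.
move=> PQ; elim=> [u /PQ //||g h _ IHg _ IHh]; first by rewrite raddf0; apply: aspan0.
by rewrite raddfB; apply: aspanB.
Qed.

Lemma aspan_sub P Q f : (forall u, P u -> Q u) -> aspan P f -> aspan Q f.
Proof. by move=> PQ; apply: (@aspan_map P Q idfun) => u /PQ; apply: aspan_gen. Qed.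

(** The staircase condition is the case where [cap] is the identity: the monomials
    x^c with c_i <= i. *)
Definition Mon (cap : nat -> nat) D u :=
  exists c, [/\ forall i, (c i <= cap i)%N, (\sum_i c i)%N = D & u = mono c].

Lemma aspan_mul cap cap' cap'' D D' f g :
  (forall k, (cap k + cap' k <= cap'' k)%N) ->
  aspan (Mon cap D) f -> aspan (Mon cap' D') g -> aspan (Mon cap'' (D + D')) (f * g).
Proof.
move=> capD; elim=> [u [c [lc <- ->]]||f1 f2 _ IH1 _ IH2] sg.
- elim: sg => [v [c' [lc' <- ->]]||g1 g2 _ IH1 _ IH2].
  + apply: aspan_gen; exists (fun i => c i + c' i)%N; split; rewrite ?monoM ?big_split //.
    by move=> i; apply: leq_trans (capD i); apply: leq_add.
  + by rewrite mulr0; apply: aspan0.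
  + by rewrite mulrBr; apply: aspanB.
- by rewrite mul0r; apply: aspan0.
- by rewrite mulrBl; apply: aspanB; [apply: IH1 | apply: IH2].
Qed.

Lemma aspan_mono c D : (\sum_i c i)%N = D ->
  forall cap : nat -> nat, (forall i, (c i <= cap i)%N) -> aspan (Mon cap D) (mono c).
Proof. by move=> sc cap lc; apply: aspan_gen; exists c. Qed.

Lemma aspan_const cap f : aspan (Mon cap 0) f -> exists z : int, f = z%:~R.
Proof.
elim=> [u [c [_ c0 ->]]||g h _ [z ->] _ [z' ->]]; last 2 first.
- by exists 0.
- by exists (z - z'); rewrite rmorphB.
exists 1; rewrite mono_eq1 // => i; apply/eqP; move/eqP: c0.
by rewrite sum_nat_eq0 => /forallP/(_ i)/implyP; apply.
Qed.

Lemma sum_indicator i : (\sum_(k < n) (k == i : nat))%N = 1%N.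
Proof. by rewrite (bigD1 i) //= eqxx big1 // => k /negPf ->. Qed.

Lemma aspan_ee k p : (k <= n)%N -> aspan (Mon (fun z : nat => (k <= z)%N) p) (ee k p).
Proof.
move=> kn; move: k kn p; apply: (@egen_ind N) => k.
  move=> nk kn [|p]; last by rewrite ee_oversize; [apply: aspan0 | lia].
  by rewrite ee0 -(@mono_eq1 (fun=> 0%N)) //; apply: aspan_mono; rewrite ?big1.
move=> kn IH _ p; rewrite eeS //; apply: aspanD.
  apply: aspan_sub (IH kn p) => u [c [lc sc eu]]; exists c; split=> // i.
  by apply: leq_trans (lc i) _; case: (ltnP k i) => // /ltnW ->.
rewrite /es; case: p => [|p] /=; first by rewrite mulr0; apply: aspan0.
rewrite -add1n subn1 /=.
apply: (@aspan_mul (fun z : nat => z == k) (fun z : nat => (k < z)%N)) => [z||]; last exact: IH.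
  by case: ltngtP.
rewrite var_mono; apply: aspan_mono; first exact: sum_indicator.
by move=> i; rewrite -val_eqE /= inordK.
Qed.

Local Notation stair := (Mon id).

(** Two equal exponents kill a monomial; in the staircase x^delta x^c with
    c_i <= i and c <> 0, the first nonzero c_i creates a repetition. *)
Lemma dS_stair D f : aspan (stair D.+1) f -> dS (xdel n * f) = 0.
Proof.
elim=> [u [c [lc sc ->]]||g h _ IHg _ IHh]; last 2 first.
- by rewrite mulr0 raddf0.
- by rewrite mulrBr raddfB /= IHg IHh subrr.
have [i0 ci0] : exists i, (0 < c i)%N.
  apply/existsP; apply: contra_eqT sc => /existsPn c0.
  by rewrite big1 // => i _; apply/eqP; rewrite -leqn0 leqNgt c0.
have [i ci mini] := @arg_minnP _ i0 (fun i => (0 < c i)%N) (fun i => i : nat) ci0.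
have jn : (i - c i < n)%N by have := ltn_ord i; lia.
pose j : 'I_n := Ordinal jn.
have ji : (j < i)%N by have := lc i; rewrite /=; lia.
have cj : c j = 0%N.
  by apply/eqP; rewrite -leqn0 leqNgt; apply/negP => /mini; rewrite leqNgt ji.
pose e (z : 'I_n) := ((N - z) + c z)%N.
have -> : xdel n * mono c = mono e by rewrite monoM.
have eij : e i = e j by rewrite /e cj /=; have := lc i; have := ltn_ord i; rewrite /=; lia.
have te : wact A (semb (tperm i j)) (mono e) = mono e.
  rewrite wact_semb_mono; apply: eq_mono => z /=.
  by rewrite tpermV; case: tpermP => // ->.
have := dS_semb (tperm i j) (mono e); rewrite te odd_tperm.
have -> : i != j by rewrite -val_eqE /= gtn_eqF.
rewrite expr1 mulN1r => /eqP; rewrite -addr_eq0 -mulr2n -mulr_natl.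
by rewrite mulf_eq0 (negPf (two_neq0 A)) => /eqP.
Qed.

(** On x_p^a x_i^b, with p = i - 1, the divided difference gives monomials whose two
    exponents are below the larger of a and b, so the bounds c_p <= p and c_i <= i
    persist. *)
Lemma dif_pow2 (y z : A) (i : 'I_n) a b :
  i != 0%N :> nat -> y = var A (prev_ord i) -> z = var A i ->
  aspan (fun u => exists a' b', [/\ (a' + b').+1 = (a + b)%N,
     (a' < maxn a b)%N, (b' < maxn a b)%N & u = y ^+ a' * z ^+ b'])
   (dif i (y ^+ a * z ^+ b)).
Proof.
move=> i0 ey ez.
have sy : wact A (simple i) y = z by rewrite ey ez s_var // tpermL.
have sz : wact A (simple i) z = y by rewrite ey ez s_var // tpermR.
have rt : sroot A i = z - y by rewrite /sroot (negPf i0) ey ez.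
have dif_sym (c : nat) f : dif i ((y * z) ^+ c * f) = (y * z) ^+ c * dif i f.
  by rewrite difMl // rmorphXn rmorphM /= sy sz mulrC.
have dy m : dif i (y ^+ m) = - \sum_(k < m) y ^+ (m.-1 - k) * z ^+ k.
  by apply: dif_uniq; rewrite rmorphXn /= sy subrXX rt; ring.
have dz m : dif i (z ^+ m) = \sum_(k < m) y ^+ (m.-1 - k) * z ^+ k.
  apply: dif_uniq; rewrite rmorphXn /= sz rt -[RHS]opprB subrXX; ring.
have [ab|/ltnW ba] := leqP a b.
  have -> : y ^+ a * z ^+ b = (y * z) ^+ a * z ^+ (b - a).
    by rewrite exprMn -mulrA -exprD subnKC.
  rewrite dif_sym dz big_distrr; apply: aspan_sum => k; apply: aspan_gen.
  exists (a + ((b - a).-1 - k))%N, (a + k)%N; have := ltn_ord k.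
  by split; [lia|lia|lia|rewrite [LHS]/=  exprMn mulrACA -!exprD].
have -> : y ^+ a * z ^+ b = (y * z) ^+ b * y ^+ (a - b).
  by rewrite exprMn mulrAC -exprD subnKC // .
rewrite dif_sym dy mulrN big_distrr; apply: aspanN; apply: aspan_sum => k; apply: aspan_gen.
exists (b + ((a - b).-1 - k))%N, (b + k)%N; have := ltn_ord k.
by split; [lia|lia|lia|rewrite [LHS]/=  exprMn mulrACA -!exprD].
Qed.

Lemma mono_split2 i j c : i != j ->
  mono c = \prod_(z | (z != i) && (z != j)) var A z ^+ c z * (var A i ^+ c i * var A j ^+ c j).
Proof.
move=> ij; rewrite /mono (bigD1 i) //= (bigD1 j) 1?eq_sym //= mulrA mulrC.
by congr (_ * _); apply: eq_bigl => z; rewrite andbC.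
Qed.

Lemma sum_split2 i j c : i != j ->
  (\sum_z c z = \sum_(z | (z != i) && (z != j)) c z + (c i + c j))%N.
Proof.
move=> ij; rewrite (bigD1 i) //= (bigD1 j) 1?eq_sym //= addnA addnC.
by congr (_ + _)%N; apply: eq_bigl => z; rewrite andbC.
Qed.

Lemma dif_stair D i f : i != 0%N :> nat -> aspan (stair D.+1) f -> aspan (stair D) (dif i f).
Proof.
move=> i0; apply: aspan_map => u [c [lc sc ->]] /=; set p := prev_ord i.
have pi : p != i by rewrite -val_eqE /=; lia.
rewrite (mono_split2 c pi) difMl; last first.
  rewrite rmorph_prod; apply: eq_bigr => z /andP[zp zi].
  by rewrite rmorphXn /= s_var // tpermD // eq_sym.
set r := \prod_(_ | _) _.
have := dif_pow2 (c p) (c i) i0 erefl erefl.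
elim=> [v [a [b [ab la lb ->]]]||g h _ IHg _ IHh]; last 2 first.
- by rewrite mulr0; apply: aspan0.
- by rewrite mulrBr; apply: aspanB.
pose c' (z : 'I_n) := if z == p then a else if z == i then b else c z.
have c'p : c' p = a by rewrite /c' eqxx.
have c'i : c' i = b by rewrite /c' eqxx eq_sym (negPf pi).
have c'o (z : 'I_n) : (z != p) && (z != i) -> c' z = c z by rewrite /c' => /andP[/negPf-> /negPf->].
apply: aspan_gen; exists c'; split.
- move=> z; rewrite /c'; case: eqP => [->|_]; last case: eqP => [->|_].
  + by have := lc p; have := lc i; rewrite /= in la *; lia.
  + by have := lc p; have := lc i; rewrite /= in lb *; lia.
  + exact: lc.
- move: sc; rewrite !(sum_split2 _ pi) c'p c'i.
  have -> : (\sum_(z | (z != p) && (z != i)) c' z = \sum_(z | (z != p) && (z != i)) c z)%N.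
    by apply: eq_bigr => z /c'o.
  by set S := (\sum_(_ | _) _)%N; move: ab; clearbody S; lia.
- rewrite (mono_split2 _ pi) c'p c'i; congr (_ * _).
  by apply: eq_bigr => z /c'o ->.
Qed.

End Staircase.

(** * Orthogonality of Schubert polynomials *)

Section Schubert.
Variables (N : nat) (A : weyl_ring N.+1).
Local Notation n := N.+1.
Implicit Types (f g h : A) (w : sperm n) (u v t : 'S_n) (i : 'I_n) (l ms : seq nat) (k m p D : nat).
Local Notation ee := (ee A).
Local Notation es := (es A).
Local Notation q := (qpf (ee 0)).
Local Notation np := (n_pairs n).
Local Notation w0 := (w_zero n).
Local Notation omega0 := (omega_zero n).
Local Notation zw := (zw N).
Local Notation ymono := (ymono A).
Local Notation xdelta := (xdel A n).
Local Notation sg := ((-1) ^+ np : A).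
Local Notation stair := (Mon id).

Lemma sgK : sg * sg = 1.
Proof. by rewrite -exprMn mulrNN mulr1 expr1n. Qed.

Lemma dd_sign w k f : dd w ((-1) ^+ k * f) = (-1) ^+ k * dd w f.
Proof. exact: ddw_sign. Qed.

Lemma dV_sign k f : dV ((-1) ^+ k * f) = (-1) ^+ k * dV f.
Proof. exact: ddw_sign. Qed.

Lemma dS_sign k f : dS ((-1) ^+ k * f) = (-1) ^+ k * dS f.
Proof. exact: ddw_sign. Qed.

Lemma sum_ord : (\sum_(i < n) i)%N = np.
Proof. by rewrite n_pairsE -bin2 -bin2_sum big_mkord. Qed.

Lemma ymono_stair : aspan (stair np) ymono.
Proof. by apply: aspan_mono; rewrite ?sum_ord. Qed.

Lemma omega0_mono (c : 'I_n -> nat) :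
  wact A omega0 (mono A c) = mono A (c \o @rev_ord n).
Proof.
rewrite omega_zeroE wact_semb_mono; apply: eq_mono => i /=; congr c.
by apply: (@perm_inj _ (perm (@rev_ord_inj n))); rewrite permKV permE rev_ordK.
Qed.

Lemma dS_ymono : dS ymono = 1.
Proof.
have -> : ymono = wact A omega0 xdelta.
  rewrite omega0_mono; apply: eq_mono => i /=; have := ltn_ord i; lia.
by rewrite omega_zeroE dS_semb odd_permE -omega_zeroE invs_omega0 signr_odd dS_xdel sgK.
Qed.

Lemma dd_stair D t f : aspan (stair D) f -> (invs (semb t) <= D)%N ->
  aspan (stair (D - invs (semb t))) (dd (semb t) f).
Proof.
have [a [ea la za]] := semb_word t.
have -> : dd (semb t) f = ddw a f by rewrite -ea ddE // la ea.
rewrite -la => sf; elim: a D f za sf {ea la} => [|i a IH] D f /=; first by rewrite subn0.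
case/andP=> i0 za sf aD; apply: dif_stair => //.
by have := IH D f za sf (ltnW aD); rewrite subnSK.
Qed.

Lemma invs_omega0M t : invs (omega0 * semb t)%g = (np - invs (semb t))%N.
Proof.
have e : (omega0 * semb t = (semb t^-1 * omega0)^-1)%g.
  by rewrite invMg omega_zeroV sembV invgK.
rewrite e invsV; have := invs_omega_zero t^-1%g; rewrite sembV invsV; lia.
Qed.

Lemma invs_Momega0 t : invs (semb t * omega0)%g = (np - invs (semb t))%N.
Proof. by have := invs_omega_zero t; lia. Qed.

Lemma invs_semb_le t : (invs (semb t) <= np)%N.
Proof. by have := invs_omega_zero t; lia. Qed.

(** Moving d_(v^-1) to the other side gives d_(v u^-1 omega_0) applied to the top
    staircase monomial y. This vanishes when the lengths do not add up; otherwise it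
    has degree l(v u^-1), and x^delta pairs to 0 with staircase monomials of positive
    degree. So only u = v remains. *)
Lemma type_A_orth u v :
  dS (dd ((semb u)^-1 * omega0)%g ymono * dd (semb v)^-1%g xdelta) = sg * (u == v)%:R.
Proof.
rewrite mulrC -sembV dS_adj invgK.
have ew : (semb v * ((semb u)^-1 * omega0) = semb (u^-1 * v) * omega0)%g.
  by rewrite mulgA sembM sembV.
have len : invs (semb v * ((semb u)^-1 * omega0))%g = (np - invs (semb (u^-1 * v)))%N.
  by rewrite ew invs_Momega0.
case: (eqVneq u v) => [uv|uv].
  subst v.
  rewrite dd_comp; last by rewrite len mulVg semb1 invs1 subn0 -sembV invs_Momega0
    sembV invsV subnKC // invs_semb_le.
  by rewrite mulgA mulgV mul1g -dSE dS_ymono mulr1 dS_xdel mulr1.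
rewrite mulr0; case: (eqVneq (invs (semb v * ((semb u)^-1 * omega0))%g)
    (invs (semb v) + invs ((semb u)^-1 * omega0)%g)) => [le|ne]; last first.
  by rewrite dd_comp0 // mulr0 raddf0.
rewrite dd_comp // ew omega_zeroM.
have pos : (0 < invs (semb (u^-1 * v)))%N.
  rewrite lt0n; apply: contra uv => /eqP/invs_eq0.
  rewrite -semb1 => /(@semb_inj N) /eqP; rewrite -eq_invg_mul invgK => /eqP ->.
  by rewrite eqxx.
have := dd_stair ymono_stair (invs_semb_le (perm (@rev_ord_inj n) * (u^-1 * v))).
rewrite -omega_zeroM invs_Momega0 subKn ?invs_semb_le //.
by case: (invs _) pos => // D _; apply: dS_stair.
Qed.

(** After moving the first operator to the other side, the two operators have lengths
    adding up to that of omega_0. So their composite is dS or 0, and it is dS exactly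
    when v = omega_0 u. *)
Lemma type_A_dual u v : (invs (semb u) + invs (semb v) = np)%N ->
  dS (dd ((semb u)^-1 * omega0)%g ymono * dd ((semb v)^-1 * omega0)%g ymono)
  = (semb v == omega0 * semb u)%g%:R.
Proof.
move=> luv; have eu : ((semb u)^-1 * omega0 = semb (perm (@rev_ord_inj n) * u^-1))%g.
  by rewrite -omega_zeroM sembV.
have eu' : (semb (perm (@rev_ord_inj n) * u^-1)^-1 = omega0 * semb u)%g.
  by rewrite sembV -eu invMg invgK omega_zeroV.
rewrite {1}eu dS_adj eu'.
have lens : (invs (omega0 * semb u)%g + invs ((semb v)^-1 * omega0)%g = np)%N.
  rewrite invs_omega0M -sembV invs_Momega0 sembV invsV.
  have := invs_semb_le u; have := invs_semb_le v; lia.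
set w := (omega0 * semb u * ((semb v)^-1 * omega0))%g.
have wE : (w == omega0) = (semb v == omega0 * semb u)%g.
  rewrite /w mulgA; apply/eqP/eqP => [e|->].
    apply/esym/eqP; rewrite eq_mulgV1; apply/eqP/(mulIg omega0).
    by rewrite e mul1g.
  by rewrite mulgV mul1g.
case: (eqVneq (invs w) np) => [lw|ne].
  have w1 : w = omega0.
    have [t et] : exists t, w = semb t.
      by rewrite /w -eu' -sembV omega_zeroM -sembM; eexists.
    have := invs_Momega0 t; rewrite -et lw subnn => /invs_eq0 e1.
    by apply: (mulIg omega0); rewrite e1 omega_zeroK.
  by rewrite dd_comp ?lens // -/w -wE w1 eqxx -dSE dS_ymono mulr1 dS_ymono.
rewrite dd_comp0 ?lens // mulr0 raddf0 -wE.
by case: (eqVneq w omega0) => // e; move: ne; rewrite e invs_omega0 eqxx.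
Qed.

(** The Schubert polynomials at Y = 0, where the kernel of the definition becomes
    x^delta Q~_(n,...,1). *)
Definition schub w : A := sg * dd (w^-1 * w0)%g (xdelta * q (rho n)).

(** For a permutation the operator factors through [dV], which sends the kernel to
    the monomial y. *)
Lemma schub_semb u : schub (semb u) = dd ((semb u)^-1 * omega0)%g ymono.
Proof.
have e : ((semb u)^-1 * w0 = (semb u)^-1 * omega0 * (omega0 * w0))%g.
  by rewrite mulgA -[(_ * omega0 * omega0)%g]mulgA omega_zeroK mulg1.
rewrite /schub e -dd_comp -?e.
  by rewrite -dVE dV_top dd_sign mulrA sgK mul1r.
have := invs_w_zero (semb u)^-1%g; rewrite invs_omega0_w0 -sembV invs_Momega0 -addnn.
move: (invs_semb_le u^-1); set a := invs (semb _); set b := invs (_ * _)%g.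
by move: a b (n_pairs _); lia.
Qed.

(** The substitution f(-x_n, ..., -x_1), which is the action of omega_0 w_0,
    conjugates the type A divided differences. *)
Definition phi f : A := wact A (omega0 * w0)%g f.

Let flip i : 'I_n := inord (n - i).

Let flip_neq0 i : i != 0%N :> nat -> flip i != 0%N :> nat.
Proof. by move=> i0; rewrite inordK; have := ltn_ord i; lia. Qed.

Let val_flip i : i != 0%N :> nat -> flip i = (n - i)%N :> nat.
Proof. by move=> i0; rewrite inordK //; have := ltn_ord i; lia. Qed.

Let simple_flip i : i != 0%N :> nat -> simple (flip i) = (omega0 * simple i * omega0)%g.
Proof.
move=> i0; have f0 := flip_neq0 i0; rewrite !simple_semb // omega_zeroE -!sembM.
congr semb; apply/permP => j; rewrite !permM !permE /= -!val_eqE /= val_flip //.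
have := ltn_ord i; have := ltn_ord j; move=> jn iN.
apply: val_inj; do ![case: eqP => ?] => /=; rewrite ?val_flip //; lia.
Qed.

Let phi_var i : phi (var A i) = - var A (rev_ord i).
Proof. by rewrite /phi wact_var /= mul1g permE !ffunE addbF expr1 mulN1r. Qed.

Let phi_dif i f : i != 0%N :> nat -> phi (dif i f) = dif (flip i) (phi f).
Proof.
move=> i0; apply/esym/dif_uniq.
have root : phi (sroot A i) = sroot A (flip i).
  rewrite /sroot (negPf i0) (negPf (flip_neq0 i0)) /phi rmorphB /= -!/(phi _) !phi_var.
  rewrite opprK addrC; congr (var A _ - var A _); apply: val_inj => /=.
    by rewrite val_flip //; have := ltn_ord i; lia.
  by rewrite val_flip //; have := ltn_ord i; lia.
rewrite -root /phi -rmorphM /= difP rmorphB /=; congr (_ - _).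
rewrite -!wactM; congr (wact A _ _).
by rewrite simple_flip // !mulgA -[(_ * omega0 * omega0)%g]mulgA omega_zeroK mulg1
  -[RHS]mulgA (w_zero_central (simple i)) mulgA.
Qed.

Lemma phi_dd t f : phi (dd (semb t) f) = dd (omega0 * semb t * omega0)%g (phi f).
Proof.
have [a [ea la za]] := semb_word t; rewrite -ea ddE; last by rewrite la ea.
have e : (omega0 * wprod a * omega0)%g = wprod (map flip a).
  elim: a za {ea la} => [|i a IH] /=; first by rewrite /wprod !big_nil mulg1 omega_zeroK.
  case/andP=> i0 za; rewrite -cat1s -[flip i :: _]cat1s !wprod_cat -IH // /wprod !big_seq1.
  rewrite simple_flip // !mulgA; congr (_ * _ * _)%g.
  by rewrite -[(_ * omega0 * omega0)%g]mulgA omega_zeroK mulg1.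
have l : size (map flip a) = invs (wprod (map flip a)).
  have et : (omega0 * semb t = semb (t * perm (@rev_ord_inj n)))%g by rewrite sembM.
  rewrite size_map la -e ea et invs_Momega0 -et invs_omega0M.
  by rewrite subKn // invs_semb_le.
rewrite e ddE //; elim: a za {ea la e l} => //= i a IH /andP[i0 za].
by rewrite phi_dif // IH.
Qed.

Lemma phi_ymono : phi ymono = sg * xdelta.
Proof.
rewrite /phi wactM; have -> : wact A w0 ymono = sg * ymono.
  rewrite -sum_ord -prodrXr -big_split /= rmorph_prod; apply: eq_bigr => i _.
  by rewrite rmorphXn /= wact_var /= ffunE perm1 expr1 mulN1r [LHS]exprNn.
by rewrite rmorphM rmorph_sign /= omega0_mono; congr (_ * _); apply: eq_mono.
Qed.

(** The substitution exchanges y and x^delta up to sign, and s_i and s_(n-i). *)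
Lemma phi_schub v : phi (schub (semb v * omega0)%g) = sg * dd (semb v)^-1%g xdelta.
Proof.
have e : (omega0 * semb (perm (@rev_ord_inj n) * (perm (@rev_ord_inj n) * v)^-1) * omega0
    = (semb v)^-1)%g.
  rewrite -omega_zeroM sembV -omega_zeroM invMg omega_zeroV.
  by rewrite !mulgA omega_zeroK mul1g -mulgA omega_zeroK mulg1.
by rewrite omega_zeroM schub_semb -sembV omega_zeroM phi_dd phi_ymono dd_sign e.
Qed.

Lemma dd_w0_sym f g : sym f -> dd w0 (f * g) = dV (f * dS g).
Proof. by move=> sf; rewrite dd_w0 dS_sym. Qed.

Lemma dV_nat (b : bool) f : dV (f * b%:R) = dV f * b%:R.
Proof. by case: b; rewrite ?mulr1 // !mulr0 raddf0. Qed.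

(** The Pfaffians are symmetric, so they come out of dS and leave a type A pairing,
    which is a constant; what remains is the orthogonality of the Pfaffians. *)
Lemma schub_orth u v l ms : strict n l -> strict n ms ->
  dd w0 (schub (semb u) * q l * (phi (schub (semb v * omega0)%g) * q ms)) =
  (u == v)%:R * (complementary N l ms)%:R.
Proof.
move=> sl sms; rewrite schub_semb phi_schub.
set f := dd _ ymono; set g := dd _ xdelta.
transitivity (dd w0 (q l * q ms * (sg * (f * g)))); first by congr (dd w0 _); ring.
rewrite dd_w0_sym; last by apply: symM; apply: sym_qpf.
by rewrite dS_sign /f /g type_A_orth [sg * (sg * _)]mulrA sgK mul1r dV_nat dV_qpf // mulrC.
Qed.

Lemma schub_dual u v l ms : strict n l -> strict n ms ->
  (invs (semb u) + invs (semb v) = np)%N ->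
  dd w0 (schub (semb u) * q l * (schub (semb v) * q ms)) =
  (semb v == omega0 * semb u)%g%:R * (complementary N l ms)%:R.
Proof.
move=> sl sms luv; rewrite !schub_semb.
set f := dd _ ymono; set g := dd ((semb v)^-1 * _)%g ymono.
rewrite mulrACA [_ * (q l * _)]mulrC dd_w0_sym; last by apply: symM; apply: sym_qpf.
by rewrite /f /g type_A_dual // dV_nat dV_qpf // mulrC.
Qed.

(** * Pairing the Schubert polynomials of increasing signed permutations *)

(** The part of [ddw (zw ms) (qpf l)] without variables as coefficients: the part
    removed by D_m is m itself. *)
Fixpoint contract ms l : A :=
  if ms is m :: ms' then delsum (fun p => (p == m)%:R) (contract ms') l else q l.

Lemma strict_size k l : strict k l -> (size l <= k)%N.
Proof.
move=> sl; rewrite -[k in X in (_ <= X)%N]size_rho; apply: uniq_leq_size.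
  exact: strict_uniq sl.
by move=> m ml; rewrite mem_rho; case/andP: sl => _ /allP; apply.
Qed.

(** In D_(m_1) ... D_(m_k) (q l) only the terms free of the variables survive
    the pairing with x^delta, because the coefficients are staircase monomials. *)
Lemma dS_zw ms l D g : strict n ms ->
  aspan (Mon (fun z : nat => z - count (leq^~ z) ms)%N D) g ->
  dS (xdelta * g * ddw (zw ms) (q l)) =
  if D == 0%N then g * (sg * contract ms l) else 0.
Proof.
elim: ms l D g => [|m ms IH] l D g sms sg_ /=.
  have {}sg_ : aspan (stair D) g.
    apply: aspan_sub sg_ => u [c [lc sc eu]]; exists c; split=> // i.
    by have := lc i; rewrite /= subn0.
  rewrite mulrC dS_sym; last exact: sym_qpf.
  case: D sg_ => [|D] sg_ /=; last by rewrite (dS_stair sg_) mulr0.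
  have [z ->] := aspan_const sg_.
  by rewrite mulrzr raddfMz /= dS_xdel -mulrzl; ring.
have sms' := strict_behead sms.
have [m0 mn] : (0 < m)%N /\ (m <= n)%N by case/andP: sms => _ /andP[/andP].
have smsn : strict n ms by apply: strict_subseq sms; apply: subseq_cons.
rewrite ddw_cat ddw_aw ?m0 // !delsumE raddf_sum /= big_distrr raddf_sum /=.
transitivity (\sum_(j < size l) (if D == 0%N then
    g * (sg * ((-1) ^+ j * (nth 0%N l j == m)%:R * contract ms (delete l j))) else 0));
  last by case: ifP => _; rewrite ?big1_eq // !big_distrr.
apply: eq_bigr => j _; set p := nth 0%N l j; set r := delete l j.
have ddw_c f h : (forall i, (i < m)%N -> wact A (simple i) h = h) ->
    ddw (zw ms) (h * f) = h * ddw (zw ms) f.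
  move=> hi; have : all (fun i : 'I_n => i < m)%N (zw ms).
    have := strict_le sms'; elim: (ms) => //= m' ms' IHm /andP[m'm /IHm].
    rewrite all_cat => -> /=; rewrite /aw all_rcons inordK //= m0 /=.
    have : (m'.-1 < m)%N by lia.
    elim: (m'.-1) => //= k IHk km; rewrite IHk ?(ltnW km) // andbT inordK //; lia.
  by elim: (zw ms) => //= i a IHa /andP[im am]; rewrite IHa // difMl // hi.
rewrite -[_ * q r]mulrA ddw_sign ddw_c; last first.
  by move=> i im; have := s_es (m := m) A m p (ltn_ord i); rewrite inord_val; apply; rewrite gtn_eqF.
rewrite mulrCA dS_sign.
transitivity ((-1) ^+ j * dS (xdelta * (g * es m m p) * ddw (zw ms) (q r))).
  by congr (_ * dS _); ring.
rewrite {1}/es; case: (leqP m p) => mp; last first.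
  by rewrite !mulr0 mul0r raddf0 mulr0 (ltn_eqF mp) !(mulr0, mul0r) if_same.
rewrite (IH _ (D + (p - m))%N) //; last first.
  apply: (aspan_mul _ sg_ (@aspan_ee N A m (p - m) mn)) => z /=.
  have := strict_size sms'; case: (leqP m z) => mz; last by lia.
  have := count_size (leq^~ z) ms; lia.
rewrite addn_eq0 subn_eq0; case: (eqVneq D 0%N) => [_|]; last by rewrite andFb mulr0.
case: (eqVneq p m) => [->|pm]; first by rewrite leqnn /= subnn ee0; ring.
by rewrite ifF ?mulr0n ?(mulr0, mul0r) //; apply/negbTE; rewrite -ltnNge ltn_neqAle eq_sym pm.
Qed.

Lemma delete_subseq (l : seq nat) p : subseq (delete l p) l.
Proof.
rewrite -[X in subseq _ X](cat_take_drop p) cat_subseq // -add1n -drop_drop.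
exact: drop_subseq.
Qed.

(** Only l = ms can be contracted to the empty list, which is the complement of
    (n, ..., 1). *)
Lemma dV_contract ms l : strict n ms -> strict n l ->
  dV (q (rho n) * contract ms l) = (l == ms)%:R.
Proof.
elim: ms l => [|m ms IH] l sms sl.
  rewrite dV_qpf ?strict_rho //; congr (nat_of_bool _)%:R.
  apply/allP/eqP => [h|-> p /= ->]; last by rewrite in_nil.
  apply: (@strict_eq n) => // p; rewrite in_nil; apply/negP => pl.
  have pr : p \in rho n by rewrite mem_rho; case/andP: sl => _ /allP; apply.
  by have := h p pr; rewrite pr pl.
have smsn : strict n ms by apply: strict_subseq sms; apply: subseq_cons.
rewrite /= delsumE big_distrr raddf_sum /=.
transitivity (\sum_(j < size l) ((l == m :: ms) && (j == 0%N :> nat))%:R : A).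
  apply: eq_bigr => j _; set p := nth 0%N l j; set r := delete l j.
  have sr : strict n r by apply: strict_subseq sl; apply: delete_subseq.
  have -> : q (rho n) * ((-1) ^+ j * (p == m)%:R * contract ms r) =
     (-1) ^+ j * (q (rho n) * contract ms r * (p == m)%:R) by ring.
  rewrite dV_sign dV_nat IH //; case: (eqVneq l (m :: ms)) => [el|ne] /=.
    case: (eqVneq (j : nat) 0%N) => [j0|j0].
      rewrite /p /r j0 el /= expr0 mul1r eqxx mulr1.
      by rewrite /delete take0 /= drop0 eqxx.
    have -> : p == m = false.
      have jl : (j < size (m :: ms))%N by rewrite -el.
      rewrite /p; move: (j : nat) j0 jl; rewrite el => k k0 kl; apply/negbTE.
      by rewrite -[X in _ != X]/(nth 0%N (m :: ms) 0) nth_uniq ?(strict_uniq sms).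
    by rewrite !mulr0.
  case: (eqVneq p m) => [pm|]; last by rewrite !mulr0.
  case: (eqVneq r ms) => [rm|]; last by rewrite mul0r mulr0.
  case/eqP: ne; apply: (strict_eq sl sms) => z.
  rewrite -[in LHS](cat_take_drop j l) (drop_nth 0%N) // -/p mem_cat !in_cons.
  by rewrite -rm mem_cat pm orbCA.
case: (eqVneq l (m :: ms)) => [->|_] /=; last by rewrite big1.
by rewrite big_ord_recl /= big1 ?addr0.
Qed.

Lemma complementary_sum ls ms : strict n ls -> strict n ms -> complementary N ls ms ->
  (sumn ls + sumn ms = np + n)%N.
Proof.
move=> sl sm /allP cl; rewrite -sumn_rho -sumn_cat; apply: perm_sumn.
have mem l : strict n l -> {subset l <= rho n}.
  by case/andP=> _ /allP h z /h; rewrite mem_rho.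
apply: uniq_perm; last 1 first.
- move=> z; rewrite mem_cat; case: (boolP (z \in rho n)) => zr.
    by have := cl z zr; case: (z \in ls); case: (z \in ms).
  by apply/negbTE; rewrite negb_or; apply/andP; split; apply: contra zr; apply: mem.
- rewrite cat_uniq (strict_uniq sl) (strict_uniq sm) andbT; apply/hasPn => z zm.
  by have := cl z (mem _ sm _ zm); rewrite zm; case: (z \in ls).
- exact: strict_uniq (strict_rho n).
Qed.

(** Two complementary lists index increasing signed permutations z and y related by
    w_0 z = y omega_0. As the lengths of z, y and omega_0 are bounded by the sizes of
    their words, which add up to the length of w_0, these words are reduced. *)
Section IncreasingPermutation.
Variables ls ms : seq nat.
Hypotheses (sls : strict n ls) (sms : strict n ms) (cls : complementary N ls ms).
Local Notation z := (wprod (zw ls)).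
Local Notation y := (wprod (zw ms)).
Hypothesis w0z : (w0 * z = y * omega0)%g.

Let pos l : strict n l -> all (ltn 0) l.
Proof. by case/andP=> _; apply: sub_all => m /andP[]. Qed.

Let invs_y : invs y = sumn ms.
Proof.
have lz : (invs z <= sumn ls)%N by rewrite -(size_zw N (pos sls)) invs_wprod.
have ly : (invs y <= sumn ms)%N by rewrite -(size_zw N (pos sms)) invs_wprod.
have := complementary_sum sls sms cls.
have := invs_mul_le y omega0; rewrite -w0z -w_zero_central invs_omega0.
have := invs_w_zero z; rewrite -addnn; lia.
Qed.

Let invs_yomega : invs (y * omega0)%g = (invs y + np)%N.
Proof.
apply/eqP; rewrite eqn_leq; apply/andP; split.
  by rewrite -[X in (_ <= _ + X)%N]invs_omega0 invs_mul_le.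
have lz : (invs z <= sumn ls)%N by rewrite -(size_zw N (pos sls)) invs_wprod.
have := complementary_sum sls sms cls.
have := invs_w_zero z; rewrite -w0z w_zero_central -addnn invs_y; lia.
Qed.

Let zw0 : (z^-1 * w0 = (y * omega0)^-1)%g.
Proof.
rewrite -w0z invMg; congr (_ * _)%g; apply/eqP.
by rewrite eq_sym eq_invg_mul w_zeroK.
Qed.

(** z^-1 w_0 = omega_0 y^-1 with lengths adding up, so the last operator applied is
    dS. *)
Lemma sym_schub_zw : sym (schub z).
Proof.
rewrite /schub zw0 invMg omega_zeroV -dd_comp -?dSE.
  by apply: symM; [move=> k _; rewrite rmorph_sign | exact: sym_dS].
by rewrite -{1}omega_zeroV -invMg !invsV invs_yomega invs_omega0 addnC.
Qed.

(** Pair with x^delta Q~_l in two ways. As [schub z] is symmetric, dS acts on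
    x^delta only; moving the operator of z^-1 w_0 to the other side instead gives
    the operators of omega_0 and then of y, which act on Q~_l by contraction. *)
Lemma schub_zw_pair l : strict n l -> dV (schub z * q l) = (l == ms)%:R.
Proof.
move=> sl; pose P := dd w0 (schub z * (xdelta * q l)).
have E1 : P = sg * dV (schub z * q l).
  rewrite /P [xdelta * _]mulrC mulrA dd_w0_sym; last first.
    by apply: symM; [exact: sym_schub_zw | exact: sym_qpf].
  by rewrite dS_xdel mulrC dV_sign.
have E2 : P = sg * (l == ms)%:R.
  rewrite /P /schub -mulrA dd_sign dd_adj zw0 invgK -dd_comp -?dSE; last first.
    by rewrite invs_yomega invs_omega0.
  rewrite [xdelta * q l]mulrC (dS_sym _ (@sym_qpf _ A l)) dS_xdel [q l * _]mulrC dd_sign.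
  rewrite [dd y _]ddE ?size_zw ?pos // dd_w0.
  have -> : xdelta * q (rho n) * (sg * ddw (zw ms) (q l)) =
     sg * (q (rho n) * (xdelta * 1 * ddw (zw ms) (q l))) by ring.
  rewrite dS_sign (dS_sym _ (@sym_qpf _ A (rho n))) (@dS_zw ms l 0) //=; last first.
    rewrite -(@mono_eq1 _ A (fun=> 0%N)) //; apply: aspan_mono; rewrite ?big1 //.
  rewrite mul1r.
  have -> : q (rho n) * (sg * contract ms l) = sg * (q (rho n) * contract ms l) by ring.
  by rewrite mulrA sgK mul1r dV_contract // mulrC.
have sg0 : sg != 0 by rewrite signr_eq0.
by apply: (mulfI sg0); rewrite -E1 E2.
Qed.

End IncreasingPermutation.

End Schubert.

(** * Strict partitions and increasing signed permutations *)

Section Parts.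
Variable N : nat.
Local Notation n := N.+1.
Implicit Types (L M : {set 'I_n}) (i : 'I_n) (ms : seq nat).
Local Notation w0 := (w_zero n).
Local Notation omega0 := (omega_zero n).
Local Notation zw := (zw N).

Lemma mem_parts L m : (m \in parts L) = (0 < m <= n)%N && (inord m.-1 \in L).
Proof.
rewrite /parts mem_rev; apply/mapP/andP => [[i iL ->]|[/andP[m0 mn] mL]].
  by rewrite /= ltn_ord inord_val -mem_enum.
by exists (inord m.-1); rewrite ?mem_enum //= inordK ?prednK.
Qed.

Lemma val_succ_enum L : [seq (val i).+1 | i <- enum L] =
  [seq k <- iota 1 n | (inord k.-1 : 'I_n) \in L].
Proof.
rewrite -[1%N]/(1 + 0)%N iotaDl -val_enum_ord -map_comp filter_map.
rewrite [in LHS]/enum_mem enumT; congr map; apply: eq_filter => i /=.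
by rewrite inord_val.
Qed.

Lemma strict_parts L : strict n (parts L).
Proof.
apply/andP; split; last by apply/allP => m; rewrite mem_parts => /andP[].
rewrite /parts rev_sorted val_succ_enum sorted_filter //; last exact: iota_ltn_sorted.
exact: ltn_trans.
Qed.

Lemma complementary_parts L M : complementary N (parts L) (parts M) = (M == ~: L).
Proof.
apply/allP/eqP => [h|-> m].
  apply/setP => i; have := h (val i).+1; rewrite mem_rho ltn_ord !mem_parts ltn_ord.
  by rewrite inord_val inE => /(_ isT) /=; case: (i \in L); case: (i \in M).
by rewrite mem_rho !mem_parts => ->; rewrite inE /=; case: (_ \in L).
Qed.

Lemma parts_setT : parts [set: 'I_n] = rho n.
Proof.
apply: (strict_eq (strict_parts _) (strict_rho n)) => m.
by rewrite mem_parts mem_rho inE andbT.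
Qed.

Lemma wlam_seqC L : wlam_seq (~: L) = rev (wlam_seq L).
Proof. by rewrite /wlam_seq setCK rev_cat revK. Qed.

Lemma w_zero_wlam L : (w0 * wlam L = wlam (~: L) * omega0)%g.
Proof.
have sz := size_wlam_seq L; apply: sperm_eq => i /=.
  rewrite mulg1 permM !permE /= wlam_seqC nth_rev ?sz //=; last by have := ltn_ord i; lia.
  rewrite -subSn ?ltn_ord // subSS subKn ?(ltnW (ltn_ord i)) //.
  by apply: set_nth_default; rewrite sz; have := ltn_ord i; lia.
rewrite !ffunE /= permE ?ffunE addbT -leqNgt /=.
have iN := ltn_ord i; have lN : (#|L| <= n)%N by rewrite -[n in (_ <= n)%N]card_ord max_card.
have -> : #|~: L| = (n - #|L|)%N by rewrite cardsCs setCK card_ord.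
by move: iN lN; move: (nat_of_ord i) #|L| => k c kn cn; apply/idP/idP; lia.
Qed.

(** The last word multiplied, that of the largest part m, moves the entry in
    position m to the front with a minus sign. This entry is m, because the first m
    positions contain exactly 1, ..., m up to sign, the positive ones in increasing
    order. *)
Lemma entry_zw ms i : strict n ms -> entry (wprod (zw ms)) i =
  nth 0 ([seq - m%:Z | m <- ms] ++ [seq m%:Z | m <- iota 1 n & m \notin ms]) i.
Proof.
elim: ms i => [|m ms IH] i sms.
  rewrite /wprod big_nil entry1 cat0s filter_predT (nth_map 0%N) ?size_iota //.
  by rewrite nth_iota // add1n.
have sms' := strict_behead sms.
have smsn : strict n ms by apply: strict_subseq sms; apply: subseq_cons.
have [m0 mn] : (0 < m)%N /\ (m <= n)%N by case/andP: sms => _ /andP[/andP].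
have lt k : k \in ms -> (0 < k < m)%N.
  by case/andP: sms' => _ /allP h /h; lia.
have split_iota : iota 1 n = iota 1 m.-1 ++ m :: iota m.+1 (n - m).
  have -> : (n = m.-1 + (n - m).+1)%N by lia.
  by rewrite iotaD add1n prednK //=; congr (_ ++ _ :: iota _ _); lia.
pose B := [seq k%:Z | k <- iota 1 m.-1 & k \notin ms].
pose C := [seq k%:Z | k <- iota m.+1 (n - m)].
pose a := [seq - k%:Z | k <- ms].
have fC : all (fun k => k \notin ms) (iota m.+1 (n - m)).
  by apply/allP => k; rewrite mem_iota => kC; apply/negP => /lt; lia.
have mms : m \notin ms by apply/negP => /lt; lia.
have e' : [seq k%:Z | k <- iota 1 n & k \notin ms] = B ++ m%:Z :: C.
  by rewrite split_iota filter_cat /= mms map_cat /= (all_filterP fC).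
have e : [seq k%:Z | k <- iota 1 n & k \notin m :: ms] = B ++ C.
  rewrite split_iota filter_cat /= mem_head /= map_cat; congr (map _ _ ++ _).
    apply: eq_in_filter => k; rewrite mem_iota in_cons => kB.
    by rewrite negb_or; case: eqP => // km; move: kB; rewrite km; lia.
  rewrite /C -[in RHS](all_filterP fC); congr map; apply: eq_in_filter => k.
  by rewrite mem_iota in_cons => kC; case: eqP => // km; move: kC; rewrite km ltnn.
have sB : size (a ++ B) = m.-1.
  rewrite size_cat !size_map size_filter.
  have := count_predC (mem ms) (iota 1 m.-1); rewrite size_iota => cp; rewrite -[RHS]cp.
  congr (_ + _)%N; rewrite -size_filter; apply: perm_size; apply: uniq_perm.
  - exact: strict_uniq sms'.
  - by rewrite filter_uniq ?iota_uniq.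
  - move=> k; rewrite mem_filter mem_iota /=; apply/idP/andP => [kms|[]//].
    by split=> //; have := lt _ kms; lia.
rewrite -[zw (m :: ms)]/(zw ms ++ aw N m) wprod_cat entry_aw ?m0 // e /= -/a !IH // e' -/a.
rewrite !catA inordK ?prednK //.
case: (eqVneq (i : nat) 0%N) => [->|i0] /=.
  by rewrite nth_cat sB ltnn subnn.
have iN := ltn_ord i; case: (ltnP i m) => im; first (rewrite inordK; last lia).
  case: (nat_of_ord i) i0 im => // k _ km; rewrite [RHS]/= !nth_cat !sB /=.
  by have -> : (k < m.-1)%N by lia.
case: (nat_of_ord i) i0 im => // k _ km; rewrite [RHS]/= !nth_cat !sB.
have -> : (k.+1 < m.-1)%N = false by lia.
have -> : (k < m.-1)%N = false by lia.
by have -> : (k.+1 - m.-1 = (k - m.-1).+1)%N by lia.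
Qed.

Lemma wlamE L : wlam L = wprod (zw (parts L)).
Proof.
apply: sperm_entryP => i; rewrite entry_zw ?strict_parts //.
have eC : [seq k <- iota 1 n | k \notin parts L] = [seq (val j).+1 | j <- enum (~: L)].
  rewrite val_succ_enum; apply: eq_in_filter => k; rewrite mem_iota mem_parts inE => /andP[k0 kn].
  by rewrite k0 -ltnS kn.
rewrite eC /parts -!map_rev -!map_comp.
have sz := size_wlam_seq L; have szr : size (rev (enum L)) = #|L| by rewrite size_rev cardE.
rewrite /entry /= permE ffunE /wlam_seq !nth_cat !size_map szr.
have szi : (i < size (rev (enum L) ++ enum (~: L)))%N by rewrite sz.
move: szi; rewrite size_cat szr; case: ifP => iL szi.
  by rewrite (nth_map i) ?szr //= mulN1r.
by rewrite (nth_map i) /= ?mul1r // -(ltn_add2l #|L|) subnKC // leqNgt iL.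
Qed.

End Parts.

(** * The dual bases *)

Section Basis.
Variables (N : nat) (A : weyl_ring N.+1).
Local Notation n := N.+1.
Implicit Types (f g h : A) (u v : 'S_n) (w : sperm n) (i : 'I_n) (L M : {set 'I_n}).
Local Notation q := (qpf (ee A 0)).
Local Notation np := (n_pairs n).
Local Notation w0 := (w_zero n).
Local Notation omega0 := (omega_zero n).
Local Notation zw := (zw N).
Local Notation xdelta := (xdel A n).
Local Notation "f %:F" := (tofrac f) : ring_scope.

(** Since the new letter is applied first, its coefficients are acted upon by the
    previous elements w, and no action on fractions is involved. *)
Lemma ddw_combination (a : seq 'I_n) : exists k : sperm n -> {fraction A},
  forall f, (ddw a f)%:F = \sum_w k w * (wact A w f)%:F.
Proof.
elim/last_ind: a => [|a i [k IH]].
  exists (fun w => (w == 1%g)%:R) => f.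
  rewrite (bigD1 1%g) //= eqxx mul1r wact1 big1 ?addr0 // => w /negPf ->.
  by rewrite mul0r.
pose r w := (wact A w (sroot A i))%:F.
have r0 w : r w != 0.
  rewrite tofrac_eq0; apply: contra (sroot_neq0 A i) => /eqP e; apply/eqP.
  by rewrite -[sroot A i](wact1) -(mulVg w) wactM e rmorph0.
exists (fun w => k w / r w - k (w * simple i)%g / r (w * simple i)%g) => f.
rewrite ddw_rcons IH.
transitivity (\sum_w k w / r w * (wact A w f)%:F -
              \sum_w k w / r w * (wact A (w * simple i)%g f)%:F).
  rewrite -sumrB; apply: eq_bigr => w _; rewrite -mulrBr -mulrA; congr (_ * _).
  have <- : (wact A w (dif i f))%:F * r w = (wact A w f)%:F - (wact A (w * simple i)%g f)%:F.
    by rewrite -tofracM -rmorphM /= difP rmorphB /= wactM tofracB.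
  by rewrite mulrC mulfK.
rewrite [X in _ - X](reindex_inj (mulIg (simple i))) /= -sumrB.
apply: eq_bigr => w _; rewrite mulrBl; congr (_ - _ * (wact A _ f)%:F).
by rewrite -mulgA simpleK mulg1.
Qed.

(** Two families of elements that are dual for the scalar product and are
    indexed by W_n: writing the scalar product as a combination of the w(f g) turns
    the duality into a product of two square matrices being 1, and the product in
    the other order gives the expansion. *)
Lemma dual_expansion (b c : sperm n -> A) :
  (forall u v : sperm n, dd w0 (b u * c v) = (u == v)%:R) ->
  forall f, f = \sum_(v : sperm n) dd w0 (f * c v) * b v.
Proof.
move=> bc f; have [k kE] := ddw_combination (reduced_word w0).
have {}kE g : (dd w0 g)%:F = \sum_w k w * (wact A w g)%:F by apply: kE.
set m := #|{: sperm n}|.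
pose P : 'M[{fraction A}]_m := \matrix_(i, j)
  (k (enum_val j) * (wact A (enum_val j) (b (enum_val i)))%:F).
pose Q : 'M[{fraction A}]_m := \matrix_(i, j)
  (wact A (enum_val i) (c (enum_val j)))%:F.
have PQ : P *m Q = 1%:M.
  apply/matrixP => i j; rewrite !mxE -(inj_eq enum_val_inj).
  rewrite -[RHS](rmorph_nat (@tofrac A)) -bc [RHS]kE (reindex (fun z : 'I_m => enum_val z)) /=; last first.
    by exists enum_rank => z _; rewrite ?enum_valK ?enum_rankK.
  by apply: eq_bigr => z _; rewrite !mxE rmorphM /= tofracM mulrA.
have QP := mulmx1C PQ.
have entry w : \sum_(v : sperm n) (wact A w (c v))%:F * (k 1%g * (b v)%:F) = (w == 1%g)%:R.
  have /matrixP/(_ (enum_rank w) (enum_rank 1%g)) := QP.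
  rewrite !mxE (inj_eq enum_rank_inj) => <-.
  rewrite (reindex (fun z : 'I_m => enum_val z)) /=; last first.
    by exists enum_rank => z _; rewrite ?enum_valK ?enum_rankK.
  by apply: eq_bigr => z _; rewrite !mxE !enum_rankK wact1.
have k1 : k 1%g != 0.
  apply/eqP => k0; move/eqP: (entry 1%g); rewrite eqxx big1 => [|v _].
    by rewrite eq_sym oner_eq0.
  by rewrite k0 mul0r mulr0.
apply/eqP; rewrite -tofrac_eq; apply/eqP; apply: (mulfI k1).
rewrite raddf_sum /= mulr_sumr.
transitivity (\sum_(v : sperm n) \sum_w k w * (wact A w f)%:F * ((wact A w (c v))%:F * (k 1%g * (b v)%:F)));
  last first.
  apply: eq_bigr => v _; rewrite tofracM kE mulrCA mulr_suml; apply: eq_bigr => w _.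
  by rewrite rmorphM /= tofracM; ring.
rewrite exchange_big /= (bigD1 1%g) //= -mulr_sumr entry eqxx mulr1 wact1.
by rewrite big1 ?addr0 // => w /negPf w1; rewrite -mulr_sumr entry w1 mulr0.
Qed.

(** The products of the theorem and their duals, with the Schubert polynomials of
    increasing signed permutations already replaced by Pfaffians. *)
Definition bas u L : A := schub A (semb u) * q (parts L).
Definition cobas u L : A := phi (schub A (semb u * omega0)%g) * q (parts (~: L)).

Lemma bas_orth u v L M : dd w0 (bas u L * cobas v M) = (u == v)%:R * (L == M)%:R.
Proof.
rewrite schub_orth ?strict_parts // complementary_parts.
by rewrite (inj_eq (@setC_inj _)) [M == L]eq_sym.
Qed.

Lemma bas_dual u v L M : (invs (semb u) + invs (semb v) = np)%N ->
  dd w0 (bas u L * bas v M) = (semb v == omega0 * semb u)%g%:R * (M == ~: L)%:R.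
Proof. by move=> luv; rewrite schub_dual ?strict_parts // complementary_parts. Qed.

(** The index set of the basis is as large as W_n, which is what makes the matrices
    of [dual_expansion] square. *)
Lemma bas_expansion f :
  f = \sum_(p : 'S_n * {set 'I_n}) dd w0 (f * cobas p.1 p.2) * bas p.1 p.2.
Proof.
pose to w := (sabs w, [set i | sbar w i]).
pose back (p : 'S_n * {set 'I_n}) := SPerm p.1 [ffun i => i \in p.2].
have toK : cancel to back.
  by move=> w; apply: sperm_eq => i //=; rewrite ffunE inE.
have backK : cancel back to.
  by case=> u L; congr pair; apply/setP => i; rewrite inE ffunE.
have orth (u v : sperm n) : dd w0 (bas (to u).1 (to u).2 * cobas (to v).1 (to v).2) = (u == v)%:R.
  by rewrite bas_orth -natrM mulnb -(inj_eq (can_inj toK)).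
rewrite {1}(dual_expansion orth f) (reindex to) //.
by exists back => z _; rewrite ?toK ?backK.
Qed.

Lemma bas_free (c : 'S_n * {set 'I_n} -> A) : (forall p, winv (c p)) ->
  \sum_p c p * bas p.1 p.2 = 0 -> forall p, c p = 0.
Proof.
move=> wc s0 [v M].
have : dd w0 ((\sum_p c p * bas p.1 p.2) * cobas v M) = 0 by rewrite s0 mul0r raddf0.
rewrite mulr_suml raddf_sum /= (bigD1 (v, M)) //= big1 ?addr0 => [|[u L] ne].
  by rewrite -mulrA [dd _ _]ddw_winv // -/(dd _ _) bas_orth !eqxx !mulr1.
rewrite -mulrA [dd _ _]ddw_winv // -/(dd _ _) bas_orth -natrM mulnb.
by move: ne; rewrite xpair_eqE => /negPf ->; rewrite mulr0.
Qed.

Lemma dd_unit w : w != 1%g -> dd w (1 : A) = 0.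
Proof.
move=> w1; case: (pickP (descent w)) => [i di|nd].
  by rewrite (dd_descent _ di) (dif_eq0 (f := 1)) ?rmorph1 ?raddf0.
by case/eqP: w1; apply: no_descent => i; rewrite nd.
Qed.

Lemma dd_w0_cobas v L f : sym f -> dV (f * q (parts (~: L))) = 0 ->
  dd w0 (f * cobas v L) = 0.
Proof.
move=> sf f0; rewrite /cobas phi_schub [_ * q _]mulrC mulrA dd_w0_sym; last first.
  by apply: symM => //; apply: sym_qpf.
rewrite dS_sign -[dd _ _]mulr1 -sembV dS_adj invgK.
case: (eqVneq (semb v) 1%g) => [->|v1]; last by rewrite dd_unit // mulr0 raddf0 !mulr0 raddf0.
by rewrite dd1 mulr1 dS_xdel sgK mulr1.
Qed.

(** The pairing of a symmetric f with a dual element reduces to dV, because x^delta is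
    the only d_(v^-1) x^delta that dS does not kill; so all coefficients of the
    expansion of f vanish. *)
Lemma sym_dV_inj f : sym f -> (forall L, dV (f * q (parts L)) = 0) -> f = 0.
Proof.
move=> sf f0; rewrite (bas_expansion f) big1 // => p _.
by rewrite dd_w0_cobas ?mul0r.
Qed.

(** Both sides are symmetric and have the same pairings with all Pfaffians. *)
Theorem schub_wlam L : schub A (wlam L) = q (parts L).
Proof.
have w0z : (w0 * wprod (zw (parts L)) = wprod (zw (parts (~: L))) * omega0)%g.
  by rewrite -!wlamE w_zero_wlam.
have cl : complementary N (parts L) (parts (~: L)) by rewrite complementary_parts.
have sL := strict_parts L; have sC := strict_parts (~: L).
rewrite wlamE; apply/eqP; rewrite -subr_eq0; apply/eqP; apply: sym_dV_inj.
  by move=> k kn; rewrite rmorphB /= (sym_schub_zw A sL sC cl w0z) ?sym_qpf.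
move=> M; rewrite mulrBl raddfB /= (schub_zw_pair A sL sC cl w0z) ?strict_parts //.
rewrite dV_qpf ?strict_parts // complementary_parts; apply/eqP; rewrite subr_eq0.
apply/eqP; congr (nat_of_bool _)%:R; apply/eqP/eqP => [e|-> //].
by apply/setP => i; have := mem_parts (~: L) i.+1; rewrite -e mem_parts ltn_ord /= inord_val.
Qed.

End Basis.

(** * The polynomial ring *)

Section PolynomialAction.
Variables (n : nat) (R : idomainType).
Implicit Types (f g : {mpoly R[n]}) (u v w : sperm n) (i j : 'I_n).

Lemma mpoly_morph_ext (B : comNzRingType) (F G : {rmorphism {mpoly R[n]} -> B}) :
  (forall c, F c%:MP = G c%:MP) -> (forall i, F 'X_i = G 'X_i) -> F =1 G.
Proof.
move=> FC FX; elim/mpolyind => [|c m p _ _ IH]; first by rewrite !rmorph0.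
rewrite !rmorphD /= IH -mul_mpolyC !rmorphM /= FC; congr (_ * _ + _).
rewrite mpolyXE_id !rmorph_prod; apply: eq_bigr => i _.
by rewrite !rmorphXn /= FX.
Qed.

Lemma sactC w c : sact w c%:MP = c%:MP :> {mpoly R[n]}.
Proof. by rewrite /sact comp_mpolyC. Qed.

Lemma sactM u v f : sact (u * v)%g f = sact u (sact v f).
Proof.
pose F : {rmorphism {mpoly R[n]} -> {mpoly R[n]}} := sact u \o sact v.
rewrite -[RHS]/(F f); apply: mpoly_morph_ext => [c|i] /=.
  by rewrite !sactC.
by rewrite !sactX rmorphM rmorph_sign /= sactX /= permM ffunE signr_addb mulrA.
Qed.

Lemma sact1 f : sact 1%g f = f.
Proof.
rewrite -[RHS]/(idfun f); apply: mpoly_morph_ext => [c|i] /=; first exact: sactC.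
by rewrite sactX /= ffunE perm1 mul1r.
Qed.

Lemma mpolyXU_neq0 i : 'X_i != 0 :> {mpoly R[n]}.
Proof.
apply/eqP => /(congr1 (fun p : {mpoly R[n]} => p@_U_(i))).
by rewrite mcoeffXU eqxx mcoeff0 => /eqP; rewrite oner_eq0.
Qed.

Lemma mpolyXU_inj : injective (fun i => 'X_i : {mpoly R[n]}).
Proof.
move=> i j /(congr1 (fun p : {mpoly R[n]} => p@_U_(i))).
rewrite !mcoeffXU eqxx; case: eqP => [-> //|_ /eqP].
by rewrite oner_eq0.
Qed.

Lemma divdiff'P i f : divdiff' i f *
   (if i == 0%N :> nat then 2%:R * 'X_i else 'X_i - 'X_(prev_ord i)) =
  f - sact (simple i) f.
Proof.
rewrite /divdiff' -divdiffP /droot; case: ifP => // _.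
by rewrite mulNr -mulrN opprB.
Qed.

End PolynomialAction.

Section Instance.
Variables (n : nat) (R : idomainType).
Hypothesis two_neq0 : 2%:R != 0 :> R.

Fact mpoly_two_neq0 : 2%:R != 0 :> {mpoly R[n]}.
Proof. by rewrite -mpolyC_nat mpolyC_eq0. Qed.

Definition mpoly_weyl : weyl_ring n :=
  @WeylRing n {mpoly R[n]} (fun w => sact w) (fun i => 'X_i) (@divdiff' n R)
   (@sactM n R) (@sact1 n R) (@sactX n R) mpoly_two_neq0 (@mpolyXU_neq0 n R)
   (@mpolyXU_inj n R) (@divdiff'P n R).

End Instance.

Lemma ee_sum N (A : weyl_ring N.+1) p :
  ee A 0 p = \sum_(J : {set 'I_N.+1} | #|J| == p) \prod_(i in J) var A i.
Proof.
rewrite /ee /egen big_mkord.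
rewrite (eq_bigr (fun i => var A i *: 'X + 1)) => [|i _]; last by rewrite inord_val addrC.
rewrite bigA_distr coef_sum [RHS]big_mkcond /=; apply: eq_bigr => J _.
rewrite -big_mkcond /=.
transitivity (((\prod_(i in J) var A i) *: 'X^#|J|)`_p).
  congr (polyseq _)`_p; rewrite -prodr_const -scaler_prod.
  by apply: eq_bigr.
by rewrite coefZ coefXn eq_sym; case: eqP; rewrite ?mulr1 ?mulr0.
Qed.

Section Connection.
Variable N : nat.
Local Notation n := N.+1.
Local Notation P := {mpoly int[n]}.
Local Notation PP := {mpoly {mpoly int[n]}[n]}.
Implicit Types (f g : P) (w : sperm n) (i : 'I_n) (L : {set 'I_n}).

Fact int_two_neq0 : 2%:R != 0 :> int. Proof. by []. Qed.

Definition intX : weyl_ring n := mpoly_weyl n int_two_neq0.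
Local Notation q := (qpf (ee intX 0)).

Lemma mesym_ee p : mesym n int p = ee intX 0 p.
Proof. by rewrite ee_sum. Qed.

Lemma Qtilde_qpf (R : comNzRingType) l : Qtilde n R l = qpf (mesym n R) l.
Proof. by []. Qed.

Lemma Qtilde_q l : Qtilde n int l = q l.
Proof. by rewrite Qtilde_qpf; apply: eq_qpf => p; apply: mesym_ee. Qed.

Local Notation ev := (map_mpoly (meval (fun=> 0 : int)) : PP -> P).

Lemma ev_sact w (f : PP) : ev (sact w f) = sact w (ev f).
Proof.
pose F : {rmorphism PP -> P} := ev \o sact w.
pose G : {rmorphism PP -> P} := sact w \o ev.
rewrite -[LHS]/(F f) -[RHS]/(G f); apply: mpoly_morph_ext => [c|i] /=.
  by rewrite sactC map_mpolyC /= sactC.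
by rewrite sactX rmorphM rmorph_sign /= !map_mpolyX sactX.
Qed.

(** Setting Y = 0 commutes with the divided differences in X, because it commutes
    with the action and they are characterized by their denominators. *)
Lemma ev_divdiff' i (f : PP) : ev (divdiff' i f) = divdiff' i (ev f).
Proof.
apply/esym/(@dif_uniq n intX).
rewrite -[wact intX _ _]/(sact (simple i) (ev f)) -ev_sact -rmorphB /= -divdiff'P rmorphM /=.
congr (_ * _); rewrite /sroot /=; case: ifP => _.
  by rewrite rmorphM rmorph_nat /= map_mpolyX.
by rewrite rmorphB /= !map_mpolyX.
Qed.

Lemma ev_divdiffw' w (f : PP) : ev (divdiffw' w f) = dd (A := intX) w (ev f).
Proof.
rewrite /divdiffw' /dd /ddw; elim: (tval _) => //= i a IH.
by rewrite ev_divdiff' IH.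
Qed.

Lemma ev_Delta : ev (DeltaXY n) = xdel intX n.
Proof.
rewrite /DeltaXY rmorph_prod /xdel /mono; apply: eq_bigr => i _.
rewrite rmorph_prod /=.
rewrite (eq_bigr (fun=> 'X_i)) => [|j _]; last first.
  by rewrite rmorphB /= map_mpolyX map_mpolyC /= mevalXU mpolyC0 subr0.
rewrite (eq_bigl (fun j : 'I_n => j < n.-1 - i)%N) => [|j]; last first.
  by have := ltn_ord i; move=> /= iN; apply/idP/idP; lia.
rewrite -(big_ord_widen n (fun=> 'X_i)) ?prodr_const ?card_ord //.
by rewrite (leq_trans (leq_subr _ _)).
Qed.

Lemma ev_Qtilde l : ev (Qtilde n P l) = Qtilde n int l.
Proof.
rewrite !Qtilde_qpf rmorph_qpf; apply: eq_qpf => p /=.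
rewrite /mesym rmorph_sum; apply: eq_bigr => J _.
by rewrite rmorph_prod; apply: eq_bigr => i _ /=; rewrite map_mpolyX.
Qed.

(** Only e_0 survives at 0, so all summands of Q~(X, 0) vanish but the one with an
    empty second partition. *)
Lemma meval0_Qtilde l : all (ltn 0) l ->
  meval (fun=> 0) (Qtilde n int l) = (l == [::])%:R :> int.
Proof.
have e p : meval (fun=> 0 : int) (mesym n int p) = (p == 0%N)%:R.
  case: p => [|p]; first by rewrite mesym0E rmorph1.
  rewrite /mesym rmorph_sum /= big1 // => J /eqP cJ.
  have [i iJ] : exists i, i \in J by apply/set0Pn; rewrite -card_gt0 cJ.
  by rewrite rmorph_prod (bigD1 i) //= mevalXU mul0r.
rewrite Qtilde_qpf rmorph_qpf.
case: l => [|a l] /=; first by rewrite qpf_nil.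
case/andP=> a0 _; rewrite qpf_cons /= e // (gtn_eqF a0) mul0r add0r.
rewrite (@eq_delsumc _ _ (fun=> 0)) => [|b _]; last first.
  rewrite /cross big1_seq // => k; rewrite mem_index_iota => /andP[_ /andP[k0 _]].
  by rewrite /= e gtn_eqF ?mul0r ?mulr0 // addn_gt0 a0.
suff -> F : delsum (fun=> 0 : int) F l = 0 by rewrite mulr0.
by elim: l F => //= b l IH F; rewrite IH mul0r subr0.
Qed.

Lemma ev_QtildeXY : ev (QtildeXY n) = q (rho n).
Proof.
have p0 : parts (set0 : {set 'I_n}) = [::] by rewrite /parts enum_set0.
rewrite /QtildeXY rmorph_sum (bigD1 setT) //= big1 => [|L LT].
  rewrite rmorphM /= ev_Qtilde map_mpolyC /= setCT p0 meval0_Qtilde //.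
  by rewrite mulr1 addr0 parts_setT Qtilde_q.
rewrite rmorphM /= map_mpolyC /= meval0_Qtilde; last first.
  by apply/allP => m; rewrite mem_parts => /andP[/andP[]].
have -> : parts (~: L) == [::] = false.
  apply/negbTE; apply: contra LT => /eqP e; apply/eqP/setP => i; rewrite !inE.
  by have := mem_parts (~: L) i.+1; rewrite e in_nil ltn_ord inord_val inE => /esym/negbFE.
by rewrite mpolyC0 mulr0.
Qed.

Lemma schubertE w : schubert w = schub intX w.
Proof.
rewrite /schubert /schubertXY rmorphM rmorph_sign /= ev_divdiffw' rmorphM /=.
by rewrite ev_Delta ev_QtildeXY -n_pairsE.
Qed.

Lemma odd_sabs_wprod (a : seq 'I_n) :
  odd_perm (sabs (wprod a)) = odd (count (fun i => i != 0%N :> nat) a).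
Proof.
elim: a => [|i a IH]; first by rewrite /wprod big_nil odd_perm1.
rewrite -cat1s wprod_cat /wprod big_seq1 /= odd_permM -/(wprod a) IH addbC oddD.
congr (_ (+) _); rewrite /simple; case: eqP => i0 /=; first by rewrite odd_perm1.
by rewrite odd_tperm -val_eqE /=; have -> : i.-1 != i by lia.
Qed.

(** The two normalizations of divided differences differ by the sign of each letter
    other than s_0; for w_0 these letters are even in number, as its underlying
    permutation is the identity. *)
Lemma foldr_divdiff (a : seq 'I_n) f : foldr (@divdiff n int) f a =
  (-1) ^+ count (fun i => i != 0%N :> nat) a * ddw (A := intX) a f.
Proof.
elim: a => [|i a IH] /=; first by rewrite mul1r.
have dN k g : divdiff' i ((-1) ^+ k * g) = (-1) ^+ k * divdiff' i g.
  exact: (@ddw_sign N intX [:: i]).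
have e g : divdiff i g = (-1) ^+ (i != 0%N :> nat) * divdiff' i g.
  by rewrite /divdiff'; case: eqP => _; rewrite ?mul1r // mulrNN mul1r.
by rewrite IH e dN mulrA -exprD.
Qed.

Lemma scalar_prodE f g : scalar_prod f g = dd (A := intX) (w_zero n) (f * g).
Proof.
rewrite /scalar_prod /divdiffw foldr_divdiff -signr_odd -odd_sabs_wprod.
by rewrite reduced_wordP odd_perm1 mul1r.
Qed.

Lemma neg_revE f : neg_rev f = phi (A := intX) f.
Proof.
rewrite /neg_rev -[phi _]/(sact _ f) /sact; congr (_ \mPo _).
apply: eq_mktuple => i; rewrite /= mul1g permE !ffunE addbF.
by rewrite expr1 mulN1r.
Qed.

Lemma winvP f : reflect (winv (A := intX) f) (f \in weyl_inv n).
Proof.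
rewrite inE; apply: (iffP forallP) => [fw k kn|fs w]; first exact/eqP/fw.
rewrite -[sact w f]/(wact intX w f) -(reduced_wordP w); apply/eqP.
elim: (tval _) => [|i a IH]; first by rewrite /wprod big_nil wact1.
rewrite -cat1s wprod_cat wactM IH /wprod big_seq1.
by have := fs i (ltn_ord i); rewrite inord_val.
Qed.

Lemma schubert_basE (u : 'S_n) L : schubert (semb u) * schubert_lam L = bas intX u L.
Proof. by rewrite /schubert_lam !schubertE schub_wlam. Qed.

Lemma schubert_cobasE (u : 'S_n) L :
  neg_rev (schubert (semb u * omega_zero n)%g) * schubert_lam (~: L) = cobas intX u L.
Proof. by rewrite /schubert_lam neg_revE !schubertE schub_wlam. Qed.

End Connection.

Theorem proposition1 (n : nat) (hn : (0 < n)%N) :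
  [/\ is_basis_over (weyl_inv n)
        (fun p : 'S_n * {set 'I_n} =>
           schubert (semb p.1) * schubert_lam p.2),
      forall (u v : 'S_n) (L M : {set 'I_n}),
        scalar_prod
          (schubert (semb u) * schubert_lam L)
          (neg_rev (schubert (semb v * omega_zero n)%g) * schubert_lam (~: M))
        = (u == v)%:R * (L == M)%:R
    & forall (u v : 'S_n) (L M : {set 'I_n}),
        (slength (semb u) + slength (semb v) = (n * n.-1)./2)%N ->
        scalar_prod (schubert2 u L) (schubert2 v M)
        = if (semb v == omega_zero n * semb u)%g && (M == ~: L) then 1 else 0].
Proof.
case: n hn => // N _; split=> [|u v L M|u v L M].
- split=> [c wc s0 p|f].
    apply: (@bas_free N (intX N) c) => [z|]; first exact/winvP/wc.
    by rewrite -[RHS]s0; apply: eq_bigr => z _; rewrite schubert_basE.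
  exists (fun p => dd (A := intX N) (w_zero _) (f * cobas (intX N) p.1 p.2)).
  split=> [p|]; first exact/winvP/winv_dd_w0.
  rewrite [LHS](bas_expansion (A := intX N) f); apply: eq_bigr => z _.
  by rewrite schubert_basE.
- by rewrite scalar_prodE schubert_basE schubert_cobasE bas_orth.
- rewrite !slengthE -n_pairsE => luv.
  rewrite scalar_prodE.
  rewrite [schubert2 u L]schubert_basE [schubert2 v M]schubert_basE.
  rewrite (bas_dual _ _ _ luv).
  by case: (_ == _); case: (_ == _); rewrite ?mulr1 ?mulr0.
Qed.
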